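(* Let $k\ge0$ and let $A:\mathcal{D}(A)\subset L^2_{-1,-1}(-1,1)\to L^2_{-1,-1}(-1,1)$ be the operator $Af=\ell[f]$ with domain $\mathcal{D}(A)=\Delta$. Then $A$ is an unbounded, self-adjoint operator in $L^2_{-1,-1}(-1,1)$ with spectrum $$\sigma(A)=\{n(n-1)+k\mid n=2,3,\ldots\}.$$
   Context: $L^2_{-1,-1}(-1,1)=L^2((-1,1);(1-x^2)^{-1})$ is the weighted Hilbert space with inner product $(f,g)_{-1,-1}=\int_{-1}^1 f(x)\overline{g}(x)(1-x^2)^{-1}dx$. The Jacobi differential expression is $\ell[y](x)=-(1-x^2)y''(x)+ky(x)$ for $x\in(-1,1)$. The maximal domain is $$\Delta=\{f:(-1,1)\to\mathbb{C}\mid f,f'\in AC_{\mathrm{loc}}(-1,1);\ f,\ell[f]\in L^2_{-1,-1}(-1,1)\},$$ where $AC_{\mathrm{loc}}(-1,1)$ denotes functions absolutely continuous on every compact subinterval of $(-1,1)$. *)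

(* Defs.v *)
From HB Require Import structures.
From mathcomp Require Import all_boot all_order all_algebra.
From mathcomp Require Import sesquilinear generic_quotient ring_quotient.
From mathcomp Require Import all_classical all_reals all_analysis.
From mathcomp Require Import measurable_realfun complex.
From mathcomp Require Import ring lra.

Set Implicit Arguments.
Unset Strict Implicit.
Unset Printing Implicit Defensive.

Import Order.TTheory GRing.Theory Num.Theory Num.Def.
Import numFieldNormedType.Exports.
Import ComplexField.Normc.

Local Open Scope classical_set_scope.
Local Open Scope ring_scope.

(* Unbounded operators on a complex inner product space H are represented by
   their graphs, that is by subsets T of H * H. *)
Section unbounded_operators.
Context {C : numClosedFieldType} {H : lmodType C}.
Variable dot : {dot H for conjC}.
Implicit Types (T : set (H * H)) (f g h : H) (l : C).

Definition hnorm f : C := sqrtC (dot f f).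

Definition op_dom T : set H := [set f | exists g, T (f, g)].

Definition linear_operator T : Prop :=
  [/\ T (0, 0),
      forall l u v, T u -> T v -> T (l *: u.1 + v.1, l *: u.2 + v.2) &
      forall f g h, T (f, g) -> T (f, h) -> g = h].

Definition bounded_operator T : Prop :=
  exists2 M : C, 0 <= M & forall f g, T (f, g) -> hnorm g <= M * hnorm f.

Definition unbounded_operator T : Prop :=
  linear_operator T /\ ~ bounded_operator T.

Definition densely_defined T : Prop :=
  forall h (e : C), 0 < e -> exists2 f, op_dom T f & hnorm (h - f) < e.

(* For a densely defined T this is the graph of the Hilbert space adjoint:
   (g, h) is in it iff (T f, g) = (f, h) for all f in the domain of T. *)
Definition adjoint T : set (H * H) :=
  [set gh | forall f Tf, T (f, Tf) -> dot Tf gh.1 = dot f gh.2].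

Definition self_adjoint T : Prop :=
  [/\ linear_operator T, densely_defined T & adjoint T = T].

(* The graph of the relation (T - l)^-1. *)
Definition resolvent T l : set (H * H) :=
  [set hf | exists2 g, T (hf.2, g) & hf.1 = g - l *: hf.2].

(* T - l is a bijection from the domain of T onto H with bounded inverse. *)
Definition resolvent_set T : set C :=
  [set l | (forall h, exists! f, resolvent T l (h, f)) /\
           bounded_operator (resolvent T l)].

Definition spectrum T : set C := ~` resolvent_set T.

End unbounded_operators.

Section weighted_L2.
Context {R : realType}.
Local Notation C := R[i].
Local Notation mu := (@lebesgue_measure R).
Implicit Types (f g h : R -> C) (x : R).

(* Functions on (-1, 1) are represented by total functions on R whose values
   outside of (-1, 1) are irrelevant. *)
Definition itv11 : set R := `]-1, 1[.

Definition weight x : R := (1 - x ^+ 2)^-1.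

Definition eq_ae f g : Prop := f = g %[ae mu in itv11].

Definition cintegral f : C :=
  ((\int[mu]_(x in itv11) complex.Re (f x)) +i*
   (\int[mu]_(x in itv11) complex.Im (f x)))%C.

Definition wdot f g : C :=
  cintegral (fun x => f x * (g x)^*%C * (weight x)%:C%C).

Definition square_integrable f : Prop :=
  [/\ measurable_fun itv11 (fun x => complex.Re (f x)),
      measurable_fun itv11 (fun x => complex.Im (f x)) &
      (\int[mu]_(x in itv11) (normc (f x) ^+ 2 * weight x)%:E < +oo)%E].

#[local] Instance ae_lebesgue_filter : Filter (nbhs (almost_everywhere mu)) :=
  ae_filter_ringOfSetsType mu.

Lemma itv11P x : itv11 x <-> (-1 < x < 1).
Proof. by rewrite /itv11/= in_itv. Qed.

Lemma measurable_itv11 : measurable itv11.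
Proof. exact: measurable_itv. Qed.
#[local] Hint Resolve measurable_itv11 : core.

Lemma weight_gt0 x : itv11 x -> 0 < weight x.
Proof. by move=> /itv11P xI; rewrite /weight invr_gt0; nra. Qed.

Lemma measurable_weight : measurable_fun itv11 weight.
Proof.
apply: open_continuous_measurable_fun; first exact: itv_open.
move=> x; rewrite inE => /itv11P xI.
rewrite /continuous_at /weight; apply: cvgV; first by rewrite gt_eqF//; nra.
by apply: cvgB; [exact: cvg_cst|exact: exprn_continuous].
Qed.
#[local] Hint Resolve measurable_weight : core.

Lemma sqr_normc (z : C) : normc z ^+ 2 = complex.Re z ^+ 2 + complex.Im z ^+ 2.
Proof. by case: z => a b /=; rewrite sqr_sqrtr// addr_ge0// sqr_ge0. Qed.

Lemma measurable_sqr_normc f :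
  measurable_fun itv11 (fun x => complex.Re (f x)) ->
  measurable_fun itv11 (fun x => complex.Im (f x)) ->
  measurable_fun itv11 (fun x => normc (f x) ^+ 2 * weight x).
Proof.
move=> mr mi; apply: measurable_funM => //.
rewrite (_ : (fun x => _) = (fun x => complex.Re (f x) ^+ 2 + complex.Im (f x) ^+ 2)).
  by apply: measurable_funD; exact: measurable_funX.
by apply/funext => x; rewrite sqr_normc.
Qed.

Lemma square_integrableP f : square_integrable f <->
  [/\ measurable_fun itv11 (fun x => complex.Re (f x)),
      measurable_fun itv11 (fun x => complex.Im (f x)) &
      mu.-integrable itv11 (fun x => (normc (f x) ^+ 2 * weight x)%:E)].
Proof.
have E : (\int[mu]_(x in itv11) `|(normc (f x) ^+ 2 * weight x)%:E| =
          \int[mu]_(x in itv11) (normc (f x) ^+ 2 * weight x)%:E)%E.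
  apply: eq_integral => x; rewrite inE => xI.
  by rewrite gee0_abs// lee_fin mulr_ge0// ?sqr_ge0// ltW// weight_gt0.
split=> -[mr mi fi]; split=> //.
  apply/integrableP; split; last by rewrite E.
  by apply/measurable_EFinP; exact: measurable_sqr_normc.
by move/integrableP : fi => [_]; rewrite E.
Qed.

Lemma dominated_integrable (u : R -> R) f g (c : R) :
  square_integrable f -> square_integrable g ->
  measurable_fun itv11 u ->
  (forall x, itv11 x ->
    `|u x| <= c * (normc (f x) ^+ 2 + normc (g x) ^+ 2) * weight x) ->
  mu.-integrable itv11 (EFin \o u).
Proof.
move=> /square_integrableP[_ _ fi] /square_integrableP[_ _ gi] mu_ ub.
apply: (@le_integrable _ _ _ mu _ _ _ (fun x =>
  c%:E * ((normc (f x) ^+ 2 * weight x)%:E + (normc (g x) ^+ 2 * weight x)%:E))%E) => //.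
- exact/measurable_EFinP.
- move=> x xI /=; rewrite lee_fin (le_trans (ub _ xI))//.
  by rewrite -mulrDl mulrA ler_norm.
- by apply: integrableZl => //; exact: integrableD.
Qed.

Lemma square_integrable0 : square_integrable (0 : R -> C).
Proof.
split; try exact: measurable_cst.
under eq_integral do rewrite sqr_normc /= expr0n/= addr0 mul0r.
by rewrite integral0.
Qed.

Lemma square_integrableD f g :
  square_integrable f -> square_integrable g -> square_integrable (f + g).
Proof.
move=> sf sg; apply/square_integrableP.
have [fr fi _] := sf; have [gr gi _] := sg.
have mr : measurable_fun itv11 (fun x => complex.Re ((f + g) x)).
  rewrite (_ : (fun x => _) = (fun x => complex.Re (f x) + complex.Re (g x))).
    exact: measurable_funD.
  by apply/funext => x; rewrite fctE/=; case: (f x); case: (g x).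
have mi : measurable_fun itv11 (fun x => complex.Im ((f + g) x)).
  rewrite (_ : (fun x => _) = (fun x => complex.Im (f x) + complex.Im (g x))).
    exact: measurable_funD.
  by apply/funext => x; rewrite fctE/=; case: (f x); case: (g x).
split=> //; apply: (dominated_integrable (c := 2) sf sg).
  exact: measurable_sqr_normc.
move=> x xI; have w0 := weight_gt0 xI.
rewrite normrM (gtr0_norm w0) ler_pM2r// ger0_norm ?sqr_ge0//.
rewrite !sqr_normc fctE; case: (f x) => a b; case: (g x) => c d /=.
by have := sqr_ge0 (a - c); have := sqr_ge0 (b - d); nra.
Qed.

Lemma square_integrableZ (l : C) f :
  square_integrable f -> square_integrable (l *: f).
Proof.
move=> sf; apply/square_integrableP.
have [fr fi _] := sf; case: l => p q.
have mr : measurable_fun itv11 (fun x => complex.Re (((p +i* q)%C *: f) x)).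
  rewrite (_ : (fun x => _) = (fun x => p * complex.Re (f x) - q * complex.Im (f x))).
    by apply: measurable_funB; exact: measurable_funM.
  by apply/funext => x; rewrite fctE/=; case: (f x).
have mi : measurable_fun itv11 (fun x => complex.Im (((p +i* q)%C *: f) x)).
  rewrite (_ : (fun x => _) = (fun x => p * complex.Im (f x) + q * complex.Re (f x))).
    by apply: measurable_funD; exact: measurable_funM.
  by apply/funext => x; rewrite fctE/=; case: (f x).
split=> //.
apply: (dominated_integrable (c := p ^+ 2 + q ^+ 2) sf sf).
  exact: measurable_sqr_normc.
move=> x xI; have w0 := weight_gt0 xI.
rewrite normrM (gtr0_norm w0) ler_pM2r// ger0_norm ?sqr_ge0//.
rewrite !sqr_normc fctE; case: (f x) => a b /=.
have -> : (p * a - q * b) ^+ 2 + (p * b + q * a) ^+ 2 =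
  (p ^+ 2 + q ^+ 2) * (a ^+ 2 + b ^+ 2) by ring.
by apply: ler_wpM2l; rewrite ?lerDl addr_ge0// sqr_ge0.
Qed.

Definition sqint_pred : {pred (R -> C)} := fun f => `[< square_integrable f >].

Lemma sqint_submod_closed : submod_closed sqint_pred.
Proof.
split; first exact/asboolP/square_integrable0.
move=> l f g /asboolP sf /asboolP sg.
by apply/asboolP/square_integrableD => //; exact: square_integrableZ.
Qed.

HB.instance Definition _ :=
  GRing.isSubmodClosed.Build _ _ sqint_pred sqint_submod_closed.

Record sqint_fun := SqintFun {
  sqint_val :> R -> C;
  sqint_valP : sqint_val \in sqint_pred }.

HB.instance Definition _ := [isSub for sqint_val].
HB.instance Definition _ := [Choice of sqint_fun by <:].
HB.instance Definition _ := [SubChoice_isSubLmodule of sqint_fun by <:].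

Definition null_pred : {pred sqint_fun} :=
  fun f : sqint_fun => `[< eq_ae f 0 >].

Lemma null_zmod_closed : zmod_closed null_pred.
Proof.
split; first by apply/asboolP/aeW.
move=> f g /asboolP f0 /asboolP g0; apply/asboolP.
move: f0 g0; rewrite /eq_ae; apply: filterS2 => x f0 g0 xI.
by rewrite [LHS](_ : _ = f x - g x)// f0// g0// subr0.
Qed.

HB.instance Definition _ :=
  GRing.isZmodClosed.Build _ null_pred null_zmod_closed.

(* The Hilbert space L^2((-1, 1); (1 - x^2)^-1) of classes of square integrable
   functions modulo equality almost everywhere; L2_fun picks a representative. *)
Definition L2 : Type := Quotient.quot null_pred.

HB.instance Definition _ := Choice.on L2.
HB.instance Definition _ := GRing.Zmodule.on L2.
HB.instance Definition _ := EqQuotient.on L2.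

Definition L2_fun (F : L2) : R -> C := repr F.
Coercion L2_fun : L2 >-> Funclass.

Lemma eq_ae_sym f g : eq_ae f g -> eq_ae g f.
Proof. exact: ae_eq_sym. Qed.

Lemma eq_ae_trans f g h : eq_ae f g -> eq_ae g h -> eq_ae f h.
Proof. exact: ae_eq_trans. Qed.

Lemma eq_aeB f g : eq_ae f g <-> eq_ae (f - g) 0.
Proof.
rewrite /eq_ae; split; apply: filterS => x + xI => /(_ xI); rewrite !fctE.
  by move=> ->; rewrite subrr.
by move/eqP; rewrite subr_eq0 => /eqP.
Qed.

Lemma pi_L2_eq (f g : sqint_fun) : \pi_L2%qT f = \pi_L2%qT g <-> eq_ae f g.
Proof.
split.
  move=> /eqP; rewrite -Quotient.idealrBE => /asboolP fg.
  exact/eq_aeB.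
by move=> /eq_aeB fg; apply/eqP; rewrite -Quotient.idealrBE; exact/asboolP.
Qed.

Lemma L2_fun_pi (f : sqint_fun) : eq_ae (\pi_L2%qT f : L2) f.
Proof. by apply/pi_L2_eq; rewrite reprK. Qed.

Lemma L2P (F G : L2) : F = G <-> eq_ae F G.
Proof. by rewrite -pi_L2_eq !reprK. Qed.

Lemma L2_square_integrable (F : L2) : square_integrable F.
Proof. exact/asboolP/sqint_valP. Qed.

Definition L2_scale (l : C) : L2 -> L2 := lift_op1 L2 ( *:%R l).

Lemma pi_L2_scale l (f : sqint_fun) :
  L2_scale l (\pi_L2%qT f) = \pi_L2%qT (l *: f).
Proof.
rewrite /L2_scale; unlock; apply/pi_L2_eq; have := L2_fun_pi f; rewrite /eq_ae; apply: filterS => x + xI => /(_ xI).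
by rewrite /L2_fun /= !fctE => ->.
Qed.

Lemma pi_L2D (f g : sqint_fun) :
  \pi_L2%qT f + \pi_L2%qT g = \pi_L2%qT (f + g) :> L2.
Proof. by rewrite [RHS]Quotient.pi_add. Qed.

Lemma L2_scaleA l m F : L2_scale l (L2_scale m F) = L2_scale (l * m) F.
Proof. by rewrite -[F]reprK !pi_L2_scale scalerA. Qed.

Lemma L2_scale1 : left_id 1 L2_scale.
Proof. by move=> F; rewrite -[F]reprK pi_L2_scale scale1r. Qed.

Lemma L2_scaleDr : right_distributive L2_scale +%R.
Proof.
move=> l F G; rewrite -[F]reprK -[G]reprK pi_L2D !pi_L2_scale pi_L2D.
by rewrite scalerDr.
Qed.

Lemma L2_scaleDl F : {morph L2_scale^~ F : l m / l + m}.
Proof. by move=> l m; rewrite -[F]reprK !pi_L2_scale pi_L2D scalerDl. Qed.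

HB.instance Definition _ := GRing.Zmodule_isLmodule.Build C L2
  L2_scaleA L2_scale1 L2_scaleDr L2_scaleDl.

Lemma L2_funP l (F G : L2) : eq_ae (l *: F + G : L2) (l *: (F : R -> C) + (G : R -> C)).
Proof.
have -> : l *: F + G = \pi_L2%qT (l *: repr F + repr G).
  by rewrite -pi_L2D -pi_L2_scale !reprK.
exact: L2_fun_pi.
Qed.

Definition wre f g x := (complex.Re (f x) * complex.Re (g x) +
                  complex.Im (f x) * complex.Im (g x)) * weight x.
Definition wim f g x := (complex.Im (f x) * complex.Re (g x) -
                  complex.Re (f x) * complex.Im (g x)) * weight x.

Lemma wdotE f g : wdot f g =
  ((\int[mu]_(x in itv11) wre f g x) +i*
   (\int[mu]_(x in itv11) wim f g x))%C.
Proof.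
congr Complex; apply: eq_Rintegral => x _; rewrite /wre /wim.
  by case: (f x) => a b; case: (g x) => c d /=; ring.
by case: (f x) => a b; case: (g x) => c d /=; ring.
Qed.

Lemma measurable_wre f g : square_integrable f -> square_integrable g ->
  measurable_fun itv11 (wre f g).
Proof.
move=> [fr fi _] [gr gi _]; apply: measurable_funM => //.
by apply: measurable_funD; exact: measurable_funM.
Qed.

Lemma measurable_wim f g : square_integrable f -> square_integrable g ->
  measurable_fun itv11 (wim f g).
Proof.
move=> [fr fi _] [gr gi _]; apply: measurable_funM => //.
by apply: measurable_funB; exact: measurable_funM.
Qed.

Lemma integrable_wre f g : square_integrable f -> square_integrable g ->
  mu.-integrable itv11 (EFin \o wre f g).
Proof.
move=> sf sg; apply: (dominated_integrable (c := 1) sf sg).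
  exact: measurable_wre.
move=> x xI; have w0 := weight_gt0 xI.
rewrite /wre normrM (gtr0_norm w0) ler_pM2r// mul1r !sqr_normc.
set a := complex.Re _; set b := complex.Re _; set c := complex.Im _.
set d := complex.Im _.
rewrite ler_norml; apply/andP; split;
  have := sqr_ge0 (a - b); have := sqr_ge0 (a + b);
  have := sqr_ge0 (c - d); have := sqr_ge0 (c + d); nra.
Qed.

Lemma integrable_wim f g : square_integrable f -> square_integrable g ->
  mu.-integrable itv11 (EFin \o wim f g).
Proof.
move=> sf sg; apply: (dominated_integrable (c := 1) sf sg).
  exact: measurable_wim.
move=> x xI; have w0 := weight_gt0 xI.
rewrite /wim normrM (gtr0_norm w0) ler_pM2r// mul1r !sqr_normc.
set a := complex.Im (f x); set b := complex.Re (g x).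
set c := complex.Re (f x); set d := complex.Im (g x).
rewrite ler_norml; apply/andP; split;
  have := sqr_ge0 (a - b); have := sqr_ge0 (a + b);
  have := sqr_ge0 (c - d); have := sqr_ge0 (c + d); nra.
Qed.

Lemma eq_ae_wdotl f h g : square_integrable f -> square_integrable h ->
  square_integrable g -> eq_ae f h -> wdot f g = wdot h g.
Proof.
rewrite /eq_ae =>  sf sh sg fh; rewrite !wdotE /Rintegral.
congr (Complex (fine _) (fine _)); apply: ae_eq_integral => //.
- by apply/measurable_EFinP; exact: measurable_wre.
- by apply/measurable_EFinP; exact: measurable_wre.
- by apply: filterS fh => x fh xI; rewrite /wre fh.
- by apply/measurable_EFinP; exact: measurable_wim.
- by apply/measurable_EFinP; exact: measurable_wim.
- by apply: filterS fh => x fh xI; rewrite /wim fh.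
Qed.

Lemma wdotC f g : square_integrable f -> square_integrable g ->
  wdot f g = (wdot g f)^*%C.
Proof.
move=> sf sg; rewrite !wdotE /=; congr Complex.
  by apply: eq_Rintegral => x _; rewrite /wre; ring.
rewrite -mulN1r -RintegralZl//; last by apply: integrable_wim.
by apply: eq_Rintegral => x _; rewrite /wim; ring.
Qed.

Lemma wdot_linear l f h g : square_integrable f -> square_integrable h ->
  square_integrable g -> wdot (l *: f + h) g = l * wdot f g + wdot h g.
Proof.
move=> sf sh sg; rewrite !wdotE; case: l => p q; simpc.
have fre := integrable_wre sf sg; have fim := integrable_wim sf sg.
have hre := integrable_wre sh sg; have him := integrable_wim sh sg.
have Z r (u : R -> R) : mu.-integrable itv11 (EFin \o u) ->
    mu.-integrable itv11 (EFin \o (fun x => r * u x)).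
  move=> ui; rewrite (_ : _ \o _ = (fun x => r%:E * (EFin \o u) x)%E)//.
  exact: integrableZl.
have D (u v : R -> R) : mu.-integrable itv11 (EFin \o u) ->
    mu.-integrable itv11 (EFin \o v) ->
    mu.-integrable itv11 (EFin \o (fun x => u x + v x)).
  move=> ui vi; rewrite (_ : _ \o _ = (EFin \o u) \+ (EFin \o v))%E//.
  exact: integrableD.
rewrite -!mulNr -!RintegralZl// -!RintegralD//;
  try by [exact: Z|apply: D; exact: Z].
congr Complex; apply: eq_Rintegral => x _; rewrite /wre /wim !fctE.
  by case: (f x) => a b; case: (g x) => c d; case: (h x) => e e' /=; ring.
by case: (f x) => a b; case: (g x) => c d; case: (h x) => e e' /=; ring.
Qed.

Lemma wdot_gt0 (F : L2) : F != 0 -> 0 < wdot F F.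
Proof.
move=> F0; have sF := L2_square_integrable F.
have wim0 : \int[mu]_(x in itv11) wim F F x = 0.
  rewrite (_ : wim F F = cst 0) ?Rintegral_cst ?mul0r//.
  by apply/funext => x; rewrite /wim /=; ring.
rewrite wdotE wim0 ltcR.
have wre_ge0 x : itv11 x -> 0 <= wre F F x.
  move=> xI; apply: mulr_ge0; last exact/ltW/weight_gt0.
  by rewrite addr_ge0// -expr2 sqr_ge0.
rewrite lt_neqAle Rintegral_ge0// andbT; apply: contra F0 => /eqP I0.
apply/eqP/L2P.
have zero_fun : eq_ae (0 : L2) 0.
  rewrite (_ : (0 : L2) = \pi_L2%qT 0); first exact: L2_fun_pi.
  by apply: (addrI (\pi_L2%qT 0 : L2)); rewrite addr0 pi_L2D addr0.
apply: eq_ae_trans (eq_ae_sym zero_fun); rewrite /eq_ae.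
have : ae_eq mu itv11 (EFin \o wre F F) (cst 0%E).
  apply/ae_eq_integral_abs => //.
    by apply/measurable_EFinP; exact: measurable_wre.
  rewrite (_ : (\int[mu]_(x in _) _ = \int[mu]_(x in itv11) (wre F F x)%:E)%E).
    rewrite -[LHS]fineK; first by rewrite -[fine _]/(Rintegral mu itv11 (wre F F)) -I0.
    by apply: integrable_fin_num => //; exact: integrable_wre.
  by apply: eq_integral => x; rewrite inE => xI /=; rewrite ger0_norm// wre_ge0.
apply: filterS => x + xI => /(_ xI) /= [].
rewrite /wre => /eqP; rewrite mulf_eq0 (gt_eqF (weight_gt0 xI)) orbF -!expr2.
rewrite paddr_eq0 ?sqr_ge0// !sqrf_eq0 => /andP[/eqP a0 /eqP b0].
by rewrite [RHS](_ : _ = 0)//; case: (L2_fun F x) a0 b0 => a b /= -> ->.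
Qed.

Definition L2_dot (F G : L2) : C := wdot F G.

Lemma L2_dot_linear (G : L2) : linear_for *%R (L2_dot^~ G).
Proof.
move=> l F H; rewrite /L2_dot -wdot_linear; [|exact: L2_square_integrable..].
apply: eq_ae_wdotl; [exact: L2_square_integrable| |exact: L2_square_integrable|
  exact: L2_funP].
apply: square_integrableD; last exact: L2_square_integrable.
by apply: square_integrableZ; exact: L2_square_integrable.
Qed.

Lemma L2_dotC (F G : L2) : L2_dot F G = (-1) ^+ false * conjC (L2_dot G F).
Proof.
rewrite expr0 mul1r; apply: wdotC; exact: L2_square_integrable.
Qed.

Lemma L2_dot_bilinear : bilinear_for *%R (conjC \; *%R) L2_dot.
Proof.
split=> [G|F]; first exact: L2_dot_linear.
move=> l G H; rewrite [LHS]L2_dotC (L2_dot_linear F) rmorphD rmorphM/=.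
by rewrite expr0 mul1r (L2_dotC F G) (L2_dotC F H) expr0 !mul1r.
Qed.

HB.instance Definition _ := bilinear_isBilinear.Build C L2 L2 C
   *%R (conjC \; *%R) L2_dot L2_dot_bilinear.
HB.instance Definition _ :=
  isHermitianSesquilinear.Build C L2 false conjC L2_dot L2_dotC.
HB.instance Definition _ := isDotProduct.Build C L2 L2_dot wdot_gt0.

End weighted_L2.

Arguments L2 : clear implicits.

Definition L2_inner (R : realType) : {dot (L2 R) for conjC} := L2_dot.

Section jacobi.
Context {R : realType}.
Local Notation C := R[i].
Implicit Types (f : R -> C) (x k : R).

(* Almost-everywhere equality with a Borel square integrable function, that is
   Lebesgue measurability and square integrability. It applies to functions
   such as l[f], whose values matter only up to a null set. *)
Definition in_L2 f : Prop := exists F : L2 R, eq_ae F f.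

Definition abs_continuous_on (a b : R) f : Prop :=
  forall e : R, 0 < e -> exists2 d : R, 0 < d &
    forall (n : nat) (u v : 'I_n -> R),
      (forall i, [/\ a <= u i, u i <= v i & v i <= b]) ->
      (forall i j, i != j -> v i <= u j \/ v j <= u i) ->
      \sum_(i < n) (v i - u i) < d ->
      \sum_(i < n) normc (f (v i) - f (u i)) < e.

Definition AC_loc f : Prop :=
  forall a b : R, -1 < a -> a <= b -> b < 1 -> abs_continuous_on a b f.

(* Derivatives of complex-valued functions of a real variable are taken
   componentwise. Where the components are not differentiable derive1 has an
   unspecified value; for f' in AC_loc this only affects f'' on a null set. *)
Definition cderivable f x : Prop :=
  derivable (fun y => complex.Re (f y)) x 1 /\
  derivable (fun y => complex.Im (f y)) x 1.

Definition cderive f x : C :=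
  ((derive1 (fun y => complex.Re (f y)) x) +i*
   (derive1 (fun y => complex.Im (f y)) x))%C.

Definition jacobi_expr k f x : C :=
  - (1 - x ^+ 2)%:C%C * cderive (cderive f) x + k%:C%C * f x.

Definition max_domain k : set (R -> C) :=
  [set f | [/\ AC_loc f,
               forall x, itv11 x -> cderivable f x,
               AC_loc (cderive f),
               in_L2 f &
               in_L2 (jacobi_expr k f)]].

Definition jacobi_operator k : set (L2 R * L2 R) :=
  [set FG : L2 R * L2 R | exists2 f, max_domain k f &
              eq_ae FG.1 f /\ eq_ae FG.2 (jacobi_expr k f)].

End jacobi.

(* Main.v *)
(** Let [w = 1 / (1 - x^2)] and let [A - k] act as [f |-> - (1 - x^2) f''].
    Integrating [f'' = - h w] from 0, the Cauchy-Schwarz inequality bounds [f']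
    by [|h| / sqrt (1 - |x|)], where [|h|] is the weighted norm. So [f] has
    limits at both endpoints, and subtracting an affine function yields a
    solution vanishing there, with [f(x)^2 <= 16 |h|^2 (1 - x^2)]. Nonzero
    affine functions are not square integrable for [w], so this solution is the
    only one in the Hilbert space. Hence [A - k] is the inverse of a bounded
    operator [S] defined everywhere, and the pointwise bound shows that [S]
    maps Cauchy sequences to convergent ones, so that the completeness of the
    whole space is never needed.

    On [(1 - x^2) q] with [q] a polynomial, [A - k] acts on the factor [q] as
    [q |-> - ((1 - x^2) q)''], which is triangular in the degree with diagonal
    entries [(n + 2) (n + 1)]. This gives eigenpolynomials of every degree; the
    corresponding vectors are orthogonal by integration by parts and total by
    the Weierstrass theorem. A bounded [S] with a total orthogonal family of
    eigenvectors for the eigenvalues [1 / lam n] is symmetric and injective,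
    which makes [A] self-adjoint, and the resolvent of [A] off the eigenvalues
    is diagonal on finite combinations of eigenvectors. *)
Require Import Defs.
From HB Require Import structures.
From mathcomp Require Import all_boot all_order all_algebra.
From mathcomp Require Import sesquilinear generic_quotient.
From mathcomp Require Import all_classical all_reals all_analysis.
From mathcomp Require Import measurable_realfun complex.
From mathcomp Require Import ring lra.

Set Implicit Arguments.
Unset Strict Implicit.
Unset Printing Implicit Defensive.

Import Order.TTheory GRing.Theory Num.Theory Num.Def.
Import numFieldNormedType.Exports.
Import ComplexField.Normc.

Local Open Scope classical_set_scope.
Local Open Scope ring_scope.

#[local] Existing Instance ae_lebesgue_filter.

(** * Absolutely continuous functions *)

Section absolute_continuity.
Context {R : realType}.
Implicit Types (a b : R) (f g : R -> R) (s : seq (R * R)).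

(** The maximal domain asks [f'] to be locally absolutely continuous, and the equation then
    prescribes [f''] only almost everywhere, whereas solutions are built and estimated through the
    integrated form [f' y - f' x = \int source]. Passing between the two forms is the fundamental
    theorem of calculus for absolutely continuous functions. It rests on the decomposition
    [f = V - (V - f)] into nondecreasing functions, where [V] is the total variation of [f], and on
    Radon-Nikodym densities of the Stieltjes measures of the two parts.

    The weight is not integrable at the endpoints, and this singularity takes the place of boundary
    conditions: square integrability alone forces the boundary values of a solution to be zero.

    The equation and the weight are real, so the real and imaginary parts of a solution are treated
    separately. An element of the space is a class modulo null sets: derivatives always concern a
    chosen representative, while a right-hand side may be altered on a null set, since it enters
    through integrals only. *)

Definition nonoverlap (p q : R * R) := (p.2 <= q.1) || (q.2 <= p.1).
Definition subitv a b (p : R * R) := [&& a <= p.1, p.1 <= p.2 & p.2 <= b].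
Definition total_length s := \sum_(p <- s) (p.2 - p.1).
Definition total_jump f s := \sum_(p <- s) `|f p.2 - f p.1|.

Definition AC_on a b f := forall e : R, 0 < e -> exists2 d : R, 0 < d &
  forall s, all (subitv a b) s -> pairwise nonoverlap s ->
    total_length s < d -> total_jump f s < e.

Lemma nonoverlapC : symmetric nonoverlap.
Proof. by move=> p q; rewrite /nonoverlap orbC. Qed.

(** Families of intervals as sequences can be concatenated, cut into pieces and treated by
    induction, which families indexed by ordinals do not allow directly. *)
Lemma abs_continuous_on_seq a b (f : R -> R[i]) :
  abs_continuous_on a b f <-> forall e : R, 0 < e -> exists2 d : R, 0 < d &
    forall s, all (subitv a b) s -> pairwise nonoverlap s ->
      total_length s < d -> \sum_(p <- s) normc (f p.2 - f p.1) < e.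
Proof.
split=> fac e /fac[d d0 Hd]; exists d => //.
  move=> s /allP sab sn sd.
  pose u (i : 'I_(size s)) := (nth (0, 0) s i).1.
  pose v (i : 'I_(size s)) := (nth (0, 0) s i).2.
  have := Hd (size s) u v; rewrite (big_nth (0, 0)) big_mkord; apply.
  - by move=> i; have /sab/and3P[] := mem_nth (0, 0) (ltn_ord i).
  - move=> i j; rewrite neq_ltn => /orP[] ij.
      have := (pairwiseP (0, 0) sn) _ _ (ltn_ord i) (ltn_ord j) ij.
      by move=> /orP[]; [left|right].
    have := (pairwiseP (0, 0) sn) _ _ (ltn_ord j) (ltn_ord i) ij.
    by move=> /orP[]; [right|left].
  - by move: sd; rewrite /total_length (big_nth (0, 0)) big_mkord.
move=> n u v uv dis sd.
have E (F : R * R -> R) :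
    \sum_(p <- [seq (u i, v i) | i <- enum 'I_n]) F p = \sum_(i < n) F (u i, v i).
  by rewrite big_map big_enum.
have := Hd [seq (u i, v i) | i <- enum 'I_n].
rewrite /total_length !E; apply=> //.
- by apply/allP => _ /mapP[i _ ->]; apply/and3P; have [] := uv i.
- rewrite pairwise_map; have : pairwise [rel i j | i != j] (enum 'I_n).
    by rewrite -uniq_pairwise enum_uniq.
  by apply: sub_pairwise => i j /= /dis; rewrite /nonoverlap /= => -[->|->]; rewrite ?orbT.
Qed.

Lemma normr_Re_le (z : R[i]) : `|complex.Re z| <= normc z.
Proof.
by case: z => x y /=; rewrite -sqrtr_sqr ler_wsqrtr// lerDl sqr_ge0.
Qed.

Lemma normr_Im_le (z : R[i]) : `|complex.Im z| <= normc z.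
Proof.
by case: z => x y /=; rewrite -sqrtr_sqr ler_wsqrtr// lerDr sqr_ge0.
Qed.

Lemma normc_le_ReIm (z : R[i]) :
  normc z <= `|complex.Re z| + `|complex.Im z|.
Proof.
case: z => x y /=; rewrite -[leRHS]ger0_norm ?addr_ge0// -sqrtr_sqr.
rewrite ler_wsqrtr// sqrrD !real_normK ?num_real// addrAC lerDl.
by rewrite mulrn_wge0// mulr_ge0.
Qed.

Lemma abs_continuous_onP a b (f : R -> R[i]) :
  abs_continuous_on a b f <->
  AC_on a b (fun x => complex.Re (f x)) /\ AC_on a b (fun x => complex.Im (f x)).
Proof.
have ReB (z w : R[i]) : complex.Re z - complex.Re w = complex.Re (z - w).
  by case: z; case: w.
have ImB (z w : R[i]) : complex.Im z - complex.Im w = complex.Im (z - w).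
  by case: z; case: w.
rewrite abs_continuous_on_seq; split=> [fac|[rac iac] e e0].
  split=> e /fac[d d0 Hd]; exists d => // s sab sn sd;
    apply: le_lt_trans (Hd s sab sn sd); apply: ler_sum => p _.
    by rewrite ReB normr_Re_le.
  by rewrite ImB normr_Im_le.
have e2 : 0 < e / 2 by rewrite divr_gt0.
have [d d0 Hd] := rac _ e2; have [c c0 Hc] := iac _ e2.
exists (Num.min d c); first by rewrite lt_min d0.
move=> s sab sn; rewrite lt_min => /andP[sd sc].
rewrite [e]splitr; apply: le_lt_trans (ltrD (Hd s sab sn sd) (Hc s sab sn sc)).
rewrite -big_split/=; apply: ler_sum => p _.
by rewrite ReB ImB normc_le_ReIm.
Qed.

Lemma AC_onB a b f g : AC_on a b f -> AC_on a b g ->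
  AC_on a b (fun x => f x - g x).
Proof.
move=> rac iac e e0.
have e2 : 0 < e / 2 by rewrite divr_gt0.
have [d d0 Hd] := rac _ e2; have [c c0 Hc] := iac _ e2.
exists (Num.min d c); first by rewrite lt_min d0.
move=> s sab sn; rewrite lt_min => /andP[sd sc].
rewrite [e]splitr; apply: le_lt_trans (ltrD (Hd s sab sn sd) (Hc s sab sn sc)).
rewrite -big_split/=; apply: ler_sum => p _.
rewrite (_ : _ - _ = (f p.2 - f p.1) - (g p.2 - g p.1)); first exact: ler_normB.
by ring.
Qed.

Lemma AC_on_dist a b f : AC_on a b f -> forall e : R, 0 < e ->
  exists2 d : R, 0 < d & forall x y, a <= x -> x <= y -> y <= b -> y - x < d ->
    `|f y - f x| < e.
Proof.
move=> fac e /fac[d d0 Hd]; exists d => // x y ax xy yb xyd.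
have := Hd [:: (x, y)]; rewrite /total_length /total_jump !big_seq1 /=.
by rewrite /subitv /= ax xy yb; apply.
Qed.

Lemma Lipschitz_AC_on a b f (M : R) :
  (forall x y, a <= x -> x <= y -> y <= b -> `|f y - f x| <= M * (y - x)) ->
  AC_on a b f.
Proof.
move=> fM e e0; have M1 : 0 < `|M| + 1 by rewrite ltr_wpDl.
exists (e / (`|M| + 1)); first by rewrite divr_gt0.
move=> s /allP sab _; rewrite ltr_pdivlMr// mulrC; apply: le_lt_trans.
rewrite /total_length big_distrr/= /total_jump !big_seq; apply: ler_sum.
move=> p /sab /and3P[ap pp pb]; rewrite (le_trans (fM _ _ ap pp pb))//.
by rewrite ler_wpM2r ?subr_ge0// (le_trans (ler_norm _))// lerDl.
Qed.

Fixpoint pieces (x : R) (l : seq R) : seq (R * R) :=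
  if l is y :: l' then (x, y) :: pieces y l' else [::].

Lemma total_jump_cat f s t :
  total_jump f (s ++ t) = total_jump f s + total_jump f t.
Proof. by rewrite /total_jump big_cat. Qed.

Lemma total_length_cat s t :
  total_length (s ++ t) = total_length s + total_length t.
Proof. by rewrite /total_length big_cat. Qed.

(** Turns a partition, through which variation is defined, into a family to which absolute
    continuity applies. *)
Lemma piecesP a b f (l : seq R) : itv_partition a b l ->
  [/\ all (subitv a b) (pieces a l), pairwise nonoverlap (pieces a l),
      total_length (pieces a l) = b - a &
      total_jump f (pieces a l) = variation a b f l].
Proof.
elim: l a => [a /itv_partition_nil ->|x l IH a H].
  by rewrite /= /total_length /total_jump !big_nil variation_nil subrr.
have lx := itv_partition_cons H; have [sx nx lenx jx] := IH _ lx.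
have ax : a < x by case: H => /= /andP[].
have xb := itv_partition_le lx.
split=> /=.
- have -> /= : subitv a b (a, x) by rewrite /subitv /= lexx ltW.
  apply: sub_all sx => p /and3P[p1 p2 p3]; apply/and3P; split=> //.
  exact: le_trans (ltW ax) p1.
- rewrite nx andbT; apply: sub_all sx => p /and3P[p1 p2 p3].
  by rewrite /nonoverlap /= p1.
- by move: lenx; rewrite /total_length big_cons /= => ->; rewrite addrC subrKA.
- move: jx; rewrite /total_jump big_cons /= => ->.
  by rewrite {2}/variation /= big_nat_recl//=.
Qed.

Lemma subitv_trans a b c d (p : R * R) : a <= c -> d <= b -> subitv c d p ->
  subitv a b p.
Proof.
move=> ac db /and3P[p1 p2 p3]; apply/and3P; split=> //.
  exact: le_trans p1.
exact: le_trans db.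
Qed.

Lemma pieces_nonoverlap a b f (l : seq R) q : itv_partition a b l ->
  nonoverlap (a, b) q -> all (nonoverlap^~ q) (pieces a l).
Proof.
move=> /(piecesP f)[+ _ _ _]; move=> ls abq; apply: sub_all ls => p /and3P[p1 p2 p3].
move: abq; rewrite /nonoverlap /= => /orP[bq|qa].
  by rewrite (le_trans p3 bq).
by rewrite (le_trans qa p1) orbT.
Qed.

(** * Total variation of an absolutely continuous function *)

Section variation_of_AC.
Variables (a b : R) (f : R -> R) (e d : R).
Hypothesis fed : forall s, all (subitv a b) s -> pairwise nonoverlap s ->
    total_length s < d -> total_jump f s < e.

Lemma AC_variation_le x y (l : seq R) : a <= x -> y <= b -> y - x < d ->
  itv_partition x y l -> variation x y f l <= e.
Proof.
move=> ax yb xyd /(piecesP f)[ls ln ll <-]; apply/ltW/fed => //.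
  by apply: sub_all ls => p; exact: subitv_trans.
by rewrite ll.
Qed.

(** On an interval shorter than [d] every variation is at most [e]. The general case is by induction
    on the number of steps of length [d / 2] needed to cross the interval. *)
Lemma AC_bounded_variation : 0 < d -> a <= b -> bounded_variation a b f.
Proof.
move=> d0 ab.
have : forall n x y, a <= x -> x <= y -> y <= b -> y - x <= n%:R * (d / 2) ->
    bounded_variation x y f.
  have d2 : 0 < d / 2 by rewrite divr_gt0.
  elim=> [|n IH] x y ax xy yb xyn.
    have -> : y = x by apply/eqP; rewrite eq_le xy -subr_le0 -(mul0r (d / 2)) xyn.
    exact: bounded_variationxx.
  have [yx|yx] := leP (y - x) (d / 2).
    exists e => _ [l xyl <-]; apply: AC_variation_le xyl => //.
    by rewrite (le_lt_trans yx)// ltr_pdivrMr// ltr_pMr// ltr1n.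
  pose z := x + d / 2; have xz : x <= z by rewrite lerDl ltW.
  have zy : z <= y by rewrite /z; lra.
  apply/bounded_variationP => //; rewrite (total_variationD _ xz zy).
  rewrite fin_numD; apply/andP; split; apply/bounded_variationP => //.
    exists e => _ [l xyl <-]; apply: AC_variation_le xyl => //; first lra.
    by rewrite /z; lra.
  apply: IH => //; first lra.
  by move: xyn; rewrite -natr1 mulrDl mul1r /z; lra.
move/(_ (truncn ((b - a) / (d / 2))).+1 a b); apply=> //.
rewrite -ler_pdivrMr ?divr_gt0//; apply: ltW; exact: truncnS_gt.
Qed.

(** The intervals of [s] are treated one at a time. The variation over an interval is a supremum
    over its partitions, so the interval may be replaced by the pieces of a partition, which join
    [t] and count there through their jumps. *)
Lemma AC_total_variation s t : bounded_variation a b f ->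
  all (subitv a b) (s ++ t) -> pairwise nonoverlap (s ++ t) ->
  total_length (s ++ t) < d ->
  \sum_(p <- s) fine (total_variation p.1 p.2 f) + total_jump f t <= e.
Proof.
move=> bv; elim: s t => [|[x y] s IH] t.
  by rewrite big_nil add0r /= => ? ? ?; exact/ltW/fed.
move=> /= /andP[/and3P[/= ax xy yb] sab] /andP[xys sn] std.
rewrite big_cons /= -addrA.
have bvxy : bounded_variation x y f.
  exact: bounded_variationl xy yb (bounded_variationr ax (le_trans xy yb) bv).
have tvfin : total_variation x y f \is a fin_num by apply/bounded_variationP.
rewrite -lerBrDr -lee_fin fineK//.
apply: ge_ereal_sup => _ [_ [l xyl <-] <-]; rewrite lee_fin lerBrDr addrCA.
have [ls ln ll <-] := piecesP f xyl; rewrite -total_jump_cat; apply: IH.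
- move: sab; rewrite !all_cat => /andP[-> ->]; rewrite /= andbT.
  by apply: sub_all ls => p; exact: subitv_trans.
- move: sn xys; rewrite !pairwise_cat !allrel_catr all_cat ln => /and3P[st -> ->].
  move=> /andP[xys xyt]; rewrite st !andbT /=; apply/andP; split.
    rewrite allrelC; apply/allrelP => p q pl qs; rewrite nonoverlapC.
    have /allP := pieces_nonoverlap f xyl (allP xys _ qs).
    exact.
  apply/allrelP => p q pl qt.
  by have /allP := pieces_nonoverlap f xyl (allP xyt _ qt); exact.
- rewrite !total_length_cat ll; move: std.
  by rewrite {1}/total_length big_cons big_cat /= addrCA.
Qed.

End variation_of_AC.

Lemma AC_on_bounded_variation a b f : a <= b -> AC_on a b f ->
  bounded_variation a b f.
Proof. by move=> ab /(_ 1 ltr01)[d d0 Hd]; exact: AC_bounded_variation Hd d0 ab. Qed.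

(** The preceding bound with no jump terms, since increments of the total variation are variations
    of subintervals. That bound is not strict, hence the use of [e / 2]. *)
Lemma AC_on_total_variation a b f : a <= b -> AC_on a b f ->
  AC_on a b (fun x => fine (total_variation a x f)).
Proof.
move=> ab fac e e0; have bv := AC_on_bounded_variation ab fac.
have e2 : 0 < e / 2 by rewrite divr_gt0.
have [d d0 Hd] := fac _ e2; exists d => // s sab sn sd.
have := @AC_total_variation _ _ _ _ _ Hd s [::] bv; rewrite cats0.
move=> /(_ sab sn sd); rewrite {1}/total_jump big_nil addr0 => H.
apply: (@le_lt_trans _ _ (e / 2)); last by rewrite ltr_pdivrMr// ltr_pMr// ltr1n.
apply: le_trans H; rewrite /total_jump !big_seq; apply: ler_sum => p ps.
have /and3P[ap pp pb] := allP sab _ ps.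
have fin x y : a <= x -> x <= y -> y <= b -> total_variation x y f \is a fin_num.
  move=> ax xy yb; apply/bounded_variationP => //.
  exact: bounded_variationl xy yb (bounded_variationr ax (le_trans xy yb) bv).
rewrite (total_variationD _ ap pp) fineD ?fin//; last exact: le_trans pb.
by rewrite addrC addKr ger0_norm// fine_ge0// total_variation_ge0.
Qed.

(** * Stieltjes measures and Radon-Nikodym densities *)

Lemma lebesgue_stieltjes_measure_oc (F : cumulative R R) (x y : R) : x <= y ->
  lebesgue_stieltjes_measure F `]x, y]%classic = (F y - F x)%:E.
Proof.
move=> xy; rewrite /lebesgue_stieltjes_measure /measure_extension.
rewrite measurable_mu_extE/=; last exact: is_ocitv.
by rewrite wlength_itv_bnd//= EFinB.
Qed.

(** The intervals of a cover may overlap. Their finite unions lie in the ring generated by half-open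
    intervals, whose elements are finite disjoint unions of such intervals; one family then computes
    the measure for all [F] at once. *)
Lemma finite_union_oc (I : nat -> set (ocitv_type R)) (n : nat) :
  (forall k, measurable (I k)) ->
  exists s : seq (R * R), [/\ all (fun p => p.1 <= p.2) s, pairwise nonoverlap s &
    forall F : cumulative R R,
      lebesgue_stieltjes_measure F (\big[setU/set0]_(k < n) I k) =
      (\sum_(p <- s) (F p.2 - F p.1))%:E].
Proof.
move=> mI.
have mU : (measurable : set (set (SetRing.type (ocitv_type R))))
    (\big[setU/set0]_(k < n) I k).
  by apply: bigsetU_measurable => k _; exact: SetRing.measurable_subring.
have [B [Bfin Bne Btriv Bm UE]] := SetRing.ring_finite_set mU.
have /choice[h hP] : forall X : set R, exists p : R * R,
    B X -> p.1 < p.2 /\ X = `]p.1, p.2]%classic.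
  move=> X; have [BX|] := pselect (B X); last by exists (0, 0).
  have := Bm X; rewrite inE => /(_ BX) /ocitvP[X0|[p p12 XE]].
    by have := Bne _ BX; rewrite X0 => -[].
  by exists p.
have [r rE] := (finite_seqP _).1 Bfin; pose S := undup r.
have SE : B = [set` S] by rewrite rE; apply/seteqP; split=> X /=; rewrite mem_undup.
have BS X : X \in S -> B X by move=> XS; rewrite SE.
exists [seq h X | X <- S]; split.
- by apply/allP => _ /mapP[X /BS/hP[+ _] ->] => /ltW.
- rewrite pairwise_map.
  have : pairwise [rel X Y | X != Y] (S).
    by rewrite -uniq_pairwise undup_uniq.
  apply: (sub_in_pairwise (P := [in S])); last exact/allP.
  move=> X Y /BS BX /BS BY /= XY.
  have [hX XE] := hP _ BX; have [hY YE] := hP _ BY.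
  apply: contraT; rewrite /nonoverlap negb_or -!ltNge => /andP[XY1 YX1].
  have : X `&` Y = set0 by move/trivIsetP : Btriv; apply.
  (* Two overlapping intervals that are closed on the right share the smaller of their right
     endpoints. *)
  move=> XY0; pose m := Num.min (h X).2 (h Y).2.
  suff : (X `&` Y) m by rewrite XY0.
  split; [rewrite XE|rewrite YE]; rewrite /= in_itv/= /m.
    by rewrite lt_min hX YX1/= ge_min lexx.
  by rewrite lt_min XY1 hY/= ge_min lexx orbT.
- move=> F; rewrite UE.
  rewrite measure_fin_bigcup//; last first.
    by move=> X BX; apply: sub_sigma_algebra; apply: Bm; rewrite inE.
  rewrite SE -fsbig_seq ?undup_uniq// big_map -sumEFin.
  rewrite !big_seq; apply: eq_bigr => X /BS/hP[X12 XE].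
  rewrite [in LHS]XE; exact/lebesgue_stieltjes_measure_oc/ltW.
Qed.

(** A null set is covered by half-open intervals of total length below [d]. Every finite part of the
    cover has [F]-measure at most [e], and continuity from below extends this to the whole cover. *)
Lemma AC_null_dominates (F : cumulative R R) :
  (forall e : R, 0 < e -> exists2 d : R, 0 < d & forall s,
    all (fun p => p.1 <= p.2) s -> pairwise nonoverlap s ->
    total_length s < d -> \sum_(p <- s) (F p.2 - F p.1) <= e) ->
  lebesgue_stieltjes_measure F `<< lebesgue_measure.
Proof.
move=> Fac; apply/null_content_dominatesP => A mA A0.
apply/eqP; rewrite eq_le measure_ge0 andbT; apply/lee_addgt0Pr => e e0.
rewrite add0e; have [d d0 Hd] := Fac _ e0.
have : (lebesgue_measure A < d%:E)%E by rewrite A0 lte_fin.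
move=> /ereal_inf_lt[_ [I [mI AI] <-] Id].
have mI' k : measurable (I k : set (measurableTypeR R)).
  by apply: sub_sigma_algebra; exact: mI.
apply: (@le_trans _ _ (lebesgue_stieltjes_measure F (\bigcup_k I k))).
  by apply: le_measure; rewrite ?inE//; exact: bigcup_measurable.
have cU : lebesgue_stieltjes_measure F (\big[setU/set0]_(k < n.+1) I k) @[n --> \oo]
    --> lebesgue_stieltjes_measure F (\bigcup_k I k).
  rewrite -bigcup_bigsetU_bigcup.
  apply: (@nondecreasing_cvg_mu _ _ _ (lebesgue_stieltjes_measure F)
    (fun n => \big[setU/set0]_(k < n.+1) I k)).
  - by move=> n; exact: bigsetU_measurable.
  - by apply: bigcup_measurable => n _; exact: bigsetU_measurable.
  - by move=> m n mn; apply/subsetPset/subset_bigsetU.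
apply: (cvge_to_le cU); apply: nearW => n.
have [s [s12 sn sF]] := finite_union_oc n.+1 mI.
rewrite [leLHS]sF lee_fin; apply: Hd => //.
(* Lebesgue measure is the Stieltjes measure of the identity, so the family computed for [F] also
   gives the length. *)
rewrite -lte_fin /total_length -(sF idfun).
apply: le_lt_trans Id; apply: ereal_inf_lbound; exists I => //.
by split=> //; exact: bigsetU_bigcup.
Qed.

(** Composition with [clamp a b] extends a function on [[a, b]] to the whole line by constants, so
    that it can serve as a cumulative function. *)
Definition clamp a b (x : R) := Num.max a (Num.min b x).

Lemma clamp_in a b x : a <= b -> a <= clamp a b x <= b.
Proof. by move=> ab; rewrite /clamp le_max lexx ge_max ab ge_min lexx. Qed.

Lemma clamp_id a b x : a <= x -> x <= b -> clamp a b x = x.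
Proof. by move=> ax xb; rewrite /clamp (min_idPr _)// (max_idPr _). Qed.

Lemma clamp_homo a b : {homo clamp a b : x y / x <= y}.
Proof.
by move=> x y xy; rewrite /clamp ge_max !le_max lexx/= le_min !ge_min lexx xy !orbT.
Qed.

Lemma clamp_dist a b x y : a <= b -> x <= y -> clamp a b y - clamp a b x <= y - x.
Proof.
rewrite /clamp /maxr /minr => ab xy.
by case: (ltP b y) => ?; case: (ltP b x) => ?; do ![case: ltP => ?]; lra.
Qed.

(* Absolute continuity of [f] says that its Stieltjes measure is dominated by
   the Lebesgue measure; [g] is the Radon-Nikodym derivative. *)
Lemma AC_nondecreasing_integral a b f : a < b ->
  {in `[a, b] &, {homo f : x y / x <= y}} -> AC_on a b f ->
  exists g, lebesgue_measure.-integrable `[a, b] (EFin \o g) /\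
    forall x, a <= x <= b -> f x - f a = \int[lebesgue_measure]_(t in `[a, x]) g t.
Proof.
move=> ab fnd fac; pose f' := f \o clamp a b.
have clI x : clamp a b x \in `[a, b] by rewrite in_itv/= clamp_in// ltW.
have f'nd : nondecreasing_fun f'.
  by move=> x y xy; apply: fnd => //; exact: clamp_homo.
have f'c : continuous f'.
  move=> x; apply/cvgrPdist_lt => e e0.
  have [d d0 Hd] := AC_on_dist fac e0.
  near=> y.
  have : `|y - x| < d by rewrite distrC; near: y; exact: cvgr_dist_lt.
  have [xy|/ltW yx] := leP x y.
    rewrite ger0_norm ?subr_ge0// distrC => yxd.
    have := clI x; have := clI y; rewrite !in_itv/= => /andP[_ y1] /andP[x1 _].
    apply: Hd => //; first exact: clamp_homo.
    by apply: le_lt_trans yxd; rewrite clamp_dist// ltW.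
  rewrite ler0_norm ?subr_le0// opprB => yxd.
  have := clI x; have := clI y; rewrite !in_itv/= => /andP[y1 _] /andP[_ x1].
  apply: Hd => //; first exact: clamp_homo.
  by apply: le_lt_trans yxd; rewrite clamp_dist// ltW.
pose F : cumulative R R :=
  HB.pack f' (isCumulative.Build R _ R f' f'nd (right_continuousW f'c)).
have Fdom : lebesgue_stieltjes_measure F `<< lebesgue_measure.
  apply: AC_null_dominates => e e0; have [d d0 Hd] := fac _ e0.
  exists d => // s /allP s12 sn sd; apply: ltW.
  pose c (p : R * R) := (clamp a b p.1, clamp a b p.2).
  apply: le_lt_trans (Hd (map c s) _ _ _).
  - rewrite /total_jump big_map; apply: ler_sum => p _ /=; exact: ler_norm.
  - apply/allP => _ /mapP[p /s12 p12 ->].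
    have := clI p.1; have := clI p.2; rewrite !in_itv/= => /andP[_ p2] /andP[p1 _].
    by apply/and3P; split=> //=; exact: clamp_homo.
  - rewrite pairwise_map; apply: sub_pairwise sn => p q /orP[] pq.
      by apply/orP; left; exact: clamp_homo.
    by apply/orP; right; exact: clamp_homo.
  - apply: le_lt_trans sd; rewrite /total_length big_map !big_seq.
    by apply: ler_sum => p /s12 p12 /=; rewrite clamp_dist// ltW.
have mab : measurable (`]a, b]%classic : set (measurableTypeR R)) by exact: measurable_itv.
have Foo : (lebesgue_stieltjes_measure F `]a, b]%classic < +oo)%E.
  by rewrite lebesgue_stieltjes_measure_oc ?ltry// ltW.
(* The restriction to []a, b]] is a finite measure, as the Radon-Nikodym theorem requires. *)
pose nu := mfrestr mab Foo.
have nudom : nu `<< lebesgue_measure.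
  apply/null_content_dominatesP => A mA A0.
  apply/eqP; rewrite eq_le measure_ge0 andbT.
  rewrite -((null_content_dominatesP _ _).1 Fdom A mA A0).
  by apply: le_measure; rewrite ?inE//; exact: measurableI.
have [g [g0 gfin gint gE]] := radon_nikodym_sigma_finite nudom.
have gK x : (fine (g x))%:E = g x by rewrite fineK.
exists (fine \o g); split.
  apply: (integrableS measurableT) => //.
  by rewrite (_ : EFin \o _ = g)//; apply/funext => x /=.
move=> x /andP[ax xb].
have axI : `]a, x]%classic `&` `]a, b]%classic = `]a, x]%classic.
  apply/setIidPl => t /=; rewrite !in_itv/= => /andP[-> /le_trans]; exact.
have nuE : (\int[lebesgue_measure]_(t in `]a, x]) g t)%E = (f x - f a)%:E.
  rewrite -gE; last exact: measurable_itv.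
  rewrite /= /mfrestr /mrestr axI lebesgue_stieltjes_measure_oc//.
  by rewrite /= /f' /= !clamp_id// ltW.
rewrite -Rintegral_itv_obnd_cbnd /Rintegral.
  by under eq_integral do rewrite /= gK; rewrite nuE.
apply: (integrableS measurableT) => //.
by rewrite (_ : EFin \o _ = g)//; apply/funext => t /=.
Unshelve. all: by end_near. Qed.

(** The increment of [V] over an interval dominates that of [f], so [V] and [V - f] are both
    nondecreasing. *)
Lemma AC_on_integral a b f : a < b -> AC_on a b f ->
  exists g, lebesgue_measure.-integrable `[a, b] (EFin \o g) /\
    forall x, a <= x <= b -> f x - f a = \int[lebesgue_measure]_(t in `[a, x]) g t.
Proof.
move=> ab fac; pose V x := fine (total_variation a x f).
have Vac : AC_on a b V by apply: AC_on_total_variation => //; exact: ltW.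
have bv := AC_on_bounded_variation (ltW ab) fac.
have fin x y : a <= x -> x <= y -> y <= b -> total_variation x y f \is a fin_num.
  move=> ax xy yb; apply/bounded_variationP => //.
  exact: bounded_variationl xy yb (bounded_variationr ax (le_trans xy yb) bv).
have VD x y : a <= x -> x <= y -> y <= b ->
    V y = V x + fine (total_variation x y f).
  move=> ax xy yb; rewrite /V (total_variationD _ ax xy) fineD ?fin//.
  exact: le_trans yb.
have [|g [gint gE]] := AC_nondecreasing_integral ab _ Vac.
  move=> x y; rewrite !in_itv/= => /andP[ax xb] /andP[ay yb] xy.
  by rewrite (VD x y)// lerDl fine_ge0// total_variation_ge0.
have [|h [hint hE]] := AC_nondecreasing_integral ab _ (AC_onB Vac fac).
  move=> x y; rewrite !in_itv/= => /andP[ax xb] /andP[ay yb] xy.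
  rewrite (VD x y)//; suff : f y - f x <= fine (total_variation x y f) by lra.
  apply: le_trans (ler_norm _) _; rewrite -lee_fin fineK ?fin//.
  exact: total_variation_ge.
exists (g \- h); split.
  rewrite (_ : EFin \o _ = (EFin \o g) \- (EFin \o h))%E//.
  by apply: integrableB => //; exact: measurable_itv.
move=> x axb; have sub : `[a, x]%classic `<=` `[a, b]%classic.
  apply: subset_itvl; by case/andP: axb.
rewrite RintegralB//; last 2 first.
- apply: integrableS gint => //.
- apply: integrableS hint => //.
by rewrite -gE// -hE//; ring.
Qed.
End absolute_continuity.

(** * Absolutely continuous functions as integrals of their derivatives *)

Section primitives.
Context {R : realType}.
Local Notation mu := (@lebesgue_measure R).
Implicit Types (a b : R) (f g : R -> R).

Lemma measurable_itvcc a b : measurable (`[a, b]%classic : set R).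
Proof. exact: measurable_itv. Qed.
#[local] Hint Resolve measurable_itvcc : core.

Lemma integrable_subitv a b c d f : a <= c -> d <= b ->
  mu.-integrable `[a, b] (EFin \o f) -> mu.-integrable `[c, d] (EFin \o f).
Proof.
move=> ac db fint; apply: integrableS fint => //.
by move=> x /=; rewrite !in_itv/= => /andP[/(le_trans ac) -> /le_trans]; exact.
Qed.

(** Almost every point is a Lebesgue point of [g], and the integral is differentiable at each of
    them. *)
Lemma ae_derive_integral a b g : mu.-integrable `[a, b] (EFin \o g) ->
  {ae mu, forall x, a < x < b ->
    is_derive x 1 (fun y => \int[mu]_(t in `[a, y]) g t) (g x)}.
Proof.
move=> gint; have gloc := integrable_locally (measurable_itvcc a b) gint.
have := lebesgue_differentiation gloc.
apply: filterS => x gx /andP[ax xb].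
have int : mu.-integrable `[a, b] (EFin \o (g \_ `[a, b])).
  apply: eq_integrable gint => //= t; rewrite inE => tab.
  by rewrite /= patchE mem_set.
have [|dF FE] := @FTC1_lebesgue_pt _ _ (BLeft a) x b xb int _ gx.
  by rewrite lte_fin.
have gE : (g \_ `[a, b]) x = g x by rewrite patchE mem_set//= in_itv/= !ltW.
have : is_derive x 1 (fun y => \int[mu]_(t in `[a, y]) (g \_ `[a, b]) t) (g x).
  by rewrite -gE -FE derive1E; split.
apply: near_eq_is_derive.
near=> y; have yb : y < b by near: y; exact: lt_nbhsl.
apply: eq_Rintegral => t; rewrite inE/= in_itv/= => /andP[at' ty].
by rewrite patchE mem_set//= in_itv/= at'/= (le_trans ty)// ltW.
Unshelve. all: by end_near. Qed.

Definition primitive_on a b g f :=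
  forall x y, a <= x -> x <= y -> y <= b -> f y - f x = \int[mu]_(t in `[x, y]) g t.

Lemma ae_derive_primitive a b g f : mu.-integrable `[a, b] (EFin \o g) ->
  primitive_on a b g f ->
  {ae mu, forall x, a < x < b -> is_derive x 1 f (g x)}.
Proof.
move=> gint fg; have := ae_derive_integral gint.
apply: filterS => x dF /andP[ax xb].
have := dF; rewrite ax xb => /(_ isT) {}dF.
have : is_derive x 1 (fun y => f a + \int[mu]_(t in `[a, y]) g t) (g x).
  by rewrite -[g x]add0r; apply: is_deriveD.
apply: near_eq_is_derive.
near=> y; have yb : y < b by near: y; exact: lt_nbhsl.
have ay : a < y by near: y; exact: lt_nbhsr.
by rewrite -(fg a y) ?lexx ?ltW//; ring.
Unshelve. all: by end_near. Qed.

Lemma AC_on_primitive a b f : a < b -> AC_on a b f ->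
  exists2 g, mu.-integrable `[a, b] (EFin \o g) & primitive_on a b g f.
Proof.
move=> ab /(AC_on_integral ab)[g [gint gE]]; exists g => // x y ax xy yb.
rewrite -Rintegral_itv_obnd_cbnd; last first.
  have := integrable_subitv ax yb gint; apply: integrableS => //.
  exact: subset_itv_oc_cc.
rewrite -(@Rintegral_itvB _ _ (BLeft a) (BRight y)) ?bnd_simp//; last first.
  exact: integrable_subitv gint.
rewrite -!gE ?ax ?yb ?(le_trans ax xy) ?(le_trans xy yb)//; ring.
Qed.

(** The density [h] obtained abstractly is almost everywhere the derivative of [f], hence agrees
    with the prescribed [g] and can be replaced by it. The endpoints, where nothing is known about
    the derivative, form a null set. *)
Lemma AC_on_FTC a b f g : a < b -> AC_on a b f ->
  measurable_fun `[a, b] g ->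
  {ae mu, forall x, a < x < b -> f^`()%classic x = g x} ->
  mu.-integrable `[a, b] (EFin \o g) /\ primitive_on a b g f.
Proof.
move=> ab fac mg fg; have [h hint hE] := AC_on_primitive ab fac.
have hg : ae_eq mu `[a, b]%classic (EFin \o h) (EFin \o g).
  have ha : {ae mu, forall x, x != a}.
    by exists [set a]; split; [exact: measurable_set1|exact: lebesgue_measure_set1|move=> x /= /negP; rewrite negbK => /eqP].
  have hb : {ae mu, forall x, x != b}.
    by exists [set b]; split; [exact: measurable_set1|exact: lebesgue_measure_set1|move=> x /= /negP; rewrite negbK => /eqP].
  have hab : {ae mu, forall x, x != a /\ x != b} by apply: filterS2 ha hb.
  have := ae_derive_primitive hint hE; move: fg hab.
  apply: filterS3 => x fg [xa xb] hx; rewrite /= in_itv/= => /andP[ax bx].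
  have axb : a < x < b by rewrite !lt_neqAle eq_sym xa xb ax bx.
  congr EFin; rewrite -(fg axb) derive1E; have [_ <-] := hx axb.
  by [].
have mh : measurable_fun `[a, b] (EFin \o h) by case/integrableP: hint.
have gint : mu.-integrable `[a, b] (EFin \o g).
  have mg' : measurable_fun `[a, b] (EFin \o g) by exact/measurable_EFinP.
  apply/integrableP; split=> //.
  rewrite (@ae_eq_integral _ _ _ mu _ (abse \o (EFin \o h)) (abse \o (EFin \o g)))//.
  - by case/integrableP: hint.
  - exact: measurableT_comp.
  - exact: measurableT_comp.
  - by apply: filterS hg => x hgx /hgx /= [->].
split=> // x y ax xy yb; rewrite hE// /Rintegral; congr fine.
have sub : `[x, y]%classic `<=` `[a, b]%classic.
  by move=> t /=; rewrite !in_itv/= => /andP[/(le_trans ax) -> /le_trans]; exact.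
apply: ae_eq_integral => //.
- by apply: measurable_funS mh.
- by apply/measurable_EFinP; apply: measurable_funS mg.
- exact: ae_eq_subset hg.
Qed.

Definition cover_oc (s : seq (R * R)) : set R :=
  \big[setU/set0]_(p <- s) `]p.1, p.2]%classic.

Lemma measurable_cover_oc s : measurable (cover_oc s).
Proof. by apply: bigsetU_measurable => p _; exact: measurable_itv. Qed.

Lemma cover_oc_measure s : all (fun p => p.1 <= p.2) s ->
  (mu (cover_oc s) <= (total_length s)%:E)%E.
Proof.
rewrite /cover_oc /total_length; elim: s => [|p s IH] /=.
  by rewrite !big_nil measure0.
move=> /andP[p12 /IH {}IH]; rewrite !big_cons EFinD.
apply: le_trans (measureU2 _ _ _) _.
- exact: measurable_itv.
- exact: measurable_cover_oc.
apply: leeD; last exact: IH.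
rewrite [leLHS]lebesgue_measure_itv /= lte_fin.
by case: ifP => // _; rewrite lee_fin subr_ge0.
Qed.

Lemma Rintegral_cover_oc (f : R -> R) s : mu.-integrable setT (EFin \o f) ->
  all (fun p => p.1 <= p.2) s -> pairwise nonoverlap s ->
  \int[mu]_(x in cover_oc s) f x = \sum_(p <- s) \int[mu]_(x in `]p.1, p.2]) f x.
Proof.
move=> fint; rewrite /cover_oc; elim: s => [|p s IH] /=.
  by rewrite !big_nil Rintegral_set0.
move=> /andP[p12 s12] /andP[ps sn]; rewrite !big_cons Rintegral_setU//=.
- by rewrite IH.
- exact: measurable_cover_oc.
- apply: integrableS fint => //; apply: measurableU; first exact: measurable_itv.
  exact: measurable_cover_oc.
apply/disj_setPS => x [/=]; rewrite in_itv/= => /andP[px xp].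
rewrite -bigcup_seq => -[q /= qs]; rewrite in_itv/= => /andP[qx xq].
have /orP[] := allP ps _ qs => pq.
  by have := le_lt_trans (le_trans xp pq) qx; rewrite ltxx.
by have := le_lt_trans (le_trans xq pq) px; rewrite ltxx.
Qed.

(** Absolute continuity of the integral with respect to the measure of its domain, applied to the
    union of the family. Half-open intervals turn a nonoverlapping family into a disjoint one. *)
Lemma primitive_AC_on a b g f : mu.-integrable `[a, b] (EFin \o g) ->
  primitive_on a b g f -> AC_on a b f.
Proof.
move=> gint fg e e0.
have Gint : mu.-integrable setT (EFin \o (g \_ `[a, b])).
  rewrite -restrict_EFin; apply/(integrable_mkcond _ _).1 => //.
have Gint' : mu.-integrable setT (EFin \o (fun x => `|(g \_ `[a, b]) x|)).
  exact: integrable_abse Gint.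
have [d [d0 Hd]] := integral_normr_continuous Gint e0.
exists d => // s /allP sab sn sd.
have s12 : all (fun p => p.1 <= p.2) s by apply/allP => p /sab /and3P[].
have := Hd _ (measurable_cover_oc s) _.
rewrite Rintegral_cover_oc// => /(_ _)H; apply: le_lt_trans (H _); last first.
  by apply: le_lt_trans (cover_oc_measure s12) _; rewrite lte_fin.
rewrite /total_jump !big_seq; apply: ler_sum => p /sab /and3P[ap pp pb].
rewrite fg// -Rintegral_itv_obnd_cbnd; last first.
  apply: integrableS gint => //= t /=; rewrite !in_itv/=.
  by move=> /andP[/ltW /(le_trans ap) -> /le_trans]; exact.
rewrite [X in `|X|](_ : _ = \int[mu]_(t in `]p.1, p.2]) (g \_ `[a, b]) t).
  by apply: le_normr_Rintegral => //; apply: integrableS Gint.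
apply: eq_Rintegral => t; rewrite inE/= in_itv/= => /andP[pt tp].
by rewrite patchE mem_set//= in_itv/= (le_trans ap (ltW pt)) (le_trans tp).
Qed.

End primitives.

(** * Antiderivatives on [(-1, 1)] and their limits at the endpoints *)

Section antiderivative.
Context {R : realType}.
Local Notation mu := (@lebesgue_measure R).
Implicit Types (a b x y : R) (f g h : R -> R).

#[local] Hint Resolve measurable_itvcc : core.

Lemma is_derive_continuous f x (l : R) : is_derive x 1 f l -> {for x, continuous f}.
Proof. by case=> df _; apply: differentiable_continuous; exact/derivable1_diffP. Qed.

Lemma derive_ge0_le a b f (df : R -> R) : a <= b ->
  (forall x, a <= x <= b -> is_derive x 1 f (df x)) ->
  (forall x, a <= x <= b -> 0 <= df x) -> f a <= f b.
Proof.
move=> ab fd df0; rewrite -subr_ge0.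
have [||c + ->] := @MVT_segment _ f df a b ab.
- by move=> x; rewrite in_itv/= => /andP[ax xb]; apply: fd; rewrite !ltW.
- apply: continuous_in_subspaceT => x; rewrite inE/= in_itv/= => xab.
  exact: is_derive_continuous (fd x xab).
by rewrite in_itv/= => cab; rewrite mulr_ge0 ?subr_ge0// df0.
Qed.

(* [2 M sqrt (1 - x)] is minus a primitive of [M / sqrt (1 - x)], so [f] plus
   it decreases while [f] minus it increases. *)
Lemma endpoint_limit f (df : R -> R) (M : R) :
  (forall x, 0 <= x < 1 -> is_derive x 1 f (df x)) ->
  (forall x, 0 <= x < 1 -> `|df x| <= M / Num.sqrt (1 - x)) ->
  exists L, forall x, 0 <= x < 1 -> `|f x - L| <= 2 * M * Num.sqrt (1 - x).
Proof.
move=> fd dfM; pose s x : R := 2 * M * Num.sqrt (1 - x).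
have sd x : 0 <= x < 1 -> is_derive x 1 s (- (M / Num.sqrt (1 - x))).
  move=> /andP[x0 x1]; have x10 : 0 < 1 - x by rewrite subr_gt0.
  have q0 : Num.sqrt (1 - x) != 0 by rewrite gt_eqF// sqrtr_gt0.
  have d1 : is_derive x 1 (fun y : R => 1 - y) (-1).
    rewrite -[-1]sub0r; exact: is_deriveB.
  have d2 := @is_derive1_comp _ Num.sqrt (fun y : R => 1 - y) x _ _
    (is_derive1_sqrt x10) d1.
  have := @is_deriveM _ _ (cst (2 * M)) _ x 1 _ _ (is_derive_cst _ _ _) d2.
  move=> dm; apply: (is_derive_eq dm); rewrite /GRing.scale/= mulr0 addr0.
  by field.
have dM x : 0 <= x < 1 -> - (M / Num.sqrt (1 - x)) <= df x <= M / Num.sqrt (1 - x).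
  by move=> /dfM; rewrite ler_norml.
have up x y : 0 <= x -> x <= y -> y < 1 -> f y + s y <= f x + s x.
  move=> x0 xy y1; rewrite -lerN2; apply: (derive_ge0_le
    (f := fun t => - (f t + s t)) (df := fun t => - (df t + - (M / Num.sqrt (1 - t))))) => // t /andP[xt ty].
    have t01 : 0 <= t < 1 by rewrite (le_trans x0 xt) (le_lt_trans ty y1).
    by apply: is_deriveN; apply: is_deriveD; [exact: fd|exact: sd].
  have t01 : 0 <= t < 1 by rewrite (le_trans x0 xt) (le_lt_trans ty y1).
  by have /andP[_] := dM _ t01; lra.
have lo x y : 0 <= x -> x <= y -> y < 1 -> f x - s x <= f y - s y.
  move=> x0 xy y1; apply: (derive_ge0_le
    (f := fun t => f t - s t) (df := fun t => df t - - (M / Num.sqrt (1 - t)))) => // t /andP[xt ty].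
    have t01 : 0 <= t < 1 by rewrite (le_trans x0 xt) (le_lt_trans ty y1).
    by apply: is_deriveB; [exact: fd|exact: sd].
  have t01 : 0 <= t < 1 by rewrite (le_trans x0 xt) (le_lt_trans ty y1).
  by have /andP[+ _] := dM _ t01; lra.
have s0 x : 0 <= x < 1 -> 0 <= s x.
  move=> x01; have := dfM 0; rewrite lexx ltr01 => /(_ isT)/(le_trans (normr_ge0 _)).
  rewrite subr0 sqrtr1 divr1 => M0.
  by rewrite mulr_ge0 ?mulr_ge0 ?sqrtr_ge0.
(* Every value of the increasing [f - s] is at most every value of the decreasing [f + s], so the
   supremum of the former separates the two. *)
pose E := [set f x - s x | x in [set x : R | 0 <= x < 1]].
have uplo x y : 0 <= x < 1 -> 0 <= y < 1 -> f y - s y <= f x + s x.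
  move=> /[dup] x01 /andP[x0 x1] /[dup] y01 /andP[y0 y1].
  have [xy|/ltW yx] := leP x y.
    by have := up _ _ x0 xy y1; have := s0 _ y01; lra.
  by have := lo _ _ y0 yx x1; have := s0 _ x01; lra.
have E0 : E !=set0 by exists (f 0 - s 0), 0 => //=; rewrite lexx ltr01.
exists (sup E) => x x01; rewrite -/(s x) ler_norml; apply/andP; split.
  suff : sup E <= f x + s x by lra.
  apply: ge_sup => // _ [y /= y01 <-]; exact: uplo.
suff : f x - s x <= sup E by lra.
apply: ub_le_sup; last by exists x.
by exists (f x + s x) => _ [y /= y01 <-]; exact: uplo.
Qed.

Lemma Rintegral_itvD a b c g : a <= b -> b <= c ->
  mu.-integrable `[a, c] (EFin \o g) ->
  \int[mu]_(t in `[a, b]) g t + \int[mu]_(t in `[b, c]) g t =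
  \int[mu]_(t in `[a, c]) g t.
Proof.
move=> ab bc gint.
rewrite -(@Rintegral_itv_obnd_cbnd _ b (BRight c)); last first.
  have := integrable_subitv ab (lexx c) gint; apply: integrableS => //.
  exact: subset_itv_oc_cc.
rewrite -(@Rintegral_itvB _ _ (BLeft a) (BRight c)) ?bnd_simp//; ring.
Qed.

Definition locally_integrable11 g :=
  forall a b, -1 < a -> b < 1 -> mu.-integrable `[a, b] (EFin \o g).

Definition primitive11 g f := forall x y, -1 < x -> x <= y -> y < 1 ->
  f y - f x = \int[mu]_(t in `[x, y]) g t.

(** The oriented integral from 0 to [x]; an integral over a set has no orientation, hence the two
    cases. *)
Definition primitive0 g x := if 0 <= x then \int[mu]_(t in `[0, x]) g t
  else - \int[mu]_(t in `[x, 0]) g t.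

Lemma primitive11_on a b g f : -1 < a -> b < 1 -> primitive11 g f ->
  primitive_on a b g f.
Proof.
move=> a1 b1 fg x y ax xy yb; apply: fg => //; first exact: lt_le_trans ax.
exact: le_lt_trans b1.
Qed.

Lemma primitive0P g : locally_integrable11 g -> primitive11 g (primitive0 g).
Proof.
move=> gint x y x1 xy y1; rewrite /primitive0.
have [x0|x0] := leP 0 x.
  rewrite (le_trans x0 xy) -(Rintegral_itvD x0 xy); last by apply: gint.
  by rewrite addrC addKr.
have [y0|y0] := leP 0 y.
  rewrite opprK -(Rintegral_itvD (ltW x0) y0); last exact: gint.
  exact: addrC.
rewrite opprK addrC -(Rintegral_itvD xy (ltW y0)); last by apply: gint.
by rewrite addrK.
Qed.

Lemma primitive0_0 g : primitive0 g 0 = 0.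
Proof. by rewrite /primitive0 lexx set_itv1 Rintegral_set1. Qed.

Lemma itv11_near x : -1 < x < 1 -> exists a b,
  [/\ -1 < a, a < x, x < b & b < 1].
Proof.
by move=> /andP[x1 x2]; exists ((x - 1) / 2), ((x + 1) / 2); split; lra.
Qed.

Lemma primitive11_continuous g f : locally_integrable11 g -> primitive11 g f ->
  forall x, -1 < x < 1 -> {for x, continuous f}.
Proof.
move=> gint fg x /itv11_near[a [b [a1 ax xb b1]]].
have fac := primitive_AC_on (gint _ _ a1 b1) (primitive11_on a1 b1 fg).
apply/cvgrPdist_lt => e e0; have [d d0 Hd] := AC_on_dist fac e0.
near=> y.
have ay : a <= y by apply/ltW; near: y; exact: lt_nbhsr.
have yb : y <= b by apply/ltW; near: y; exact: lt_nbhsl.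
have : `|x - y| < d by near: y; exact: cvgr_dist_lt.
have [xy|/ltW yx] := leP x y.
  rewrite distrC (distrC (f x)) ger0_norm ?subr_ge0// => xyd.
  by apply: Hd => //; exact: ltW.
by rewrite ger0_norm ?subr_ge0// => xyd; apply: Hd => //; exact: ltW.
Unshelve. all: by end_near. Qed.

Lemma primitive11_derive g f : locally_integrable11 g -> primitive11 g f ->
  (forall x, -1 < x < 1 -> {for x, continuous g}) ->
  forall x, -1 < x < 1 -> is_derive x 1 f (g x).
Proof.
move=> gint fg gc x xI; have [a [b [a1 ax xb b1]]] := itv11_near xI.
have [|||dF FE] := @continuous_FTC1 _ g (BLeft a) x b xb.
- exact: gint.
- by rewrite lte_fin.
- exact: gc.
have : is_derive x 1 (fun y => f a + \int[mu]_(t in `[a, y]) g t) (g x).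
  by rewrite -[g x]add0r; apply: is_deriveD; rewrite -FE derive1E; split.
apply: near_eq_is_derive.
near=> y; have yb : y < b by near: y; exact: lt_nbhsl.
have ay : a < y by near: y; exact: lt_nbhsr.
by rewrite -(fg a y) ?ltW ?(lt_trans yb)//; ring.
Unshelve. all: by end_near. Qed.

Lemma continuous_locally_integrable11 g :
  (forall x, -1 < x < 1 -> {for x, continuous g}) -> locally_integrable11 g.
Proof.
move=> gc a b a1 b1; apply: continuous_compact_integrable.
  exact: segment_compact.
apply: continuous_in_subspaceT => x; rewrite inE/= in_itv/= => /andP[ax xb].
by apply: gc; rewrite (lt_le_trans a1 ax) (le_lt_trans xb b1).
Qed.

End antiderivative.

(** * The equation [- (1 - x^2) f'' = h] *)

Section singular_ode.
Context {R : realType}.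
Local Notation mu := (@lebesgue_measure R).
Local Notation weight := (@weight R).
Local Notation itv11 := (@itv11 R).
Implicit Types (a b x y : R) (f g h : R -> R).

#[local] Hint Resolve measurable_itvcc : core.

Lemma measurable_itv11R : measurable (itv11 : set (measurableTypeR R)).
Proof. exact: measurable_itv11. Qed.

Lemma measurable_itvccR a b : measurable (`[a, b]%classic : set (measurableTypeR R)).
Proof. exact: measurable_itvcc. Qed.

#[local] Hint Extern 0 (measurable _) => solve [exact: measurable_itv11R | exact: measurable_itvccR
  | exact: measurable_itv11 | exact: measurable_itvcc] : core.

Lemma integrable_EFinD (D : set (measurableTypeR R)) f g : measurable D ->
  mu.-integrable D (EFin \o f) -> mu.-integrable D (EFin \o g) ->
  mu.-integrable D (EFin \o (fun x => f x + g x)).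
Proof. by move=> mD fi gi; have := integrableD mD fi gi; apply: eq_integrable. Qed.

Lemma integrable_EFinZ (D : set (measurableTypeR R)) (k : R) f : measurable D ->
  mu.-integrable D (EFin \o f) -> mu.-integrable D (EFin \o (fun x => k * f x)).
Proof. by move=> mD fi; have := integrableZl mD k fi; apply: eq_integrable. Qed.

Lemma is_derive_affine (c d x : R) : is_derive x 1 (fun t => c + d * t) d.
Proof.
have := is_deriveD (is_derive_cst c x 1) (is_deriveZ d (is_derive_id x 1)).
by move=> dc; apply: (is_derive_eq dc); rewrite add0r /GRing.scale/= mulr1.
Qed.

Definition real_sqint h := measurable_fun itv11 h /\
  mu.-integrable itv11 (EFin \o (fun x => h x ^+ 2 * weight x)).

(* The value of [f''] prescribed by [- (1 - x^2) f'' = h]. *)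
Definition source h x := - (h x * weight x).

(** The second-order equation is integrated once. In this form it says nothing about [f''] at
    individual points, yet makes [f'] locally absolutely continuous. *)
Definition real_solution f h :=
  (forall x, -1 < x < 1 -> derivable f x 1) /\ primitive11 (source h) f^`()%classic.

Definition wnorm2 h := \int[mu]_(x in itv11) (h x ^+ 2 * weight x).

Lemma sub_itv11 a b : -1 < a -> b < 1 -> `[a, b]%classic `<=` itv11.
Proof.
move=> a1 b1 x /=; rewrite in_itv/= => /andP[ax xb]; apply/itv11P.
by rewrite (lt_le_trans a1) ?(le_lt_trans xb).
Qed.

Lemma measurable_source h : measurable_fun itv11 h -> measurable_fun itv11 (source h).
Proof.
move=> mh; rewrite (_ : source h = (fun x => (- h x) * weight x)).
  apply: measurable_funM; first exact: measurable_funN.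
  exact: measurable_weight.
by apply/funext => x; rewrite /source mulNr.
Qed.

Lemma source_integrable h : real_sqint h -> locally_integrable11 (source h).
Proof.
move=> [mh hint] a b a1 b1; have sub := sub_itv11 a1 b1.
have [ab|ba] := leP a b; last first.
  by rewrite set_itv_ge ?bnd_simp -?ltNge//; exact: integrable_set0.
(* On [[a, b]] the factors of [1 - x^2] are at least [1 - b] and [1 + a], which bounds the
   weight. *)
pose c := ((1 - b) * (1 + a))^-1.
have cint : mu.-integrable `[a, b] (EFin \o cst c).
  apply: continuous_compact_integrable; first exact: segment_compact.
  by apply: continuous_subspaceT => x; exact: cst_continuous.
apply: (@le_integrable _ _ _ mu _ _ _
  (fun x => (h x ^+ 2 * weight x)%:E + c%:E)%E) => //.
- apply/measurable_EFinP; apply: (measurable_funS _ sub (measurable_source mh)).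
  exact: measurable_itv11.
- move=> x /[dup] xab /sub xI /=; have w0 := weight_gt0 xI.
  rewrite lee_fin /source normrN normrM (gtr0_norm w0).
  apply: le_trans (ler_norm _).
  have wc : weight x <= c.
    move/itv11P : xI => /andP[x1 x2]; move: xab; rewrite /= in_itv/= => /andP[ax xb].
    rewrite /weight lef_pV2 ?posrE; nra.
  have : `|h x| <= h x ^+ 2 + 1.
    by rewrite -real_normK ?num_real//; have := sqr_ge0 (`|h x| - 1); nra.
  by move/(ler_wpM2r (ltW w0)) => /le_trans; apply; rewrite mulrDl mul1r lerD2l.
- by apply: integrableD => //; apply: integrableS hint.
Qed.

(* Weighted Cauchy-Schwarz, through [2 |h| <= c h^2 + 1 / c] with
   [1 / c = M sqrt r]. *)
Lemma source_integral_le h (M r : R) x y : real_sqint h -> 0 < M ->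
  wnorm2 h <= M ^+ 2 -> -1 < x -> x <= y -> y < 1 -> y - x <= 1 -> 0 < r ->
  (forall t, x <= t <= y -> weight t <= r^-1) ->
  `|\int[mu]_(t in `[x, y]) source h t| <= M / Num.sqrt r.
Proof.
move=> sh M0 hM x1 xy y1 yx r0 wr; have [mh hint] := sh.
have sub := sub_itv11 x1 y1.
have q0 : 0 < Num.sqrt r by rewrite sqrtr_gt0.
pose c := (M * Num.sqrt r)^-1; have c0 : 0 < c by rewrite invr_gt0 mulr_gt0.
have sint := source_integrable sh x1 y1.
apply: le_trans (le_normr_Rintegral _ sint) _ => //.
have hint' : mu.-integrable `[x, y] (EFin \o (fun x => h x ^+ 2 * weight x)).
  by apply: integrableS hint.
have hint2 : mu.-integrable `[x, y] (EFin \o (fun x => c / 2 * (h x ^+ 2 * weight x))).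
  exact: integrable_EFinZ.
pose k := c^-1 / 2 * r^-1.
have kint : mu.-integrable `[x, y] (EFin \o cst k).
  apply: continuous_compact_integrable; first exact: segment_compact.
  by apply: continuous_subspaceT => t; exact: cst_continuous.
apply: (@le_trans _ _ (\int[mu]_(t in `[x, y]) (c / 2 * (h t ^+ 2 * weight t) + cst k t))).
  apply: le_Rintegral => //.
  - exact: integrable_abse sint.
  - exact: integrable_EFinD.
  move=> t /[dup] txy /sub tI; have w0 := weight_gt0 tI.
  rewrite /source normrN normrM (gtr0_norm w0) /=.
  have wrt : weight t <= r^-1 by apply: wr; move: txy; rewrite /= in_itv.
  have H : `|h t| <= c / 2 * h t ^+ 2 + c^-1 / 2.
    rewrite -(real_normK (num_real (h t))).
    have -> : c / 2 * `|h t| ^+ 2 + c^-1 / 2 =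
      `|h t| + c / 2 * (`|h t| - c^-1) ^+ 2 by field; rewrite gt_eqF.
    by rewrite lerDl mulr_ge0 ?sqr_ge0// divr_ge0// ltW.
  apply: le_trans (ler_wpM2r (ltW w0) H) _.
  rewrite mulrDl -(mulrA (c / 2)) lerD2l /k ler_wpM2l// divr_ge0// invr_ge0 ltW//.
rewrite RintegralD// RintegralZl// Rintegral_cst//.
have I1 : \int[mu]_(t in `[x, y]) (h t ^+ 2 * weight t) <= M ^+ 2.
  apply: le_trans hM; rewrite /wnorm2 /Rintegral fine_le//.
  - exact: integrable_fin_num hint'.
  - exact: integrable_fin_num hint.
  apply: ge0_subset_integral => //; first by case/integrableP: hint.
  by move=> t tI /=; rewrite lee_fin mulr_ge0 ?sqr_ge0 ?ltW// weight_gt0.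
have -> : fine (mu `[x, y]) = y - x.
  rewrite lebesgue_measure_itv/= lte_fin; case: ltP => //= yx'.
  by apply/eqP; rewrite eq_sym subr_eq0 eq_le xy yx'.
have qr : r = Num.sqrt r ^+ 2 by rewrite sqr_sqrtr// ltW.
have k0 : 0 <= k by rewrite ltW// divr_gt0// divr_gt0// invr_gt0.
(* With [1 / c = M sqrt r] each of the two terms equals [M / (2 sqrt r)]. *)
have -> : M / Num.sqrt r = c / 2 * M ^+ 2 + k.
  rewrite /k {2}qr /c; field.
  by rewrite !gt_eqF.
apply: lerD; first by rewrite ler_wpM2l// divr_ge0// ltW.
by rewrite -[leRHS]mulr1 ler_wpM2l.
Qed.

Lemma weight_le_right x t : 0 <= x < 1 -> 0 <= t <= x -> weight t <= (1 - x)^-1.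
Proof.
move=> /andP[x0 x1] /andP[t0 tx]; rewrite /weight lef_pV2 ?posrE; nra.
Qed.

Lemma weight_le_left x t : -1 < x <= 0 -> x <= t <= 0 -> weight t <= (1 + x)^-1.
Proof.
move=> /andP[x0 x1] /andP[t0 tx]; rewrite /weight lef_pV2 ?posrE; nra.
Qed.

Lemma real_solution_exists h (M : R) : real_sqint h -> 0 < M ->
  wnorm2 h <= M ^+ 2 -> exists f, real_solution f h /\
    forall x, -1 < x < 1 -> f x ^+ 2 <= 16 * M ^+ 2 * (1 - x ^+ 2).
Proof.
move=> sh M0 hM; have sint := source_integrable sh.
pose p := primitive0 (source h); have pP : primitive11 (source h) p := primitive0P sint.
have pc := primitive11_continuous sint pP.
have pint := continuous_locally_integrable11 pc.
pose q := primitive0 p; have qP : primitive11 p q := primitive0P pint.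
have qd := primitive11_derive pint qP pc.
have p0 : p 0 = 0 := primitive0_0 _.
have q0 : q 0 = 0 := primitive0_0 _.
have pr x : 0 <= x < 1 -> `|p x| <= M / Num.sqrt (1 - x).
  move=> x01; have /andP[x0 x1] := x01.
  have -> : p x = \int[mu]_(t in `[0, x]) source h t by rewrite -pP ?ltrN10// p0 subr0.
  apply: source_integral_le => //; rewrite ?ltrN10 ?subr0 ?subr_gt0 ?ltW//.
  by move=> t; exact: weight_le_right.
have pl x : 0 <= x < 1 -> `|p (- x)| <= M / Num.sqrt (1 - x).
  move=> /andP[x0 x1].
  have pE : - p (- x) = \int[mu]_(t in `[- x, 0]) source h t.
    by rewrite -pP ?p0 ?sub0r// ?oppr_le0 ?ltrN2.
  rewrite -normrN pE.
  apply: source_integral_le => //; rewrite ?ltrN2 ?oppr_le0 ?sub0r ?opprK ?subr_gt0//.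
    exact: ltW.
  by move=> t; apply: weight_le_left; rewrite ltrN2 x1 oppr_le0.
have [||Lr Lr_le] := @endpoint_limit _ q p M; [|exact: pr|].
  by move=> x /andP[x0 x1]; apply: qd; rewrite (lt_le_trans _ x0) ?ltrN10.
(* The left endpoint is reduced to the right one by the reflection [x |-> - x]. *)
have [||Ll Ll_le] := @endpoint_limit _ (fun x => q (- x)) (fun x => - p (- x)) M.
- move=> x /andP[x0 x1].
  have dq : is_derive (- x) 1 q (p (- x)) by apply: qd; lra.
  have dN : is_derive x 1 (fun t : R => - t) (-1) by exact: is_deriveN.
  have := @is_derive1_comp _ q (fun t : R => - t) x _ _ dq dN.
  by move=> dc; apply: (is_derive_eq dc); rewrite mulrN1.
- by move=> x x01; rewrite normrN pl.
(* The affine function with the limits of [q] as its values at the endpoints. *)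
pose l x := Lr * ((1 + x) / 2) + Ll * ((1 - x) / 2).
have ld x : is_derive x 1 l ((Lr - Ll) / 2).
  have -> : l = (fun t => (Lr + Ll) / 2 + (Lr - Ll) / 2 * t).
    by apply/funext => t; rewrite /l; field.
  exact: is_derive_affine.
have fd x : -1 < x < 1 -> is_derive x 1 (fun t => q t - l t) (p x - (Lr - Ll) / 2).
  by move=> xI; apply: is_deriveB; exact: qd.
exists (fun t => q t - l t); split; first split.
- by move=> x /fd[].
- move=> x y x1 xy y1; have xI : -1 < x < 1 by rewrite x1 (le_lt_trans xy).
  have yI : -1 < y < 1 by rewrite y1 (lt_le_trans x1).
  rewrite !derive1E; have [_ ->] := fd _ xI; have [_ ->] := fd _ yI.
  by rewrite -pP//; ring.
(* Here [L] is the limit at the endpoint on the side of [x] and [L'] the limit at the opposite one.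
   With [s = sqrt (1 - x) <= 1], both [u - L] and [(L - L') / 2 * s^2] are at most [2 M s] in
   absolute value. Their sum has square at most [16 M^2 (1 - x)], and [1 - x <= 1 - x^2]. *)
have aux (u L L' x : R) : 0 <= x < 1 -> `|u - L| <= 2 * M * Num.sqrt (1 - x) ->
    `|L| <= 2 * M -> `|L'| <= 2 * M ->
    (u - (L * ((1 + x) / 2) + L' * ((1 - x) / 2))) ^+ 2 <= 16 * M ^+ 2 * (1 - x ^+ 2).
  move=> /andP[x0 x1]; have s0 := sqrtr_ge0 (1 - x).
  have : Num.sqrt (1 - x) ^+ 2 = 1 - x by rewrite sqr_sqrtr// subr_ge0 ltW.
  move: s0; set s := Num.sqrt _ => s0 sE uL /ler_normlP[L1 L2] /ler_normlP[L'1 L'2].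
  have s1 : s <= 1 by rewrite -sqrtr1 ler_wsqrtr//; lra.
  have : `|u - (L * ((1 + x) / 2) + L' * ((1 - x) / 2))| <= 4 * M * s.
    have -> : u - (L * ((1 + x) / 2) + L' * ((1 - x) / 2)) =
      (u - L) + (L - L') / 2 * s ^+ 2 by rewrite sE; field.
    apply: le_trans (ler_normD _ _) _.
    have : `|(L - L') / 2 * s ^+ 2| <= 2 * M * s.
      rewrite normrM (ger0_norm (sqr_ge0 _)) expr2 mulrA ler_wpM2r//.
      have : `|(L - L') / 2| <= 2 * M by rewrite ler_norml; apply/andP; split; lra.
      by have := normr_ge0 ((L - L') / 2); nra.
    by lra.
  move=> H; rewrite -real_normK ?num_real//.
  apply: (@le_trans _ _ ((4 * M * s) ^+ 2)).
    by rewrite ler_sqr ?nnegrE// mulr_ge0// mulr_ge0// ltW.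
  rewrite !exprMn sE -[leLHS]mulrA; have -> : (4 : R) ^+ 2 = 16 by ring.
  by rewrite -mulrA ler_wpM2l// ler_wpM2l ?sqr_ge0//; nra.
(* The limit estimate is read at [x = 0], where [q] vanishes. *)
have Lr2 : `|Lr| <= 2 * M.
  have := Lr_le 0; rewrite lexx ltr01 => /(_ isT).
  by rewrite q0 sub0r normrN subr0 sqrtr1 mulr1.
have Ll2 : `|Ll| <= 2 * M.
  have := Ll_le 0; rewrite lexx ltr01 => /(_ isT).
  by rewrite !oppr0 addr0 q0 sub0r normrN sqrtr1 mulr1.
move=> x /andP[x1 x2]; have [x0|x0] := leP 0 x.
  by apply: aux => //; [rewrite x0|apply: Lr_le; rewrite x0].
have x01 : 0 <= - x < 1 by rewrite oppr_ge0 ltW//= ltrNl.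
have := aux (q x) Ll Lr (- x) x01 _ Ll2 Lr2; rewrite sqrrN opprK.
rewrite /l addrC => H; apply: le_trans (H _).
  by rewrite le_eqVlt; apply/orP; left; apply/eqP; congr (_ ^+ 2); ring.
by have := Ll_le _ x01; rewrite !opprK addrC.
Qed.

Lemma solution_continuous f h : real_solution f h ->
  forall x, -1 < x < 1 -> {for x, continuous f}.
Proof.
by move=> [fd _] x /fd dx; apply: differentiable_continuous; exact/derivable1_diffP.
Qed.

Lemma solution_measurable f h : real_solution f h -> measurable_fun itv11 f.
Proof.
move=> /solution_continuous fc; apply: open_continuous_measurable_fun.
  exact: itv_open.
by move=> x; rewrite inE => /itv11P; exact: fc.
Qed.

Lemma mu_itv11 : mu itv11 = (2 : R)%:E.
Proof.
have N11 : (-1 : R) < 1 by lra.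
by rewrite lebesgue_measure_itv/= lte_fin N11 -EFinB opprK.
Qed.

Lemma integrable_cst11 (k : R) : mu.-integrable itv11 (EFin \o cst k).
Proof.
apply/integrableP; split; first exact/measurable_EFinP/measurable_cst.
under eq_integral do rewrite /=.
by rewrite integral_cst//= mu_itv11 -EFinM ltry.
Qed.

(** The factor [1 - x^2] cancels the weight, so the integrand is at most [K] on an interval of
    length 2. *)
Lemma bounded_real_sqint f (K : R) : measurable_fun itv11 f ->
  (forall x, -1 < x < 1 -> f x ^+ 2 <= K * (1 - x ^+ 2)) ->
  real_sqint f /\ wnorm2 f <= 2 * K.
Proof.
move=> mf fK.
have mfw : measurable_fun itv11 (fun x => f x ^+ 2 * weight x).
  by apply: measurable_funM; [exact: measurable_funX|exact: measurable_weight].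
have fwK x : itv11 x -> f x ^+ 2 * weight x <= K.
  move=> /[dup] /weight_gt0 w0 /itv11P /[dup] xI /fK fx.
  by rewrite /weight ler_pdivrMr//; nra.
have fint : mu.-integrable itv11 (EFin \o (fun x => f x ^+ 2 * weight x)).
  apply: (@le_integrable _ _ _ mu _ _ _ (EFin \o cst K)) => //.
  - exact/measurable_EFinP.
  - move=> x xI /=; rewrite lee_fin (le_trans _ (ler_norm _))//.
    by rewrite ger0_norm ?fwK// mulr_ge0 ?sqr_ge0// ltW// weight_gt0.
  - exact: integrable_cst11.
split=> //; rewrite /wnorm2; apply: (@le_trans _ _ (\int[mu]_(x in itv11) cst K x)).
  by apply: le_Rintegral => //; exact: integrable_cst11.
by rewrite Rintegral_cst//= mu_itv11/= mulrC.
Qed.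

(* At an endpoint where an affine function does not vanish, its square times
   the weight is of order [1 / t] on an interval of length [t] at distance [t],
   which contradicts the absolute continuity of the integral as [t] tends to 0. *)
Lemma affine_blowup (c d x t : R) : 0 < t -> 4 * t * `|d| <= `|c + d| ->
  2 * t < 1 -> 1 - 2 * t <= x <= 1 - t ->
  (c + d) ^+ 2 / 16 / t <= (c + d * x) ^+ 2 * weight x.
Proof.
move=> t0 td t1 /andP[x1 x2].
have x10 : 0 < 1 - x ^+ 2 by nra.
have H : `|c + d| / 2 <= `|c + d * x|.
  have -> : c + d * x = (c + d) - d * (1 - x) by ring.
  apply: le_trans (lerB_dist _ _).
  have : `|d * (1 - x)| <= `|c + d| / 2.
    rewrite normrM (@ger0_norm _ (1 - x)); last lra.
    by have := normr_ge0 d; nra.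
  lra.
have H2 : (c + d) ^+ 2 / 4 <= (c + d * x) ^+ 2.
  rewrite -(real_normK (num_real (c + d))) -(real_normK (num_real (c + d * x))).
  by have := normr_ge0 (c + d); nra.
rewrite /weight ler_pdivlMr// mulrAC ler_pdivrMr//.
apply: (@le_trans _ _ ((c + d) ^+ 2 / 4 * t)); last by rewrite ler_wpM2r// ltW.
have : 1 - x ^+ 2 <= 4 * t by nra.
by have := sqr_ge0 (c + d); nra.
Qed.

(** Such a lower bound on [[x, y]] makes the integral there at least [k], which absolute continuity
    of the integral excludes on short intervals. *)
Lemma integral_lower_bound (v : R -> R) (k : R) : 0 < k ->
  mu.-integrable itv11 (EFin \o v) -> exists2 e : R, 0 < e &
  forall x y, -1 < x -> x < y -> y < 1 -> y - x < e ->
    ~ (forall t, x <= t <= y -> k / (y - x) <= v t).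
Proof.
move=> k0 vint.
have Vint : mu.-integrable setT (EFin \o (v \_ itv11)).
  rewrite -restrict_EFin; exact/(integrable_mkcond _ _).1.
have [e [e0 He]] := integral_normr_continuous Vint k0.
exists e => // x y x1 xy y1 yxe vk.
have muxy : mu `[x, y]%classic = (y - x)%:E.
  by rewrite lebesgue_measure_itv/= lte_fin xy.
have := He `[x, y]%classic (measurable_itvccR x y).
have muxye : (mu `[x, y]%classic < e%:E)%E by rewrite muxy lte_fin.
move=> /(_ muxye); apply/negP; rewrite -leNgt.
have cint : mu.-integrable `[x, y] (EFin \o cst (k / (y - x))).
  apply: integrableS (integrable_cst11 _) => //; exact: sub_itv11.
apply: (@le_trans _ _ (\int[mu]_(t in `[x, y]) cst (k / (y - x)) t)).
  rewrite Rintegral_cst// [X in _ * fine X]muxy /= divfK// gt_eqF// subr_gt0//.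
apply: le_Rintegral => //.
  have : mu.-integrable `[x, y] (EFin \o v \_ itv11) by apply: integrableS Vint.
  by move=> /integrable_abse; apply: eq_integrable.
move=> t /[dup] /(sub_itv11 x1 y1) tI; rewrite /= in_itv/= => txy.
by rewrite patchE mem_set//= (le_trans (vk _ txy))// ler_norm.
Qed.

Lemma affine_sqint c d : real_sqint (fun x => c + d * x) -> c = 0 /\ d = 0.
Proof.
(* The sign [s] selects an endpoint; an affine function vanishing at both endpoints is zero. *)
suff aux (s : R) : s = 1 \/ s = -1 -> real_sqint (fun x => c + d * x) -> c + s * d = 0.
  move=> cd; have := aux 1 (or_introl erefl) cd.
  have := aux (-1) (or_intror erefl) cd; lra.
move=> s1 [_ cdint]; apply/eqP/contraT => cd0.
have ss : s * s = 1 by case: s1 => ->; ring.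
have k0 : 0 < (c + s * d) ^+ 2 / 16 by rewrite divr_gt0// exprn_even_gt0.
have [e e0 He] := integral_lower_bound k0 cdint.
have n0 : 0 < `|c + s * d| by rewrite normr_gt0.
(* The three bounds on [t] give an interval shorter than [e], the inequality [2 t < 1], and the
   smallness of [t] relative to the slope. The added 1 keeps the denominator positive when
   [d = 0]. *)
pose t := Num.min (e / 2) (Num.min (1 / 4) (`|c + s * d| / (4 * (`|d| + 1)))).
have d1 : 0 < `|d| + 1 by rewrite ltr_wpDl.
have t0 : 0 < t by rewrite !lt_min !divr_gt0// mulr_gt0.
have te : t < e.
  by apply: (@le_lt_trans _ _ (e / 2)); [rewrite ge_min lexx|lra].
have t4 : t <= 1 / 4 by rewrite !ge_min lexx orbT.
have td : 4 * t * `|s * d| <= `|c + s * d|.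
  have : t <= `|c + s * d| / (4 * (`|d| + 1)) by rewrite !ge_min lexx !orbT.
  rewrite ler_pdivlMr ?mulr_gt0// => H.
  have -> : `|s * d| = `|d| by case: s1 => ->; rewrite ?mul1r// mulN1r normrN.
  by have := normr_ge0 d; nra.
have t2 : 2 * t < 1 by lra.
have blow x : 1 - 2 * t <= s * x <= 1 - t ->
    (c + s * d) ^+ 2 / 16 / t <= (c + d * x) ^+ 2 * weight x.
  move=> /(affine_blowup t0 td t2); rewrite /weight mulrACA ss mul1r exprMn.
  by rewrite [s ^+ 2]expr2 ss mul1r.
case: s1 => sE; rewrite sE in blow He.
  have := He (1 - 2 * t) (1 - t); have -> : 1 - t - (1 - 2 * t) = t by ring.
  by move=> H; exfalso; apply: H; try lra; move=> x xI; apply: blow; rewrite mul1r.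
have := He (- (1 - t)) (- (1 - 2 * t)).
have -> : - (1 - 2 * t) - - (1 - t) = t by ring.
by move=> H; exfalso; apply: H; try lra; move=> x xI; apply: blow; rewrite mulN1r; lra.
Qed.

Lemma real_sqint_lin (a : R) f g : real_sqint f -> real_sqint g ->
  real_sqint (fun x => a * f x + g x).
Proof.
move=> [mf fi] [mg gi].
have ml : measurable_fun itv11 (fun x => a * f x + g x).
  by apply: measurable_funD => //; exact: measurable_funM.
split=> //; apply: (@le_integrable _ _ _ mu _ _ _ (EFin \o
    (fun x => 2 * a ^+ 2 * (f x ^+ 2 * weight x) + 2 * (g x ^+ 2 * weight x)))) => //.
- apply/measurable_EFinP; apply: measurable_funM; last exact: measurable_weight.
  exact: measurable_funX.
- move=> x xI /=; have w0 := weight_gt0 xI.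
  rewrite lee_fin (le_trans _ (ler_norm _))// ger0_norm; last first.
    by rewrite mulr_ge0 ?sqr_ge0// ltW.
  rewrite !mulrA -mulrDl ler_wpM2r ?(ltW w0)//.
  by have := sqr_ge0 (a * f x - g x); rewrite !sqrrD; lra.
- by apply: integrable_EFinD => //; exact: integrable_EFinZ.
Qed.

Lemma eq_real_sqint f g : (forall x, -1 < x < 1 -> f x = g x) -> real_sqint f ->
  real_sqint g.
Proof.
move=> fg [mf fi]; split.
  by apply: eq_measurable_fun mf => x; rewrite inE => /itv11P/fg.
by apply: eq_integrable fi => //= x; rewrite inE => /itv11P/fg /= ->.
Qed.

Lemma source_lin (a : R) h k x : source (fun t => a * h t + k t) x =
  a * source h x + source k x.
Proof. by rewrite /source; ring. Qed.

Lemma derive1_lin (a : R) f g x : derivable f x 1 -> derivable g x 1 ->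
  is_derive x 1 (fun t => a * f t + g t) (a * f^`()%classic x + g^`()%classic x).
Proof.
move=> df dg; rewrite !derive1E.
have df' : is_derive x 1 f ('D_1 f x) by [].
have dg' : is_derive x 1 g ('D_1 g x) by [].
exact: (is_deriveD (is_deriveZ a df') dg').
Qed.

Lemma real_solution_lin (a : R) f g h k : real_sqint h -> real_sqint k ->
  real_solution f h -> real_solution g k ->
  real_solution (fun x => a * f x + g x) (fun x => a * h x + k x).
Proof.
move=> sh sk [df fh] [dg gk]; split.
  by move=> x xI; have [] := derive1_lin a (df x xI) (dg x xI).
move=> x y x1 xy y1.
have xI : -1 < x < 1 by rewrite x1 (le_lt_trans xy).
have yI : -1 < y < 1 by rewrite y1 (lt_le_trans x1).
have E t : -1 < t < 1 -> (fun x => a * f x + g x)^`()%classic t =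
    a * f^`()%classic t + g^`()%classic t.
  by move=> tI; rewrite derive1E; have [_ ->] := derive1_lin a (df t tI) (dg t tI).
rewrite !E//.
under eq_Rintegral do rewrite source_lin.
rewrite RintegralD//; last 2 first.
- by apply: integrable_EFinZ => //; exact: source_integrable.
- exact: source_integrable.
by rewrite RintegralZl ?source_integrable// -fh// -gk//; ring.
Qed.

Lemma is_derive_zero_cst f : (forall x, -1 < x < 1 -> is_derive x 1 f 0) ->
  forall x, -1 < x < 1 -> f x = f 0.
Proof.
move=> fd; have le x y : -1 < x -> x <= y -> y < 1 -> f x = f y.
  move=> x1 xy y1; have I t : x <= t <= y -> -1 < t < 1.
    by move=> /andP[xt ty]; rewrite (lt_le_trans x1)// (le_lt_trans ty).
  apply/eqP; rewrite eq_le; apply/andP; split.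
    by apply: (derive_ge0_le (df := cst 0)) => // t /I/fd.
  rewrite -lerN2; apply: (derive_ge0_le (f := fun t => - f t) (df := cst 0)) => // t /I/fd.
  by move=> d; rewrite /cst -oppr0; exact: is_deriveN.
move=> x /andP[x1 x2]; have [x0|/ltW x0] := leP 0 x.
  by apply/esym/le => //; rewrite ltrN10.
by apply: le => //; exact: ltr01.
Qed.

Lemma real_solution_unique f g h : real_sqint h -> real_sqint f -> real_sqint g ->
  real_solution f h -> real_solution g h -> forall x, -1 < x < 1 -> f x = g x.
Proof.
move=> sh sf sg fh gh.
pose u x := -1 * g x + f x.
have [ud up] : real_solution u (fun x => -1 * h x + h x) by exact: real_solution_lin.
have su : real_sqint u by exact: real_sqint_lin.
have d0 : -1 < (0 : R) < 1 by rewrite ltrN10 ltr01.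
pose d := u^`()%classic 0.
have udE x : -1 < x < 1 -> is_derive x 1 u d.
  move=> xI; have -> : d = u^`()%classic x; last by rewrite derive1E; split => //; exact: ud.
  have z y z' : \int[mu]_(t in `[y, z']) source (fun x => -1 * h x + h x) t = 0.
    under eq_Rintegral do rewrite source_lin mulN1r addNr.
    by rewrite Rintegral_cst//= mul0r.
  have /andP[x1 x2] := xI; rewrite /d; have [x0|/ltW x0] := leP 0 x.
    have := up 0 x (ltrN10 _) x0 x2; rewrite z; lra.
  have := up x 0 x1 x0 (ltr01); rewrite z; lra.
have uE x : -1 < x < 1 -> u x = u 0 + d * x.
  move=> xI; have := @is_derive_zero_cst (fun t => u t - (0 + d * t)) _ x xI.
  rewrite mulr0 addr0 subr0 add0r => H; apply/eqP; rewrite -subr_eq; apply/eqP.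
  apply: H.
  move=> t tI; rewrite -(subrr d); apply: is_deriveB; first exact: udE.
  exact: is_derive_affine.
have /affine_sqint[u0 d00] := eq_real_sqint uE su.
by move=> x /uE; rewrite u0 d00 /u; lra.
Qed.

(** By uniqueness an arbitrary square integrable solution is the constructed one and inherits its
    bound. *)
Lemma real_solution_bound f h (M : R) : real_sqint h -> real_sqint f ->
  real_solution f h -> 0 < M -> wnorm2 h <= M ^+ 2 ->
  forall x, -1 < x < 1 -> f x ^+ 2 <= 16 * M ^+ 2 * (1 - x ^+ 2).
Proof.
move=> sh sf fh M0 hM x xI; have [g [gh gM]] := real_solution_exists sh M0 hM.
have [sg _] := bounded_real_sqint (solution_measurable gh) gM.
by rewrite (real_solution_unique sh sf sg fh gh xI) gM.
Qed.

Lemma eq_real_solution f g h k : (forall x, -1 < x < 1 -> f x = g x) ->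
  (forall x, -1 < x < 1 -> h x = k x) ->
  real_solution f h -> real_solution g k.
Proof.
move=> fg hk [fd fh].
have nfg x : -1 < x < 1 -> {near x, f =1 g}.
  move=> /andP[x1 x2]; near=> y; apply: fg; apply/andP; split; near: y.
    exact: lt_nbhsr.
  exact: lt_nbhsl.
split=> [x xI|x y x1 xy y1]; first by apply: near_eq_derivable (nfg x xI) (fd x xI).
have E t : -1 < t < 1 -> g^`()%classic t = f^`()%classic t.
  by move=> tI; rewrite !derive1E; apply/esym; exact: near_eq_derive (nfg t tI).
rewrite !E ?x1 ?(le_lt_trans xy) ?(lt_le_trans x1)// fh//.
apply: eq_Rintegral => t; rewrite inE => /(sub_itv11 x1 y1)/itv11P tI.
by rewrite /source hk.
Unshelve. all: by end_near. Qed.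

End singular_ode.

(** * The graph of the Jacobi operator through the integrated equation *)

Section jacobi_graph.
Context {R : realType}.
Local Notation C := R[i].
Local Notation mu := (@lebesgue_measure R).
Local Notation weight := (@weight R).
Local Notation itv11 := (@itv11 R).
Local Notation Re := (@complex.Re R).
Local Notation Im := (@complex.Im R).
Implicit Types (a b x y : R) (f g : R -> C) (F G H : L2 R).

Lemma square_integrable_ReIm f : square_integrable f <->
  real_sqint (fun x => Re (f x)) /\ real_sqint (fun x => Im (f x)).
Proof.
split.
  move=> /[dup] sf /square_integrableP[mr mi fi].
  split; split=> //; apply: (dominated_integrable (c := 1) sf square_integrable0).
  - by apply: measurable_funM; [exact: measurable_funX|exact: measurable_weight].
  - move=> x /weight_gt0 w0; rewrite ger0_norm; last by rewrite mulr_ge0 ?sqr_ge0// ltW.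
    rewrite ler_pM2r// mul1r !Defs.sqr_normc.
    by have := sqr_ge0 (Im (f x)); have := sqr_ge0 (Re ((0 : R -> C) x)); have := sqr_ge0 (Im ((0 : R -> C) x)); lra.
  - by apply: measurable_funM; [exact: measurable_funX|exact: measurable_weight].
  - move=> x /weight_gt0 w0; rewrite ger0_norm; last by rewrite mulr_ge0 ?sqr_ge0// ltW.
    rewrite ler_pM2r// mul1r !Defs.sqr_normc.
    by have := sqr_ge0 (Re (f x)); have := sqr_ge0 (Re ((0 : R -> C) x)); have := sqr_ge0 (Im ((0 : R -> C) x)); lra.
move=> [[mr ri] [mi ii]]; apply/square_integrableP; split=> //.
have := integrable_EFinD (@measurable_itv11R R) ri ii; apply: eq_integrable => //.
  exact: measurable_itv11R.
by move=> x _ /=; rewrite Defs.sqr_normc mulrDl.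
Qed.

Lemma L2_real_sqint F :
  real_sqint (fun x => Re (F x)) /\ real_sqint (fun x => Im (F x)).
Proof. exact/square_integrable_ReIm/L2_square_integrable. Qed.

(** The interval is a countable union of intervals []-1 + d n, 1 - d n[], and countably many null
    sets have a null union. *)
Lemma ae_itv11 (P : R -> Prop) :
  (forall a b, -1 < a -> a < b -> b < 1 -> {ae mu, forall x, a < x < b -> P x}) ->
  {ae mu, forall x, itv11 x -> P x}.
Proof.
move=> H; pose d n : R := n.+2%:R^-1.
have d0 n : 0 < d n by rewrite invr_gt0.
have d1 n : d n < 1 by rewrite invf_lt1// ltr1n.
have : {ae mu, forall x n, -1 + d n < x < 1 - d n -> P x}.
  apply: ae_foralln => n; have : d n <= 2^-1 by rewrite lef_pV2 ?posrE// ler_nat.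
  by have := d0 n => ? ?; apply: H; lra.
apply: filterS => x H' /itv11P /andP[x1 x2].
have e0 : 0 < Num.min (1 + x) (1 - x) by rewrite lt_min; apply/andP; split; lra.
pose n := truncn (Num.min (1 + x) (1 - x))^-1; apply: (H' n).
have : d n < Num.min (1 + x) (1 - x).
  rewrite /d invf_plt ?posrE//; apply: lt_trans (truncnS_gt _) _.
  by rewrite ltr_nat.
by rewrite lt_min => /andP[? ?]; lra.
Qed.

(** The derivative is bounded on the compact interval, so [f] is Lipschitz there. *)
Lemma C1_AC_on a b (f : R -> R) : -1 < a -> a <= b -> b < 1 ->
  (forall x, -1 < x < 1 -> derivable f x 1) ->
  (forall x, -1 < x < 1 -> {for x, continuous f^`()%classic}) -> AC_on a b f.
Proof.
move=> a1 ab b1 fd fc.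
have I t : a <= t <= b -> -1 < t < 1.
  by move=> /andP[xt ty]; rewrite (lt_le_trans a1)// (le_lt_trans ty).
have [|c cab cmax] := @EVT_max _ (fun t => `|f^`()%classic t|) a b ab.
  apply: continuous_in_subspaceT => x; rewrite inE/= in_itv/= => /I xI.
  apply: continuous_comp; first exact: fc.
  exact: norm_continuous.
apply: (@Lipschitz_AC_on _ _ _ _ `|f^`()%classic c|) => x y ax xy yb.
have [||t txy ->] := @MVT_segment _ f f^`()%classic x y xy.
- move=> t; rewrite in_itv/= => /andP[xt ty].
  rewrite derive1E; apply/derivableP; apply/fd/I.
  by rewrite (le_trans ax (ltW xt)) (le_trans (ltW ty)).
- apply: continuous_in_subspaceT => t; rewrite inE/= in_itv/= => /andP[xt ty].
  apply: differentiable_continuous; apply/derivable1_diffP/fd/I.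
  by rewrite (le_trans ax xt) (le_trans ty).
rewrite normrM (@ger0_norm _ (y - x)) ?subr_ge0// ler_wpM2r ?subr_ge0//.
apply: cmax; move: txy; rewrite !in_itv/= => /andP[xt ty].
by rewrite (le_trans ax xt) (le_trans ty).
Qed.

(** For a pair [(F, G)] in the graph of [A], this is the right-hand side [h] of [(A - k) F = h]. *)
Definition graph_source (k : R) F G := fun x => G x - k%:C%C * F x.

Lemma graph_source_sqint k F G :
  real_sqint (fun x => Re (graph_source k F G x)) /\
  real_sqint (fun x => Im (graph_source k F G x)).
Proof.
have [Fr Fi] := L2_real_sqint F; have [Gr Gi] := L2_real_sqint G.
rewrite /graph_source; split; [move: (real_sqint_lin (- k) Fr Gr)|move: (real_sqint_lin (- k) Fi Gi)];
  apply: eq_real_sqint => x _; case: (F x) => p q; case: (G x) => r s /=; ring.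
Qed.

Definition complex_solution f h :=
  real_solution (fun x => Re (f x)) (fun x => Re (h x)) /\
  real_solution (fun x => Im (f x)) (fun x => Im (h x)).

Lemma AC_solution (f h : R -> R) : real_sqint h ->
  (forall x, itv11 x -> derivable f x 1) ->
  (forall a b, -1 < a -> a <= b -> b < 1 -> AC_on a b f^`()%classic) ->
  {ae mu, forall x, itv11 x -> f^`()%classic^`()%classic x = source h x} ->
  real_solution f h.
Proof.
move=> sh fd fac fh; split=> [x xI|x y x1 xy y1]; first exact/fd/itv11P.
have : x <= y by []; rewrite le_eqVlt => /orP[/eqP->|xy'].
  by rewrite subrr set_itv1 Rintegral_set1.
have [||_] := @AC_on_FTC _ x y f^`()%classic (source h) xy' (fac _ _ x1 xy y1).
- apply: measurable_funS (measurable_source sh.1) => //.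
    exact: measurable_itv11.
  exact: sub_itv11.
- apply: filterS fh => t + /andP[xt ty]; apply; apply/itv11P.
  by rewrite (lt_trans x1) ?(lt_trans ty).
by apply; rewrite ?lexx.
Qed.

Lemma solution_AC (f h : R -> R) : real_sqint h -> real_solution f h ->
  [/\ forall a b, -1 < a -> a <= b -> b < 1 -> AC_on a b f,
     forall x, itv11 x -> derivable f x 1,
     forall a b, -1 < a -> a <= b -> b < 1 -> AC_on a b f^`()%classic &
     {ae mu, forall x, itv11 x -> f^`()%classic^`()%classic x = source h x}].
Proof.
move=> sh [fd fh]; have sint := source_integrable sh.
split.
- move=> a b a1 ab b1; apply: (C1_AC_on a1 ab b1 fd).
  exact: primitive11_continuous sint fh.
- by move=> x /itv11P/fd.
- move=> a b a1 _ b1; apply: primitive_AC_on (sint _ _ a1 b1) _.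
  exact: primitive11_on.
- apply: ae_itv11 => a b a1 ab b1.
  have := ae_derive_primitive (sint _ _ a1 b1) (primitive11_on a1 b1 fh).
  by apply: filterS => x H /H[_ <-]; rewrite derive1E.
Qed.

Lemma jacobi_exprE (k : R) f x : jacobi_expr k f x =
  ((- (1 - x ^+ 2) * (fun y => Re (f y))^`()%classic^`()%classic x + k * Re (f x)) +i*
   (- (1 - x ^+ 2) * (fun y => Im (f y))^`()%classic^`()%classic x + k * Im (f x)))%C.
Proof.
have E (u v p q c : R) : (- c%:C * (u +i* v) + k%:C * (p +i* q) =
    (- c * u + k * p) +i* (- c * v + k * q))%C.
  by apply/eqP; rewrite eq_complex /=; apply/andP; split; apply/eqP; ring.
by rewrite /jacobi_expr [cderive _ _]/cderive; case: (f x) => p q; exact: E.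
Qed.

Lemma sourceE (h : R -> R) x : itv11 x -> - (1 - x ^+ 2) * source h x = h x.
Proof.
move=> /itv11P xI; rewrite /source /Defs.weight; field.
by rewrite gt_eqF//; nra.
Qed.

(** Only the representative [f] is differentiated. The class [F] may stand for it in the right-hand
    side, which matters only almost everywhere, and [F] and [G] themselves witness the square
    integrability of [f] and of its image. *)
Lemma jacobi_operatorP (k : R) F G : jacobi_operator k (F, G) <->
  exists2 f, eq_ae F f & complex_solution f (graph_source k F G).
Proof.
have [sr si] := graph_source_sqint k F G; split.
  move=> [f [fac fd f'ac _ _] [/= Ff Gf]]; exists f => //.
  have src x : itv11 x -> F x = f x -> G x = jacobi_expr k f x ->
     (fun y => Re (f y))^`()%classic^`()%classic x = source (fun x => Re (graph_source k F G x)) x /\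
     (fun y => Im (f y))^`()%classic^`()%classic x = source (fun x => Im (graph_source k F G x)) x.
    move=> /itv11P xI Fx; rewrite jacobi_exprE /source /graph_source Fx => ->.
    have x0 : 1 - x ^+ 2 != 0 by rewrite gt_eqF//; nra.
    by rewrite /Defs.weight; case: (f x) => p q /=; split; field.
  split; apply: AC_solution => //.
  - by move=> x /fd[].
  - by move=> a b a1 ab b1; have /abs_continuous_onP[] := f'ac a b a1 ab b1.
  - by apply: filterS2 Ff Gf => x Fx Gx xI; have [] := src x xI (Fx xI) (Gx xI).
  - by move=> x /fd[].
  - by move=> a b a1 ab b1; have /abs_continuous_onP[] := f'ac a b a1 ab b1.
  - by apply: filterS2 Ff Gf => x Fx Gx xI; have [] := src x xI (Fx xI) (Gx xI).
move=> [f Ff [fr fi]].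
have [rac rd r'ac raE] := solution_AC sr fr.
have [iac id i'ac iaE] := solution_AC si fi.
have Gf : eq_ae G (jacobi_expr k f).
  move: Ff raE iaE; rewrite /eq_ae; apply: filterS3 => x Fx rx ix xI.
  rewrite jacobi_exprE (rx xI) (ix xI) !sourceE// /graph_source -(Fx xI).
  by case: (F x) => p q; case: (G x) => r s /=; apply/eqP; rewrite eq_complex /=;
    apply/andP; split; apply/eqP; ring.
exists f => //; split.
- by move=> a b a1 ab b1; apply/abs_continuous_onP; split; [exact: rac|exact: iac].
- by move=> x xI; split; [exact: rd|exact: id].
- by move=> a b a1 ab b1; apply/abs_continuous_onP; split; [exact: r'ac|exact: i'ac].
- by exists F.
- by exists G.
Qed.

End jacobi_graph.

(** * Operators whose inverse has a total orthogonal family of eigenvectors *)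

Section hilbert.
Context {R : realType} {H : lmodType R[i]}.
Variable dot : {dot H for conjC}.
Implicit Types (u v f g h : H) (a : nat -> R[i]).

(** A real number, unlike the complex-valued [hnorm], so that estimates take place in the ordered
    field [R]. *)
Definition sqnorm u : R := complex.Re (dot u u).

Lemma dot_sqnorm u : dot u u = (sqnorm u)%:C%C.
Proof.
have := dnorm_ge0 dot u; rewrite lecE /= /sqnorm => /andP[/eqP].
by case: (dot u u) => x y /= ->.
Qed.

Lemma sqnorm_ge0 u : 0 <= sqnorm u.
Proof. by have := dnorm_ge0 dot u; rewrite dot_sqnorm lecR. Qed.

Lemma sqnorm_eq0 u : sqnorm u = 0 -> u = 0.
Proof. by move=> u0; apply/eqP; rewrite -(dnorm_eq0 dot) dot_sqnorm u0. Qed.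

Lemma hnormE u : hnorm dot u = (Num.sqrt (sqnorm u))%:C%C.
Proof.
rewrite /hnorm dot_sqnorm -[in LHS](sqr_sqrtr (sqnorm_ge0 u)).
by rewrite rmorphXn/= sqrCK// lecR sqrtr_ge0.
Qed.

Lemma dotC u v : dot u v = (dot v u)^*%C.
Proof. by rewrite (hermC dot) expr0 mul1r. Qed.

Lemma dotZl (l : R[i]) u v : dot (l *: u) v = l * dot u v.
Proof. exact: linearZl_LR. Qed.

Lemma dotZr (l : R[i]) u v : dot u (l *: v) = l^*%C * dot u v.
Proof. exact: linearZr_LR. Qed.

Lemma dotBl u v w : dot (u - v) w = dot u w - dot v w.
Proof. exact: linearBl. Qed.

Lemma dotBr u v w : dot u (v - w) = dot u v - dot u w.
Proof. exact: linearBr. Qed.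

Lemma dotDl u v w : dot (u + v) w = dot u w + dot v w.
Proof. exact: linearDl. Qed.

Lemma sqnormZ (l : R[i]) u : sqnorm (l *: u) = normc l ^+ 2 * sqnorm u.
Proof.
rewrite {1}/sqnorm dotZl dotZr mulrA dot_sqnorm Defs.sqr_normc.
by case: l => x y /=; ring.
Qed.

Lemma sqnorm0 : sqnorm 0 = 0.
Proof. by rewrite /sqnorm linear0l. Qed.

Lemma sqnormN u : sqnorm (- u) = sqnorm u.
Proof. by rewrite /sqnorm hnormN. Qed.

(** Half of the parallelogram identity; it serves as a triangle inequality for squared norms. *)
Lemma sqnormD_le u v : sqnorm (u + v) <= 2 * sqnorm u + 2 * sqnorm v.
Proof.
have := sqnorm_ge0 (u - v); rewrite /sqnorm dnormB dnormD.
by case: (dot u v) => x y; case: (dot u u) => ? ?; case: (dot v v) => ? ? /=; lra.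
Qed.

Lemma sqnormB_le u v : sqnorm (u - v) <= 2 * sqnorm u + 2 * sqnorm v.
Proof. by rewrite -(sqnormN v); exact: sqnormD_le. Qed.

Lemma sqnormDd u v : dot u v = 0 -> sqnorm (u + v) = sqnorm u + sqnorm v.
Proof.
move=> uv; rewrite {1}/sqnorm; have -> : dot (u + v) (u + v) = dot u u + dot v v.
  exact: hnormDd uv.
by rewrite !dot_sqnorm.
Qed.

(** The component of [u] orthogonal to [v] has nonnegative squared norm. *)
Lemma dot_cauchy_schwarz u v : normc (dot u v) ^+ 2 <= sqnorm u * sqnorm v.
Proof.
have [/sqnorm_eq0 ->|v0] := eqVneq (sqnorm v) 0.
  by rewrite linear0r sqnorm0 mulr0 Defs.sqr_normc /= !expr0n /= addr0.
have vp : 0 < sqnorm v by rewrite lt_neqAle eq_sym v0 sqnorm_ge0.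
have := sqnorm_ge0 (u - ((sqnorm v)^-1%:C%C * dot u v) *: v).
rewrite {1}/sqnorm dnormB dotZr linearZl_LR/= dotZr.
rewrite !dot_sqnorm Defs.sqr_normc; move: v0 vp; case: (dot u v) => x y.
move: (sqnorm u) (sqnorm v) => A B B0 Bp /=.
set E := (X in 0 <= X); have -> : E = A - (x ^+ 2 + y ^+ 2) / B by rewrite /E; field.
by rewrite subr_ge0 ler_pdivrMr.
Qed.

Definition lincomb (e : nat -> H) a n := \sum_(i < n) a i *: e i.

Section compact_inverse.
Variables (S : H -> H) (e : nat -> H) (lam : nat -> R) (K : R).
Hypothesis S_lin : forall (l : R[i]) u v, S (l *: u + v) = l *: S u + S v.
Hypothesis S_bounded : forall u, sqnorm (S u) <= K * sqnorm u.
(* A substitute for the completeness of [H]. *)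
Hypothesis S_complete : forall (g : nat -> H),
  (forall r : R, 0 < r -> exists n, forall i j, (n <= i)%N -> (n <= j)%N ->
    sqnorm (g i - g j) < r) ->
  exists f, forall r : R, 0 < r -> exists n, forall i, (n <= i)%N ->
    sqnorm (f - S (g i)) < r.
Hypothesis lam_ge : forall n, n.+1%:R <= lam n.
Hypothesis e_neq0 : forall n, e n != 0.
Hypothesis S_e : forall n, S ((lam n)%:C%C *: e n) = e n.
Hypothesis e_orth : forall m n, m != n -> dot (e m) (e n) = 0.
Hypothesis e_dense : forall h (r : R), 0 < r -> exists a n,
  sqnorm (h - lincomb e a n) < r.

Lemma S0 : S 0 = 0.
Proof. by have := S_lin (-1) 0 0; rewrite scaler0 addr0 scaleN1r addNr. Qed.

Lemma SZ l u : S (l *: u) = l *: S u.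
Proof. by have := S_lin l u 0; rewrite S0 !addr0. Qed.

Lemma SD u v : S (u + v) = S u + S v.
Proof. by have := S_lin 1 u v; rewrite !scale1r. Qed.

Lemma SN u : S (- u) = - S u.
Proof. by rewrite -scaleN1r SZ scaleN1r. Qed.

Lemma SB u v : S (u - v) = S u - S v.
Proof. by rewrite SD SN. Qed.

Lemma lam_gt0 n : 0 < lam n.
Proof. by apply: lt_le_trans (lam_ge n); rewrite ltr0n. Qed.

Lemma S_eE n : S (e n) = (lam n)^-1%:C%C *: e n.
Proof. by rewrite -[in RHS](S_e n) SZ scalerA -rmorphM mulVf ?gt_eqF ?lam_gt0// scale1r. Qed.

Lemma K_ge0 : 0 <= K.
Proof.
have e0 : 0 < sqnorm (e 0%N).
  rewrite lt_neqAle sqnorm_ge0 andbT eq_sym; apply/eqP => /sqnorm_eq0 e00.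
  by have := e_neq0 0; rewrite e00 eqxx.
by have := le_trans (sqnorm_ge0 _) (S_bounded (e 0%N)); rewrite pmulr_lge0.
Qed.

(* The bound makes [phi] continuous, and the [e n] are total. *)
Lemma functional_eq0 (phi : H -> R[i]) (c : R) :
  (forall l u v, phi (l *: u + v) = l * phi u + phi v) ->
  (forall u, normc (phi u) ^+ 2 <= c * sqnorm u) ->
  (forall n, phi (e n) = 0) -> forall u, phi u = 0.
Proof.
move=> phil phic phie u.
have phi0 : phi 0 = 0.
  by have := phil 1 0 0; rewrite scale1r addr0 mul1r -{1}[phi 0]addr0 => /addrI.
have phis a n : phi (lincomb e a n) = 0.
  rewrite /lincomb; elim: n => [|n IH]; first by rewrite big_ord0.
  by rewrite big_ord_recr /= addrC phil phie mulr0 add0r IH.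
have : normc (phi u) ^+ 2 <= 0.
  apply/ler_addgt0Pr => r r0; rewrite add0r.
  have c1 : 0 < `|c| + 1 by rewrite ltr_wpDl.
  have [a [n an]] := e_dense u (divr_gt0 r0 c1).
  have -> : phi u = phi (u - lincomb e a n).
    by rewrite -scaleN1r addrC phil phis mulr0 add0r.
  apply: le_trans (phic _) _; apply: (@le_trans _ _ ((`|c| + 1) * sqnorm (u - lincomb e a n))).
    by rewrite ler_wpM2r ?sqnorm_ge0// (le_trans (ler_norm c))// lerDl.
  by rewrite mulrC -ler_pdivlMr// ltW.
rewrite le_eqVlt ltNge sqr_ge0 orbF sqrf_eq0 => /eqP /eq0_normc.
by [].
Qed.

Lemma dot_e_eq0 u : (forall n, dot u (e n) = 0) -> u = 0.
Proof.
move=> ue; apply: sqnorm_eq0; rewrite /sqnorm.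
rewrite (functional_eq0 (phi := fun v => dot v u) (c := sqnorm u)) //.
- by move=> l v w; rewrite linearPl.
- by move=> v; rewrite mulrC; exact: dot_cauchy_schwarz.
- by move=> n; rewrite dotC ue conjc0.
Qed.

(** Both sides are bounded linear functionals of [u], and orthogonality makes them agree on every
    [e m]. *)
Lemma S_dot_e u n : dot (S u) (e n) = (lam n)^-1%:C%C * dot u (e n).
Proof.
apply/eqP; rewrite -subr_eq0; apply/eqP.
rewrite (functional_eq0 (phi := fun v => dot (S v) (e n) - (lam n)^-1%:C%C * dot v (e n))
  (c := (2 * (K + normc (lam n)^-1%:C%C ^+ 2)) * sqnorm (e n))) //.
- move=> l v w; rewrite S_lin !linearPl /=; ring.
- move=> v; have -> : dot (S v) (e n) - (lam n)^-1%:C%C * dot v (e n) =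
      dot (S v - (lam n)^-1%:C%C *: v) (e n).
    by rewrite dotBl dotZl.
  apply: le_trans (dot_cauchy_schwarz _ _) _; rewrite mulrAC ler_wpM2r ?sqnorm_ge0//.
  apply: le_trans (sqnormB_le _ _) _; rewrite sqnormZ.
  by move: (normc _ ^+ 2) => m; have := S_bounded v; lra.
- move=> m; rewrite S_eE dotZl; have [->|mn] := eqVneq m n; first by rewrite subrr.
  by rewrite e_orth// !mulr0 subrr.
Qed.

(** The difference is a bounded linear functional of [u], and on [e n] it vanishes because [lam n]
    is real. The constant [4 K] comes from [|a - b|^2 <= 2 |a|^2 + 2 |b|^2] with both terms bounded
    by Cauchy-Schwarz. *)
Lemma S_sym u v : dot (S u) v = dot u (S v).
Proof.
apply/eqP; rewrite -subr_eq0; apply/eqP.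
rewrite (functional_eq0 (phi := fun w => dot (S w) v - dot w (S v))
  (c := 4 * K * sqnorm v)) //.
- move=> l w z; rewrite S_lin !linearPl /=; ring.
- move=> w; have H1 := dot_cauchy_schwarz (S w) v.
  have H2 := dot_cauchy_schwarz w (S v).
  have S1 := ler_wpM2r (sqnorm_ge0 v) (S_bounded w).
  have S2 := ler_wpM2l (sqnorm_ge0 w) (S_bounded v).
  move: H1 H2 S1 S2; rewrite !Defs.sqr_normc.
  case: (dot (S w) v) => x y; case: (dot w (S v)) => x' y' /=.
  by have := sqr_ge0 (x + x'); have := sqr_ge0 (y + y'); nra.
- move=> n; rewrite S_eE dotZl [dot (e n) (S v)]dotC S_dot_e (dotC v).
  by apply/eqP; rewrite eq_complex; case: (dot (e n) v) => x y /=; apply/andP; split; apply/eqP; ring.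
Qed.

(** All coefficients of [u] against the [e n] vanish. This is what makes the inverse of [S]
    single-valued. *)
Lemma S_inj u : S u = 0 -> u = 0.
Proof.
move=> Su; apply: dot_e_eq0 => n; have := S_dot_e u n; rewrite Su linear0l.
move/esym/eqP; rewrite mulf_eq0 => /orP[|/eqP//].
by rewrite eq_complex /= eqxx andbT invr_eq0 gt_eqF ?lam_gt0.
Qed.

(** * Self-adjointness and spectrum of [S^-1 + k] *)

Section spectrum_of_inverse.
Variable k : R.

(** The graph of [S^-1 + k], written without inverting [S]. *)
Definition inverse_graph : set (H * H) :=
  [set fg | fg.1 = S (fg.2 - k%:C%C *: fg.1)].
Local Notation T := inverse_graph.

Lemma inverse_graph_linear : linear_operator T.
Proof.
split.
- by rewrite /T /= scaler0 subr0 S0.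
- move=> l [f1 g1] [f2 g2]; rewrite /T /= => {1}-> {1}->; rewrite -S_lin.
  congr S; rewrite !scalerDr !scalerN !scalerA opprD addrACA; congr (_ + _ + _).
  by rewrite mulrC.
- move=> f g h; rewrite /T /= => {1}-> /eqP.
  rewrite -subr_eq0 -SB opprB subrKA => /eqP/S_inj/eqP.
  by rewrite subr_eq0 => /eqP.
Qed.

Lemma inverse_graph_e n : T (e n, (lam n + k)%:C%C *: e n).
Proof.
by rewrite /T /= -scalerBl -rmorphB addrK S_e.
Qed.

Lemma inverse_graph_unbounded : unbounded_operator dot T.
Proof.
split; first exact: inverse_graph_linear.
move=> [M M0 TM].
have ME : M = (complex.Re M)%:C%C.
  by move: M0; rewrite lecE /= => /andP[/eqP]; case: (M) => x y /= ->.
(* This index satisfies [lam n >= n + 1 > M - k], so the eigenvalue [lam n + k] exceeds [M]. *)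
pose n := truncn (complex.Re M - k).
have := TM _ _ (inverse_graph_e n); rewrite !hnormE ME -rmorphM lecR sqnormZ.
have e0 : 0 < sqnorm (e n).
  rewrite lt_neqAle sqnorm_ge0 andbT eq_sym; apply/eqP => /sqnorm_eq0 e00.
  by have := e_neq0 n; rewrite e00 eqxx.
have Mn : complex.Re M < lam n + k.
  have := truncnS_gt (complex.Re M - k); have := lam_ge n; rewrite -/n; lra.
have M0' : 0 <= complex.Re M by move: M0; rewrite lecE => /andP[].
rewrite Defs.sqr_normc /= expr0n/= addr0 sqrtrM ?sqr_ge0// sqrtr_sqr.
rewrite ler_pM2r ?sqrtr_gt0//; apply/negP; rewrite -ltNge.
by rewrite (lt_le_trans Mn)// ler_norm.
Qed.

Lemma inverse_graph_S h : T (S h, h + k%:C%C *: S h).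
Proof. by rewrite /T /= addrK. Qed.

Lemma inverse_graph_dense : densely_defined dot T.
Proof.
move=> h eps eps0.
have [epsE r0] : eps = (complex.Re eps)%:C%C /\ 0 < complex.Re eps.
  by move: eps0; rewrite ltcE /= => /andP[/eqP]; case: (eps) => x y /= ->.
have [a [n an]] := e_dense h (exprn_gt0 2 r0).
exists (lincomb e a n); last first.
  rewrite hnormE epsE ltcR -(ger0_norm (ltW r0)) -sqrtr_sqr.
  by rewrite ltr_sqrt// exprn_gt0.
(* Finite combinations of eigenvectors lie in the domain. *)
rewrite /lincomb; elim: n {an} => [|n [g IH]].
  by rewrite big_ord0; exists 0; have [] := inverse_graph_linear.
rewrite big_ord_recr /= addrC; have [_ lin _] := inverse_graph_linear.
by exists (a n *: ((lam n + k)%:C%C *: e n) + g); exact: (lin _ _ _ (inverse_graph_e n) IH).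
Qed.

(** For [(U, V)] in the adjoint, [u = S (V - k U)] is what [U] should be. Testing the adjoint
    relation on [f = S (U - u)] and using the symmetry of [S] gives [(U - u, u) = (U - u, U)], hence
    [U = u]. *)
Lemma inverse_graph_adjoint : adjoint dot T = T.
Proof.
apply/seteqP; split=> -[U V]; rewrite /adjoint /=.
  move=> UV; apply/eqP; rewrite -subr_eq0; apply/eqP.
  set u := S (V - _); apply: sqnorm_eq0; rewrite /sqnorm.
  have E : dot (S (U - u)) V - k%:C%C * dot (S (U - u)) U = dot (U - u) U.
    by rewrite -(UV _ _ (inverse_graph_S (U - u))) dotDl dotZl addrK.
  have uU : dot (U - u) u = dot (U - u) U.
    by rewrite [in X in dot _ X]/u -S_sym dotBr dotZr conjc_real E.
  by rewrite /= dotBr uU subrr.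
rewrite {1}/inverse_graph /= => UV f Tf; rewrite /inverse_graph /= => fE.
have -> : Tf = (Tf - k%:C%C *: f) + k%:C%C *: f by rewrite subrK.
rewrite dotDl dotZl [in X in X + _]UV -S_sym -fE dotBr dotZr conjc_real.
by rewrite subrK.
Qed.

Lemma inverse_graph_self_adjoint : self_adjoint dot T.
Proof.
split; [exact: inverse_graph_linear|exact: inverse_graph_dense|].
exact: inverse_graph_adjoint.
Qed.

(** Writes [(T - l) f = h] as a fixed-point equation in the everywhere defined [S] alone. *)
Lemma resolvent_inverse_graph (l : R[i]) h f :
  resolvent T l (h, f) <-> f = S (h + (l - k%:C%C) *: f).
Proof.
split.
  move=> [g fE hE]; rewrite (hE : h = g - l *: f) {1}(fE : f = S (g - k%:C%C *: f)) scalerBl; congr S.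
  by rewrite addrA subrK.
move=> fE; exists (h + l *: f); last by rewrite /= addrK.
by rewrite /T /= {1}fE scalerBl addrA.
Qed.

Lemma sqnorm_lincomb a n :
  sqnorm (lincomb e a n) = \sum_(i < n) normc (a i) ^+ 2 * sqnorm (e i).
Proof.
rewrite /lincomb; elim: n => [|n IH]; first by rewrite !big_ord0 sqnorm0.
rewrite !big_ord_recr /= -IH -sqnormZ; set u := \sum_(_ < _) _.
have uen : dot u (a n *: e n) = 0.
  apply: (big_ind (fun w => dot w (a n *: e n) = 0)) => [|v w v0 w0|i _].
  - exact: linear0l.
  - by rewrite dotDl v0 w0 addr0.
  - by rewrite dotZl dotZr e_orth ?mulr0// ltn_eqF.
by rewrite sqnormDd.
Qed.

(** As [lam n >= n + 1], all but finitely many [lam n] are at distance at least 1 from [m], and the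
    remaining distances have a positive minimum. *)
Lemma eigenvalue_gap (m : R[i]) : (forall n, m != (lam n)%:C%C) ->
  exists2 d : R, 0 < d & forall n, d <= normc ((lam n)%:C%C - m) ^+ 2.
Proof.
move=> mlam.
have [N HN] : exists N, forall n, (N <= n)%N -> 1 <= normc ((lam n)%:C%C - m) ^+ 2.
  exists (truncn (`|complex.Re m| + 1)) => n Nn.
  have : `|complex.Re m| + 1 <= lam n.
    apply/ltW/(lt_le_trans (truncnS_gt _))/(le_trans _ (lam_ge n)).
    by rewrite ler_nat.
  rewrite Defs.sqr_normc; have := ler_norm (complex.Re m).
  case: (m) => x y /= xx xl; have := sqr_ge0 (0 - y); nra.
suff [d d0 Hd] : exists2 d : R, 0 < d &
    forall n, (n < N)%N -> d <= normc ((lam n)%:C%C - m) ^+ 2.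
  exists (Num.min d 1) => [|n]; first by rewrite lt_min d0 ltr01.
  have [nN|Nn] := ltnP n N; first by rewrite ge_min Hd.
  by rewrite ge_min HN// orbT.
elim: N {HN} => [|N [d d0 Hd]]; first by exists 1.
have dN : 0 < normc ((lam N)%:C%C - m) ^+ 2.
  rewrite exprn_even_gt0//=; apply/eqP => /eq0_normc/eqP.
  by rewrite subr_eq0 eq_sym; exact/negP.
exists (Num.min d (normc ((lam N)%:C%C - m) ^+ 2)); first by rewrite lt_min d0.
move=> n; rewrite ltnS leq_eqVlt => /predU1P[->|/Hd nd].
  by rewrite ge_min lexx orbT.
by rewrite ge_min nd.
Qed.

(** Replaces a passage to the limit in an inequality with two error terms. *)
Lemma le_small_error (x y A B : R) : 0 <= A -> 0 <= B ->
  (forall r : R, 0 < r -> exists s t, [/\ s < r, t < r & x <= y + A * s + B * t]) ->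
  x <= y.
Proof.
move=> A0 B0 H1; apply/ler_addgt0Pr => r r0.
have AB : 0 < A + B + 1 by lra.
have [s [t [sr tr xy]]] := H1 _ (divr_gt0 r0 AB).
have rE : r = r / (A + B + 1) * (A + B + 1) by rewrite divfK// gt_eqF.
have q0 : 0 < r / (A + B + 1) by rewrite divr_gt0.
rewrite rE; nra.
Qed.

Lemma lincomb_widen a n M : (n <= M)%N ->
  lincomb e a n = lincomb e (fun i => if (i < n)%N then a i else 0) M.
Proof.
move=> nM; rewrite /lincomb (big_ord_widen _ (fun i => a i *: e i) nM).
by rewrite big_mkcond; apply: eq_bigr => i _; case: ifP => //; rewrite scale0r.
Qed.

Lemma lincombB a b n :
  lincomb e a n - lincomb e b n = lincomb e (fun i => a i - b i) n.
Proof.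
by rewrite /lincomb -sumrB; apply: eq_bigr => i _; rewrite scalerBl.
Qed.

(* On finite combinations the solution is diagonal, with coefficients
   [b a i]; the general case follows by density and [S_complete]. *)
Lemma resolvent_exists (m : R[i]) : (forall n, m != (lam n)%:C%C) ->
  exists2 c : R, 0 <= c & forall h, exists2 f, f = S (h + m *: f) &
    sqnorm f <= c * sqnorm h.
Proof.
move=> mlam; have [d d0 Hd] := eigenvalue_gap mlam.
have lm0 n : (lam n)%:C%C - m != 0 by rewrite subr_eq0 eq_sym mlam.
pose b a i := a i / ((lam i)%:C%C - m).
have dV : 0 < d^-1 by rewrite invr_gt0.
have ble a n : sqnorm (lincomb e (b a) n) <= d^-1 * sqnorm (lincomb e a n).
  rewrite !sqnorm_lincomb big_distrr/=; apply: ler_sum => i _.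
  rewrite mulrA ler_wpM2r ?sqnorm_ge0// mulrC ler_pdivlMr//.
  have -> : normc (a i) ^+ 2 = normc (b a i) ^+ 2 * normc ((lam i)%:C%C - m) ^+ 2.
    by rewrite -exprMn -normcM /b divfK.
  by rewrite ler_wpM2l ?sqr_ge0.
have bS a n : lincomb e (b a) n = S (lincomb e a n + m *: lincomb e (b a) n).
  elim: n => [|n IH]; first by rewrite /lincomb !big_ord0 scaler0 addr0 S0.
  rewrite /lincomb !big_ord_recr /= -!/(lincomb _ _ _) scalerDr addrACA SD -IH.
  congr (_ + _); rewrite scalerA -scalerDl.
  have -> : a n + m * b a n = b a n * (lam n)%:C%C.
    by rewrite /b -{1}[a n](divfK (lm0 n)); ring.
  by rewrite -scalerA SZ S_e.
(* The diagonal solution costs [1 / d], and each of the two approximations, of [f] and of [h], costs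
   a factor 2. *)
exists (4 * d^-1); first by rewrite mulr_ge0// ltW.
move=> h.
have /choice[c Hc] : forall j : nat, exists p : (nat -> R[i]) * nat,
    sqnorm (h - lincomb e p.1 p.2) < j.+1%:R^-1.
  move=> j; have j0 : 0 < (j.+1%:R^-1 : R) by rewrite invr_gt0.
  by have [a [n an]] := e_dense h j0; exists (a, n).
pose hh j := lincomb e (c j).1 (c j).2.
pose ff j := lincomb e (b (c j).1) (c j).2.
have fS j : ff j = S (hh j + m *: ff j) by exact: bS.
have fle j : sqnorm (ff j) <= d^-1 * sqnorm (hh j) by exact: ble.
have fBle i j : sqnorm (ff i - ff j) <= d^-1 * sqnorm (hh i - hh j).
  pose M := maxn (c i).2 (c j).2.
  pose t (p : (nat -> R[i]) * nat) l := if (l < p.2)%N then p.1 l else 0.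
  have bt p l : b (t p) l = if (l < p.2)%N then b p.1 l else 0.
    by rewrite /b /t; case: ifP => //; rewrite mul0r.
  have -> : hh i - hh j = lincomb e (fun k => t (c i) k - t (c j) k) M.
    rewrite /hh (@lincomb_widen _ (c i).2 M) ?leq_maxl//.
    by rewrite (@lincomb_widen _ (c j).2 M) ?leq_maxr// lincombB.
  have -> : ff i - ff j = lincomb e (b (fun k => t (c i) k - t (c j) k)) M.
    rewrite /ff (@lincomb_widen _ (c i).2 M) ?leq_maxl//.
    rewrite (@lincomb_widen _ (c j).2 M) ?leq_maxr// lincombB.
    rewrite /lincomb; apply: eq_bigr => k' _; congr (_ *: _).
    by rewrite -!bt /b mulrBl.
  exact: ble.
have hsmall (r : R) : 0 < r -> exists n, forall i, (n <= i)%N -> sqnorm (h - hh i) < r.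
  move=> r0; exists (truncn r^-1) => i ni; apply: lt_trans (Hc i) _.
  rewrite invf_plt ?posrE//; apply: lt_le_trans (truncnS_gt _) _.
  by rewrite ler_nat.
(* The vectors [hh j + m ff j] form a Cauchy sequence because differences of the [ff j] are
   controlled by those of the [hh j]. Their images under [S] are the [ff j], which therefore
   converge. *)
have [|f Hf] := S_complete (g := fun j => hh j + m *: ff j).
  move=> r r0; pose D := 2 + 2 * (normc m ^+ 2 * d^-1).
  have m0 : 0 <= normc m ^+ 2 * d^-1 by rewrite mulr_ge0 ?sqr_ge0// ltW.
  have D0 : 0 < D by rewrite /D; lra.
  have [n Hn] := hsmall (r / (4 * D)) (divr_gt0 r0 (mulr_gt0 (ltr0n _ 4) D0)).
  exists n => i j ni nj.
  have -> : hh i + m *: ff i - (hh j + m *: ff j) = (hh i - hh j) + m *: (ff i - ff j).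
    by rewrite opprD addrACA scalerBr.
  apply: le_lt_trans (sqnormD_le _ _) _; rewrite sqnormZ.
  have H1 := ler_wpM2l (sqr_ge0 (normc m)) (fBle i j).
  have H2 : sqnorm (hh i - hh j) <= 2 * sqnorm (h - hh j) + 2 * sqnorm (h - hh i).
    have -> : hh i - hh j = (h - hh j) - (h - hh i) by rewrite opprB [RHS]addrC subrKA.
    exact: sqnormB_le.
  have H3 := Hn _ ni; have H4 := Hn _ nj.
  have H5 : sqnorm (hh i - hh j) < r / D.
    apply: le_lt_trans H2 _.
    have -> : r / D = 4 * (r / (4 * D)) by field; rewrite gt_eqF.
    lra.
  apply: (@le_lt_trans _ _ (D * sqnorm (hh i - hh j))).
    by rewrite /D; lra.
  by rewrite mulrC -ltr_pdivlMr.
have close (r : R) : 0 < r -> exists i, sqnorm (f - ff i) < r /\ sqnorm (h - hh i) < r.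
  move=> r0; have [n1 Hn1] := Hf _ r0; have [n2 Hn2] := hsmall _ r0.
  exists (maxn n1 n2); rewrite [in X in X /\ _]fS; split.
    by apply: Hn1; exact: leq_maxl.
  by apply: Hn2; exact: leq_maxr.
exists f.
  apply/eqP; rewrite -subr_eq0; apply/eqP/sqnorm_eq0/eqP; rewrite eq_le sqnorm_ge0 andbT.
  apply: (@le_small_error _ _ (2 + 4 * K * normc m ^+ 2) (4 * K)).
  - by have := K_ge0; have := sqr_ge0 (normc m); nra.
  - by have := K_ge0; lra.
  move=> r /close[i [fi hi]]; exists (sqnorm (f - ff i)), (sqnorm (h - hh i)).
  split=> //; rewrite add0r.
  (* Subtracting the equation of [ff i] expresses the defect of [f] through two small errors and the
     bounded [S]. *)
  have -> : f - S (h + m *: f) = (f - ff i) - S ((h - hh i) + m *: (f - ff i)).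
    have -> : (h - hh i) + m *: (f - ff i) = (h + m *: f) - (hh i + m *: ff i).
      by rewrite opprD addrACA scalerBr.
    by rewrite SB -fS opprB addrA subrK.
  apply: le_trans (sqnormB_le _ _) _.
  have H1 := S_bounded ((h - hh i) + m *: (f - ff i)).
  have H2 := ler_wpM2l K_ge0 (sqnormD_le (h - hh i) (m *: (f - ff i))).
  by move: H2; rewrite sqnormZ; nra.
apply: (@le_small_error _ _ 2 (4 * d^-1)) => //; first by rewrite mulr_ge0// ltW.
move=> r /close[i [fi hi]]; exists (sqnorm (f - ff i)), (sqnorm (h - hh i)).
split=> //.
have H1 : sqnorm f <= 2 * sqnorm (f - ff i) + 2 * sqnorm (ff i).
  by rewrite -{1}[f](subrK (ff i)); exact: sqnormD_le.
have H2 : sqnorm (hh i) <= 2 * sqnorm h + 2 * sqnorm (h - hh i).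
  have {1}-> : hh i = h - (h - hh i) by rewrite opprB addrC subrK.
  exact: sqnormB_le.
have H3 := fle i; have H4 := ler_wpM2l (ltW dV) H2; lra.
Qed.

Lemma inverse_graph_spectrum :
  spectrum dot T = [set l | exists n, l = (lam n + k)%:C%C].
Proof.
apply/seteqP; split=> l; rewrite /spectrum /=.
  apply: contra_notP => ln; have ml n : l - k%:C%C != (lam n)%:C%C.
    apply/eqP => E; apply: ln; exists n.
    have -> : ((lam n + k)%:C = (lam n)%:C + k%:C)%C by rewrite rmorphD.
    by rewrite -E subrK.
  have [c c0 Hc] := resolvent_exists ml.
  (* Each coefficient of [f - f'] against [e n] is multiplied by [(l - k) / lam n], which differs
     from 1, and so vanishes. *)
  have uniq h f f' : f = S (h + (l - k%:C%C) *: f) -> f' = S (h + (l - k%:C%C) *: f') ->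
      f = f'.
    move=> fE f'E; apply/eqP; rewrite -subr_eq0; apply/eqP.
    have dE : f - f' = (l - k%:C%C) *: S (f - f').
      by rewrite {1}fE {1}f'E -SB -SZ opprD addrACA subrr add0r scalerBr.
    apply: dot_e_eq0 => n; apply/eqP; have := ml n; apply: contra_neqT => dn0.
    have : dot (f - f') (e n) = (l - k%:C%C) * ((lam n)^-1%:C%C * dot (f - f') (e n)).
      by rewrite -S_dot_e -dotZl -dE.
    rewrite mulrA -[LHS]mul1r => /(mulIf dn0) H1.
    have : (lam n)%:C%C = (l - k%:C%C) * ((lam n)^-1%:C%C * (lam n)%:C%C).
      by rewrite mulrA -H1 mul1r.
    by rewrite -rmorphM mulVf ?gt_eqF ?lam_gt0// mulr1 => ->.
  split.
    move=> h; have [f fE _] := Hc h; exists f; split.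
      exact/resolvent_inverse_graph.
    by move=> f' /resolvent_inverse_graph; exact: uniq.
  exists (Num.sqrt c)%:C%C; first by rewrite lecR sqrtr_ge0.
  move=> h f /resolvent_inverse_graph fE; have [f' f'E f'c] := Hc h.
  rewrite !hnormE -rmorphM lecR -sqrtrM// ler_wsqrtr//.
  by rewrite (uniq _ _ _ fE f'E).
(* At an eigenvalue both 0 and [e n] solve the resolvent equation for [h = 0], against
   uniqueness. *)
move=> [n ->]; rewrite /resolvent_set /= => -[/(_ 0)[f [_ fu]] _].
have f0 : f = 0.
  by apply: fu; apply/resolvent_inverse_graph; rewrite scaler0 addr0 S0.
have : f = e n.
  apply: fu; apply/resolvent_inverse_graph.
  by rewrite add0r -rmorphB addrK S_e.
by rewrite f0 => /esym/eqP; apply/negP; exact: e_neq0.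
Qed.

End spectrum_of_inverse.
End compact_inverse.
End hilbert.

(** * The inverse of the Jacobi operator *)

Section solution_operator.
Context {R : realType}.
Local Notation C := R[i].
Local Notation mu := (@lebesgue_measure R).
Local Notation weight := (@weight R).
Local Notation itv11 := (@itv11 R).
Local Notation Re := (@complex.Re R).
Local Notation Im := (@complex.Im R).
Implicit Types (f g h : R -> C) (F G H : L2 R).

Lemma wnorm2_ge0 (h : R -> R) : 0 <= wnorm2 h.
Proof.
apply: Rintegral_ge0 => x /weight_gt0 w0.
by rewrite mulr_ge0 ?sqr_ge0// ltW.
Qed.

(** The pointwise factor 16 is integrated over length 2. The term [e / 32] keeps the bound [M]
    positive when [h] has norm zero. *)
Lemma real_solution_wnorm2 (f h : R -> R) : real_sqint h -> real_sqint f ->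
  real_solution f h -> wnorm2 f <= 32 * wnorm2 h.
Proof.
move=> sh sf fh; apply/ler_addgt0Pr => e e0.
have q0 : 0 < wnorm2 h + e / 32 by rewrite ltr_wpDl ?wnorm2_ge0// divr_gt0.
have M2 : Num.sqrt (wnorm2 h + e / 32) ^+ 2 = wnorm2 h + e / 32.
  by rewrite sqr_sqrtr// ltW.
have := @real_solution_bound _ f h (Num.sqrt (wnorm2 h + e / 32)) sh sf fh.
rewrite M2 sqrtr_gt0 => /(_ q0) H1.
have he : wnorm2 h <= wnorm2 h + e / 32 by lra.
have [] := bounded_real_sqint (solution_measurable fh) (H1 he).
by move=> _; lra.
Qed.

Lemma ae_real_solution (f h k : R -> R) : real_sqint h -> real_sqint k ->
  {ae mu, forall x, itv11 x -> h x = k x} -> real_solution f h -> real_solution f k.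
Proof.
move=> sh sk hk [fd fh]; split=> // x y x1 xy y1; rewrite fh//.
have sub := sub_itv11 x1 y1.
rewrite /Rintegral; congr fine; apply: ae_eq_integral => //.
- by case/integrableP: (source_integrable sh x1 y1).
- by case/integrableP: (source_integrable sk x1 y1).
- by apply: filterS hk => t hk /sub /hk; rewrite /source /= => ->.
Qed.

Definition L2_solution F H := exists2 f, eq_ae F f & complex_solution f H.

Lemma L2_of_fun f : square_integrable f -> exists F : L2 R, eq_ae F f.
Proof.
move=> /asboolP sf; exists (\pi_(L2 R)%qT (SqintFun sf)).
exact: L2_fun_pi.
Qed.

Lemma sqnorm_L2E F f : square_integrable f -> eq_ae F f ->
  sqnorm (L2_inner R) F = wnorm2 (fun x => Re (f x)) + wnorm2 (fun x => Im (f x)).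
Proof.
move=> sf Ff; have sF := L2_square_integrable F.
have [fr fi] := (square_integrable_ReIm f).1 sf.
have -> : sqnorm (L2_inner R) F = Re (wdot f f).
  rewrite -[LHS]/(Re (wdot F F)) (eq_ae_wdotl sF sf sF Ff) wdotC//.
  by rewrite (eq_ae_wdotl sF sf sf Ff) -wdotC.
rewrite wdotE /=.
rewrite /wnorm2 -RintegralD//; [|exact: measurable_itv11R|exact: fr.2|exact: fi.2].
by apply: eq_Rintegral => x _; rewrite /wre; ring.
Qed.

(** Borel measurability does not pass along equality almost everywhere, so it is a hypothesis on
    [f]. *)
Lemma ae_real_sqint F f : eq_ae F f -> measurable_fun itv11 (fun x => Re (f x)) ->
  measurable_fun itv11 (fun x => Im (f x)) ->
  real_sqint (fun x => Re (f x)) /\ real_sqint (fun x => Im (f x)).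
Proof.
have aux (u v : R -> R) : real_sqint u -> measurable_fun itv11 v ->
    {ae mu, forall x, itv11 x -> u x = v x} -> real_sqint v.
  move=> [mu' ui] mv uv; split=> //.
  have mvw : measurable_fun itv11 (EFin \o (fun x => v x ^+ 2 * weight x)).
    apply/measurable_EFinP; apply: measurable_funM; last exact: measurable_weight.
    exact: measurable_funX.
  move/integrableP : (ui) => [muw uioo].
  apply/integrableP; split=> //.
  rewrite (@ae_eq_integral _ _ _ mu _ (abse \o (EFin \o (fun x => u x ^+ 2 * weight x)))
    (abse \o (EFin \o (fun x => v x ^+ 2 * weight x))))//.
  - exact: measurable_itv11R.
  - exact: measurableT_comp.
  - exact: measurableT_comp.
  - by apply: filterS uv => x uvx /uvx /= ->.
move=> Ff mr mi; have [Fr Fi] := L2_real_sqint F.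
split; [apply: aux Fr mr _|apply: aux Fi mi _];
  by apply: filterS Ff => x Fx /Fx ->.
Qed.

Lemma L2_solution_unique F G H : L2_solution F H -> L2_solution G H -> F = G.
Proof.
move=> [f Ff [fr fi]] [g Gg [gr gi]]; apply/L2P.
have [Hr Hi] := L2_real_sqint H.
have [Fr Fi] := ae_real_sqint Ff (solution_measurable fr) (solution_measurable fi).
have [Gr Gi] := ae_real_sqint Gg (solution_measurable gr) (solution_measurable gi).
have fg : {ae mu, forall x, itv11 x -> f x = g x}.
  apply/aeW => x /itv11P xI; apply/eqP; rewrite eq_complex.
  rewrite (real_solution_unique Hr Fr Gr fr gr xI) eqxx.
  by rewrite (real_solution_unique Hi Fi Gi fi gi xI) eqxx.
exact: eq_ae_trans Ff (eq_ae_trans fg (eq_ae_sym Gg)).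
Qed.

Lemma L2_solution_exists H : exists F, L2_solution F H.
Proof.
have [Hr Hi] := L2_real_sqint H.
have sol (h : R -> R) : real_sqint h -> exists f : R -> R, real_sqint f /\ real_solution f h.
  move=> sh; have h0 := wnorm2_ge0 h.
  have M0 : 0 < wnorm2 h + 1 by lra.
  have hM : wnorm2 h <= (wnorm2 h + 1) ^+ 2 by nra.
  have [f [fh fM]] := real_solution_exists sh M0 hM.
  exists f; split=> //; exact: (bounded_real_sqint (solution_measurable fh) fM).1.
have [f [sf fH]] := sol _ Hr; have [g [sg gH]] := sol _ Hi.
have [F FE] : exists F : L2 R, eq_ae F (fun x => (f x +i* g x)%C).
  by apply: L2_of_fun; apply/square_integrable_ReIm.
by exists F; exists (fun x => (f x +i* g x)%C).
Qed.

(** The operator [S] of the overview. Uniqueness of the solution makes the choice harmless. *)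
Definition solution_op H : L2 R := sval (cid (L2_solution_exists H)).

Lemma solution_opP H : L2_solution (solution_op H) H.
Proof. by rewrite /solution_op; case: cid. Qed.

Lemma solution_opE F H : L2_solution F H <-> F = solution_op H.
Proof.
split=> [FH|->]; last exact: solution_opP.
exact: L2_solution_unique FH (solution_opP H).
Qed.

Lemma L2_solution_sqint F H f : eq_ae F f -> complex_solution f H ->
  real_sqint (fun x => Re (f x)) /\ real_sqint (fun x => Im (f x)).
Proof.
move=> Ff [fr fi].
exact: ae_real_sqint Ff (solution_measurable fr) (solution_measurable fi).
Qed.

Lemma solution_op_bounded H :
  sqnorm (L2_inner R) (solution_op H) <= 32 * sqnorm (L2_inner R) H.
Proof.
have [f Ff [fr fi]] := solution_opP H.
have [sr si] := L2_solution_sqint Ff (conj fr fi).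
have [Hr Hi] := L2_real_sqint H.
rewrite (sqnorm_L2E _ Ff); last exact/square_integrable_ReIm.
rewrite (@sqnorm_L2E H H (L2_square_integrable H)); last exact: aeW.
rewrite mulrDr lerD//; exact: real_solution_wnorm2.
Qed.

Lemma complex_scaleE (l z w : C) :
  (Re (l * z + w) = Re l * Re z + (- Im l * Im z + Re w)) *
  (Im (l * z + w) = Re l * Im z + (Im l * Re z + Im w)).
Proof. by case: l => p q; case: z => a b; case: w => c d /=; split; ring. Qed.

(** By uniqueness it suffices that the combination of the solutions solves the combined equation.
    Multiplication by [l] mixes real and imaginary parts, hence the nested real combinations. *)
Lemma solution_op_lin (l : C) H G :
  solution_op (l *: H + G) = l *: solution_op H + solution_op G.
Proof.
apply/esym/solution_opE.
have [f Ff [fr fi]] := solution_opP H; have [g Gg [gr gi]] := solution_opP G.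
have [Hr Hi] := L2_real_sqint H; have [Gr Gi] := L2_real_sqint G.
have [lr li] := L2_real_sqint (l *: H + G).
exists (fun x => l * f x + g x).
  apply: eq_ae_trans (L2_funP _ _ _) _; move: Ff Gg; rewrite /eq_ae.
  by apply: filterS2 => x Fx Gx xI; rewrite !fctE Fx// Gx.
split.
- apply: (@ae_real_solution _ (fun x => Re l * Re (H x) + (- Im l * Im (H x) + Re (G x)))) => //.
  + by do 2 apply: real_sqint_lin => //.
  + have := L2_funP l H G; apply: filterS => x + xI => /(_ xI) ->.
    by rewrite !fctE [l *: _]/(l * _) complex_scaleE.
  + apply: (@eq_real_solution _ (fun x => Re l * Re (f x) + (- Im l * Im (f x) + Re (g x)))
      _ (fun x => Re l * Re (H x) + (- Im l * Im (H x) + Re (G x)))) => //.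
      by move=> x _; rewrite complex_scaleE.
    apply: real_solution_lin => //; last exact: real_solution_lin.
    exact: real_sqint_lin.
- apply: (@ae_real_solution _ (fun x => Re l * Im (H x) + (Im l * Re (H x) + Im (G x)))) => //.
  + by do 2 apply: real_sqint_lin => //.
  + have := L2_funP l H G; apply: filterS => x + xI => /(_ xI) ->.
    by rewrite !fctE [l *: _]/(l * _) complex_scaleE.
  + apply: (@eq_real_solution _ (fun x => Re l * Im (f x) + (Im l * Re (f x) + Im (g x)))
      _ (fun x => Re l * Im (H x) + (Im l * Re (H x) + Im (G x)))) => //.
      by move=> x _; rewrite complex_scaleE.
    apply: real_solution_lin => //; last exact: real_solution_lin.
    exact: real_sqint_lin.
Qed.

Lemma graph_source_ae (k : R) F G :
  eq_ae (G - k%:C%C *: F : L2 R) (graph_source k F G).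
Proof.
rewrite addrC -scaleNr; apply: eq_ae_trans (L2_funP _ _ _) _; apply/aeW => x _.
rewrite /graph_source !fctE addrC; congr (_ + _); exact: mulNr.
Qed.

(** The class [G - k F] and the function [graph_source k F G] differ on a null set only, which
    leaves the integrated equation unchanged. *)
Lemma jacobi_operator_graph (k : R) :
  jacobi_operator k = inverse_graph solution_op k.
Proof.
apply/seteqP; split=> -[F G]; have [sr si] := graph_source_sqint k F G;
  have [lr li] := L2_real_sqint (G - k%:C%C *: F); have E := graph_source_ae k F G.
  move=> /jacobi_operatorP[f Ff [fr fi]]; apply/solution_opE; exists f => //; split.
    by apply: ae_real_solution sr lr _ fr; apply: filterS E => x + xI => /(_ xI) ->.
  by apply: ae_real_solution si li _ fi; apply: filterS E => x + xI => /(_ xI) ->.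
move=> /solution_opE[f Ff [fr fi]]; apply/jacobi_operatorP; exists f => //; split.
  by apply: ae_real_solution lr sr _ fr; apply: filterS E => x + xI => /(_ xI) ->.
by apply: ae_real_solution li si _ fi; apply: filterS E => x + xI => /(_ xI) ->.
Qed.

(** The hypothesis makes the sequence Cauchy at each point. The pointwise limit is measurable, and
    the weighted bound survives letting [j] tend to infinity. *)
Lemma uniform_limit (r : nat -> R -> R) :
  (forall j, measurable_fun itv11 (r j)) ->
  (forall e : R, 0 < e -> exists n, forall i j, (n <= i)%N -> (n <= j)%N ->
    forall x, -1 < x < 1 -> (r i x - r j x) ^+ 2 <= e * (1 - x ^+ 2)) ->
  exists r' : R -> R, measurable_fun itv11 r' /\
    forall e : R, 0 < e -> exists n, forall i, (n <= i)%N ->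
      forall x, -1 < x < 1 -> (r' x - r i x) ^+ 2 <= e * (1 - x ^+ 2).
Proof.
move=> mr rC; pose r' x := lim (r ^~ x @ \oo).
have rcvg x : -1 < x < 1 -> r ^~ x @ \oo --> r' x.
  move=> xI; apply/cauchy_cvgP/cauchyP => e e0.
  have e2 : 0 < e / 2 by rewrite divr_gt0.
  have [n Hn] := rC _ (exprn_gt0 2 e2).
  exists (r n x); exists n => // i /= ni.
  have H1 := Hn _ _ (leqnn n) ni x xI.
  have x2 := sqr_ge0 x; have e3 := sqr_ge0 (e / 2).
  have : `|r n x - r i x| ^+ 2 <= (e / 2) ^+ 2.
    by rewrite real_normK ?num_real//; nra.
  rewrite ler_sqr ?nnegrE ?(ltW e2)// => /le_lt_trans; apply.
  by rewrite ltr_pdivrMr// ltr_pMr// ltr1n.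
exists r'; split.
  apply: (measurable_fun_cvg mr) => x /itv11P xI; exact: rcvg.
move=> e e0; have [n Hn] := rC _ e0; exists n => i ni x xI.
have c : (r j x - r i x) ^+ 2 @[j --> \oo] --> (r' x - r i x) ^+ 2.
  rewrite !expr2; apply: cvgM; apply: cvgB; [exact: rcvg|exact: cvg_cst|exact: rcvg|exact: cvg_cst].
apply: (cvgr_to_le c); exists n => // j /= nj; exact: Hn.
Qed.

Lemma L2_sub_ae F G : eq_ae (F - G : L2 R) (fun x => F x - G x).
Proof.
rewrite addrC -scaleN1r; apply: eq_ae_trans (L2_funP _ _ _) _; apply/aeW => x _.
by rewrite !fctE addrC; congr (_ + _); exact: mulN1r.
Qed.

Lemma solution_op_complete (G : nat -> L2 R) :
  (forall r : R, 0 < r -> exists n, forall i j, (n <= i)%N -> (n <= j)%N ->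
    sqnorm (L2_inner R) (G i - G j) < r) ->
  exists F, forall r : R, 0 < r -> exists n, forall i, (n <= i)%N ->
    sqnorm (L2_inner R) (F - solution_op (G i)) < r.
Proof.
move=> GC.
have /choice[f Hf] : forall j, exists f, eq_ae (solution_op (G j)) f /\
    complex_solution f (G j).
  by move=> j; have [f Ff fs] := solution_opP (G j); exists f.
have fsq j : real_sqint (fun x => Re (f j x)) /\ real_sqint (fun x => Im (f j x)).
  by have [Ff fs] := Hf j; exact: L2_solution_sqint Ff fs.
have bound (e : R) : 0 < e -> exists n, forall i j, (n <= i)%N -> (n <= j)%N ->
    forall x, -1 < x < 1 -> (Re (f i x) - Re (f j x)) ^+ 2 <= e * (1 - x ^+ 2) /\
      (Im (f i x) - Im (f j x)) ^+ 2 <= e * (1 - x ^+ 2).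
  (* This compensates the factor 16 in the pointwise bound for solutions. *)
  move=> e0; have e16 : 0 < e / 16 by rewrite divr_gt0.
  have [n Hn] := GC _ e16; exists n => i j ni nj x xI.
  have := Hn _ _ ni nj; set d := sqnorm _ _ => de.
  have [_ [fir fii]] := Hf i; have [_ [fjr fji]] := Hf j.
  have [sir sii] := fsq i; have [sjr sji] := fsq j.
  have [Gir Gii] := L2_real_sqint (G i); have [Gjr Gji] := L2_real_sqint (G j).
  have dE : d = wnorm2 (fun x => -1 * Re (G j x) + Re (G i x)) +
                wnorm2 (fun x => -1 * Im (G j x) + Im (G i x)).
    rewrite /d (sqnorm_L2E _ (L2_sub_ae _ _)); last first.
      apply/square_integrable_ReIm; split.
        apply: eq_real_sqint (real_sqint_lin (-1) Gjr Gir) => y _.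
        by case: (G i y) => a b; case: (G j y) => a' b' /=; ring.
      apply: eq_real_sqint (real_sqint_lin (-1) Gji Gii) => y _.
      by case: (G i y) => a b; case: (G j y) => a' b' /=; ring.
    by congr (wnorm2 _ + wnorm2 _); apply/funext => y;
      case: (G i y) => a b; case: (G j y) => a' b' /=; ring.
  have M0 : 0 < Num.sqrt (e / 16) by rewrite sqrtr_gt0.
  have M2 : Num.sqrt (e / 16) ^+ 2 = e / 16 by rewrite sqr_sqrtr// ltW.
  have eE : e = 16 * Num.sqrt (e / 16) ^+ 2 by rewrite M2; field.
  have w1 := wnorm2_ge0 (fun x => -1 * Re (G j x) + Re (G i x)).
  have w2 := wnorm2_ge0 (fun x => -1 * Im (G j x) + Im (G i x)).
  rewrite eE; split.
    have -> : Re (f i x) - Re (f j x) = -1 * Re (f j x) + Re (f i x) by ring.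
    apply: (real_solution_bound (real_sqint_lin (-1) Gjr Gir)
      (real_sqint_lin (-1) sjr sir) (real_solution_lin (-1) Gjr Gir fjr fir)) => //.
    by rewrite M2; lra.
  have -> : Im (f i x) - Im (f j x) = -1 * Im (f j x) + Im (f i x) by ring.
  apply: (real_solution_bound (real_sqint_lin (-1) Gji Gii)
    (real_sqint_lin (-1) sji sii) (real_solution_lin (-1) Gji Gii fji fii)) => //.
  by rewrite M2; lra.
have [||p [mp Hp]] := @uniform_limit (fun j x => Re (f j x)).
- by move=> j; have [[]] := fsq j.
- move=> e e0; have [n Hn] := bound _ e0; exists n => i j ni nj x xI.
  by have [] := Hn i j ni nj x xI.
have [||q [mq Hq]] := @uniform_limit (fun j x => Im (f j x)).
- by move=> j; have [_ []] := fsq j.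
- move=> e e0; have [n Hn] := bound _ e0; exists n => i j ni nj x xI.
  by have [] := Hn i j ni nj x xI.
have diff (u v : R -> R) (e : R) : measurable_fun itv11 u -> real_sqint v ->
    (forall x, -1 < x < 1 -> (u x - v x) ^+ 2 <= e * (1 - x ^+ 2)) ->
    real_sqint (fun x => u x - v x) /\ wnorm2 (fun x => u x - v x) <= 2 * e.
  move=> um [vm _] uv; apply: (bounded_real_sqint _ uv); exact: measurable_funB.
(* One approximation suffices: [u] is the sum of [u - v n], which the weighted bound makes square
   integrable, and [v n]. *)
have lim_sqint (u : R -> R) (v : nat -> R -> R) : measurable_fun itv11 u ->
    (forall j, real_sqint (v j)) ->
    (forall e : R, 0 < e -> exists n, forall i, (n <= i)%N ->
      forall x, -1 < x < 1 -> (u x - v i x) ^+ 2 <= e * (1 - x ^+ 2)) -> real_sqint u.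
  move=> um vs H; have [n Hn] := H 1 ltr01.
  have [uv _] := diff _ _ _ um (vs n) (Hn n (leqnn n)).
  by apply: eq_real_sqint (real_sqint_lin 1 uv (vs n)) => x _; ring.
have sp : real_sqint p.
  by apply: lim_sqint mp _ Hp => j; have [] := fsq j.
have sq : real_sqint q.
  by apply: lim_sqint mq _ Hq => j; have [] := fsq j.
have [F FE] : exists F : L2 R, eq_ae F (fun x => (p x +i* q x)%C).
  by apply: L2_of_fun; apply/square_integrable_ReIm.
(* The real and imaginary parts contribute at most [2 (r / 8)] each. *)
exists F => r r0; have r8 : 0 < r / 8 by rewrite divr_gt0.
have [n1 Hn1] := Hp _ r8; have [n2 Hn2] := Hq _ r8.
exists (maxn n1 n2) => i ni.
have [sir sii] := fsq i; have [Ff _] := Hf i.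
have [d1 w1] := diff _ _ _ mp sir (Hn1 i (leq_trans (leq_maxl _ _) ni)).
have [d2 w2] := diff _ _ _ mq sii (Hn2 i (leq_trans (leq_maxr _ _) ni)).
have E : eq_ae (F - solution_op (G i) : L2 R)
    (fun x => ((p x - Re (f i x)) +i* (q x - Im (f i x)))%C).
  apply: eq_ae_trans (L2_sub_ae _ _) _; move: FE Ff; rewrite /eq_ae.
  apply: filterS2 => x H1 H2 xI; rewrite H1// H2//.
  by case: (f i x).
rewrite (sqnorm_L2E _ E); last exact/square_integrable_ReIm.
by rewrite /=; lra.
Qed.

End solution_operator.

(** * Density of polynomials *)

Section weierstrass.
Context {R : realType}.
Implicit Types (f : R -> R) (phi : nat -> R) (p : {poly R}).

(** Heine-Cantor through the covering form of compactness of [[0, 1]]; the point [y] may leave that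
    interval. *)
Lemma heine f : continuous f -> forall e : R, 0 < e -> exists2 d : R, 0 < d &
  forall x y, 0 <= x <= 1 -> `|y - x| < d -> `|f y - f x| < e.
Proof.
move=> fc e e0; have := @segment_compact R 0 1.
move=> /compact_near_coveringP /(_ R (nbhs 0^'+)
  (fun d x => forall y, `|y - x| < d -> `|f y - f x| < e) _) [].
- move=> x _; have e2 : 0 < e / 2 by rewrite divr_gt0.
  have /cvgrPdist_lt/(_ _ e2)[d /= d0 Hd] := fc x.
  have d2 : 0 < d / 2 by rewrite divr_gt0.
  exists (ball x (d / 2), [set r | r < d / 2]); first split => /=.
  + exact: nbhsx_ballx.
  + exact: nbhs_right_lt.
  move=> [x' r] /= [xx' rd] y yx'.
  have H1 : `|f x - f x'| < e / 2 by apply: Hd; rewrite /= (lt_trans xx')// ltr_pdivrMr// ltr_pMr// ltr1n.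
  have H2 : `|f x - f y| < e / 2.
    apply: Hd; rewrite /= [d]splitr.
    have -> : x - y = (x - x') + (x' - y) by ring.
    rewrite (le_lt_trans (ler_normD _ _))// ltrD//.
    by rewrite distrC (lt_trans yx').
  rewrite [e]splitr; have -> : f y - f x' = (f x - f x') - (f x - f y) by ring.
  by rewrite (le_lt_trans (ler_normB _ _))// ltrD.
move=> r /= r0 Hr; exists (r / 2); first by rewrite divr_gt0.
move=> x y x01 xy; apply: (Hr (r / 2)) => //=.
- by rewrite sub0r normrN gtr0_norm ?divr_gt0// ltr_pdivrMr// ltr_pMr// ltr1n.
- by rewrite divr_gt0.
Qed.

(* The Bernstein operator [sum_k phi k * C(n, k) X^k (1 - X)^(n - k)], by
   conditioning on the first of [n] coin tosses. *)
Fixpoint bernstein n phi : {poly R} :=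
  if n is m.+1 then 'X * bernstein m (fun k => phi k.+1) + (1 - 'X) * bernstein m phi
  else (phi 0)%:P.

Lemma bernsteinS n phi x : (bernstein n.+1 phi).[x] =
  x * (bernstein n (fun k => phi k.+1)).[x] + (1 - x) * (bernstein n phi).[x].
Proof. by rewrite /= !hornerE. Qed.

Lemma bernstein_le n phi psi x : 0 <= x <= 1 ->
  (forall k, (k <= n)%N -> phi k <= psi k) ->
  (bernstein n phi).[x] <= (bernstein n psi).[x].
Proof.
move=> /andP[x0 x1]; elim: n phi psi => [|n IH] phi psi le.
  by rewrite /= !hornerC le.
rewrite !bernsteinS lerD// ler_wpM2l ?subr_ge0//; apply: IH => k kn; apply: le => //.
exact: leqW.
Qed.

(** The expectation of [a + b (K - c)^2] for a binomial [K] of mean [n x] and variance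
    [n x (1 - x)]. *)
Lemma bernstein_quadratic n (a b c x : R) :
  (bernstein n (fun k => a + b * (k%:R - c) ^+ 2)).[x] =
  a + b * ((n%:R * x - c) ^+ 2 + n%:R * x * (1 - x)).
Proof.
elim: n c => [|n IH] c; first by rewrite /= hornerC; ring.
have -> : bernstein n.+1 (fun k => a + b * (k%:R - c) ^+ 2) =
    'X * bernstein n (fun k => a + b * (k%:R - (c - 1)) ^+ 2) +
    (1 - 'X) * bernstein n (fun k => a + b * (k%:R - c) ^+ 2).
  by rewrite /=; congr ('X * bernstein n _ + _); apply/funext => k; rewrite -natr1; ring.
by rewrite !hornerE !IH -natr1; ring.
Qed.

(** Chebyshev's argument: the values [f (k / n)] lie within [e / 2 + A (k / n - x)^2] of [f x], by
    uniform continuity for [k / n] near [x] and by boundedness otherwise. Positivity of the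
    Bernstein operator and the variance formula then bound the error. *)
Lemma bernstein_approx f (e : R) : continuous f -> 0 < e ->
  exists p, forall x, 0 <= x <= 1 -> `|f x - p.[x]| <= e.
Proof.
move=> fc e0; have e2 : 0 < e / 2 by rewrite divr_gt0.
have [d d0 Hd] := heine fc e2.
have [M M0 fM] : exists2 M : R, 0 < M & forall x, 0 <= x <= 1 -> `|f x| <= M.
  have [|c _ Hc] := @EVT_max R (fun x => `|f x|) 0 1 ler01.
    apply: continuous_subspaceT => x; apply: continuous_comp; first exact: fc.
    exact: norm_continuous.
  exists (`|f c| + 1) => [|x x01]; first by rewrite ltr_wpDl.
  by rewrite (le_trans (Hc x _)) ?in_itv// lerDl.
(* Chosen so that [A (k / n - x)^2 >= 2 M] as soon as [k / n] is at distance at least [d] from [x];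
   then [n] is taken with [A / n <= e / 2]. *)
pose A := 2 * M / d ^+ 2; have A0 : 0 < A by rewrite divr_gt0 ?mulr_gt0 ?exprn_gt0.
pose n := (truncn (A / (e / 2))).+1.
have n0 : 0 < (n%:R : R) by rewrite ltr0n.
exists (bernstein n (fun k => f (k%:R / n%:R))) => x x01; have /andP[x0 x1] := x01.
have fx k : (k <= n)%N -> `|f (k%:R / n%:R) - f x| <= e / 2 + A * (k%:R / n%:R - x) ^+ 2.
  move=> kn; have kn01 : 0 <= (k%:R / n%:R : R) <= 1.
    by rewrite divr_ge0//= ler_pdivrMr// mul1r ler_nat.
  have [/(Hd x _ x01)/ltW/le_trans|dk] := ltP `|k%:R / n%:R - x| d.
    by apply; rewrite lerDl mulr_ge0 ?sqr_ge0// ltW.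
  apply: le_trans (ler_normB _ _) _; have H1 := fM _ kn01; have H2 := fM _ x01.
  have : d ^+ 2 <= (k%:R / n%:R - x) ^+ 2.
    by rewrite -[leRHS]real_normK ?num_real// ler_sqr ?nnegrE// ltW.
  rewrite -(ler_pM2l A0) => H3; have : A * d ^+ 2 = 2 * M.
    by rewrite /A divfK// expf_neq0// gt_eqF.
  lra.
have q (s : R) k : f x + s * (e / 2 + A * (k%:R / n%:R - x) ^+ 2) =
    (f x + s * (e / 2)) + (s * A / n%:R ^+ 2) * (k%:R - n%:R * x) ^+ 2.
  by field; rewrite gt_eqF.
have b (s : R) : (bernstein n (fun k => f x + s * (e / 2 + A * (k%:R / n%:R - x) ^+ 2))).[x] =
    f x + s * (e / 2 + A / n%:R * (x * (1 - x))).
  have -> : (fun k => f x + s * (e / 2 + A * (k%:R / n%:R - x) ^+ 2)) =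
    (fun k => (f x + s * (e / 2)) + (s * A / n%:R ^+ 2) * (k%:R - n%:R * x) ^+ 2).
    by apply/funext => k; exact: q.
  by rewrite bernstein_quadratic; field; rewrite gt_eqF.
have small : e / 2 + A / n%:R * (x * (1 - x)) <= e.
  have An : A / n%:R <= e / 2.
    rewrite ler_pdivrMr// mulrC -ler_pdivrMr//.
    exact/ltW/truncnS_gt.
  have : x * (1 - x) <= 1 by nra.
  have : 0 <= x * (1 - x) by nra.
  have : 0 < A / n%:R by rewrite divr_gt0.
  nra.
rewrite distrC ler_norml; apply/andP; split.
  have : (bernstein n (fun k => f x + -1 * (e / 2 + A * (k%:R / n%:R - x) ^+ 2))).[x] <=
      (bernstein n (fun k => f (k%:R / n%:R))).[x].
    by apply: bernstein_le => // k /fx; rewrite ler_norml => /andP[]; lra.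
  rewrite b; lra.
have : (bernstein n (fun k => f (k%:R / n%:R))).[x] <=
    (bernstein n (fun k => f x + 1 * (e / 2 + A * (k%:R / n%:R - x) ^+ 2))).[x].
  by apply: bernstein_le => // k /fx; rewrite ler_norml => /andP[]; lra.
rewrite b; lra.
Qed.

Lemma weierstrass11 f (e : R) : continuous f -> 0 < e ->
  exists p, forall x, -1 <= x <= 1 -> `|f x - p.[x]| <= e.
Proof.
move=> fc e0; have [|p Hp] := @bernstein_approx (fun t => f (-1 + 2 * t)) e _ e0.
  move=> t; apply: (@continuous_comp _ _ _ (fun t : R => -1 + 2 * t) f); last exact: fc.
  exact: is_derive_continuous (is_derive_affine (-1) 2 t).
exists (p \Po ((2^-1)%:P * ('X + 1))) => x /andP[x1 x2].
rewrite horner_comp !hornerE.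
have := Hp (2^-1 * (x + 1)); have -> : -1 + 2 * (2^-1 * (x + 1)) = x by field.
by apply; apply/andP; split; lra.
Qed.

End weierstrass.

(** * Density of the functions [(1 - x^2) p] *)

Section polynomial_density.
Context {R : realType}.
Local Notation mu := (@lebesgue_measure R).
Local Notation weight := (@weight R).
Local Notation itv11 := (@itv11 R).
Implicit Types (x : R) (f g h : R -> R).

#[local] Hint Extern 0 (measurable _) => solve [exact: measurable_itv11R | exact: measurable_itv11] : core.

Lemma sqr_weight_ge0 f x : itv11 x -> 0 <= f x ^+ 2 * weight x.
Proof. by move=> /weight_gt0/ltW w0; apply: mulr_ge0 => //; exact: sqr_ge0. Qed.

(** The threshold concerns [h w] rather than [h], because [h w] is what the polynomial has to
    approximate. *)
Definition tail h (N : nat) x := if `|h x * weight x| <= N%:R then 0 else h x.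

Lemma measurable_tail h N : measurable_fun itv11 h -> measurable_fun itv11 (tail h N).
Proof.
move=> mh; apply: measurable_fun_if => //.
- apply: measurable_fun_ler => //; apply: measurableT_comp => //.
  by apply: measurable_funM => //; exact: measurable_weight.
- by apply: measurable_funS mh => //; exact: subIsetl.
Qed.

Lemma tail_sqint h N : real_sqint h -> real_sqint (tail h N).
Proof.
move=> [mh hi]; have mt := measurable_tail N mh; split=> //.
apply: (le_integrable _ _ _ hi) => //.
  apply/measurable_EFinP/measurable_funM; last exact: measurable_weight.
  exact: measurable_funX.
move=> x xI /=; rewrite lee_fin !ger0_norm ?sqr_weight_ge0//.
by rewrite /tail; case: ifP => // _; rewrite expr0n/= mul0r sqr_weight_ge0.
Qed.

Lemma tail_wnorm2 h (e : R) : real_sqint h -> 0 < e ->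
  exists N, (0 < N)%N /\ wnorm2 (tail h N) < e.
Proof.
move=> sh e0; have [mh hi] := sh.
have [||||||_ _ tcvg] := @dominated_convergence _ _ _ mu itv11 _
  (fun N => EFin \o (fun x => tail h N x ^+ 2 * weight x)) (cst 0%E)
  (EFin \o (fun x => h x ^+ 2 * weight x)).
- exact: measurable_itv11.
- by move=> N; case: (tail_sqint N sh) => _ /integrableP[].
- exact: measurable_cst.
- apply/aeW => x xI; apply: cvg_near_cst.
  exists (truncn `|h x * weight x|).+1 => // n /= nx.
  rewrite /tail ifT ?expr0n/= ?mul0r//.
  by rewrite (le_trans (ltW (truncnS_gt _)))// ler_nat.
- exact: hi.
- apply/aeW => x N xI /=; rewrite lee_fin ger0_norm ?sqr_weight_ge0//.
  by rewrite /tail; case: ifP => // _; rewrite expr0n/= mul0r sqr_weight_ge0.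
rewrite integral0 in tcvg.
have : (fine \o (fun N => \int[mu]_(x in itv11) (tail h N x ^+ 2 * weight x)%:E)%E) @ \oo --> (0:R).
  exact: fine_cvg tcvg.
(* The successor makes the truncation level positive, as it later occurs in a denominator. *)
move=> /cvgrPdist_lt/(_ _ e0)[N _ /(_ N.+1 (leqnSn N))] /=; rewrite sub0r normrN => tN.
by exists N.+1; split=> //; apply: le_lt_trans tN; exact: ler_norm.
Qed.

Lemma continuous_approx_L1 f (e : R) : mu.-integrable itv11 (EFin \o f) -> 0 < e ->
  exists g, [/\ continuous g, mu.-integrable itv11 (EFin \o (fun x => `|f x - g x|)) &
    \int[mu]_(x in itv11) `|f x - g x| < e].
Proof.
move=> fi e0; have [||g_ [gc gi gcvg]] := approximation_continuous_integrable _ _ fi.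
- exact: measurable_itv11.
- by have := ltry (2 : R); rewrite -mu_itv11.
have : (fine \o (fun n => \int[mu]_(z in itv11) `|(f z - g_ n z)%:E|)%E) @ \oo --> (0:R).
  exact: fine_cvg gcvg.
move=> /cvgrPdist_lt/(_ _ e0)[N _ /(_ N (leqnn N))] /=; rewrite sub0r normrN => tN.
exists (g_ N); split=> //.
  have := integrable_abse (integrable_EFinD measurable_itv11R fi
    (integrable_EFinZ (-1) measurable_itv11R (gi N))).
  by apply: eq_integrable => // x _ /=; rewrite mulN1r.
exact: le_lt_trans (ler_norm _) tN.
Qed.

Definition clip (N : R) g x := Num.min N (Num.max (- N) (g x)).

Lemma continuous_clip (N : R) g : continuous g -> continuous (clip N g).
Proof.
move=> gc; apply: (@min_fun_continuous _ R R (cst N) (cst (- N) \max g)).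
  exact: cst_continuous.
by apply: max_fun_continuous; first exact: cst_continuous.
Qed.

(** Clipping to [[-N, N]] brings [g x] no further from [v] and leaves a distance of at most [2 N].
    The product of the two bounds turns an [L^1] estimate into an [L^2] one. *)
Lemma clip_dist (N v : R) g x : `|v| <= N -> (v - clip N g x) ^+ 2 <= 2 * N * `|v - g x|.
Proof.
move=> vN; rewrite -real_normK ?num_real// expr2.
have [H1 H2] : `|v - clip N g x| <= `|v - g x| /\ `|v - clip N g x| <= 2 * N.
  move: vN; rewrite /clip ler_norml => /andP[v1 v2].
  have [H1|H1] := leP (- N) (g x); [have [H2|H2] := leP N (g x)|have [H2|H2] := leP N (- N)];
    split; rewrite ler_norml; apply/andP; split; have := ler_norm (v - g x);
    have := ler_norm (- (v - g x)); rewrite normrN; lra.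
by apply: ler_pM.
Qed.

(* With [u = h w] the error is the integral of [(u - p)^2 (1 - x^2)]: truncate
   [u] at level [N], replace it by a clipped continuous function, and use the
   Weierstrass theorem. *)
Lemma polynomial_density h (e : R) : real_sqint h -> 0 < e -> exists p : {poly R},
  wnorm2 (fun x => h x - (1 - x ^+ 2) * p.[x]) < e.
Proof.
(* The error is at most [3 |tail|^2 + 6 N |v - g|_1 + 6 eta^2], where [|tail|] is the weighted norm;
   the bounds [e / 12], [e / (24 N)] and [e / 24] make each term at most [e / 4]. *)
move=> sh e0; have e12 : 0 < e / 12 by rewrite divr_gt0.
have [N [N0 tN]] := tail_wnorm2 sh e12.
have N0R : 0 < N%:R :> R by rewrite ltr0n.
pose v x := (h x - tail h N x) * weight x.
have vN x : `|v x| <= N%:R.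
  by rewrite /v /tail; case: ifP => [|_]; rewrite ?subr0// subrr mul0r normr0 ltW.
have mv : measurable_fun itv11 v.
  apply: measurable_funM; last exact: measurable_weight.
  by apply: measurable_funB; [case: sh|apply: measurable_tail; case: sh].
have vi : mu.-integrable itv11 (EFin \o v).
  apply: (le_integrable _ _ _ (integrable_cst11 N%:R)) => //.
    exact/measurable_EFinP.
  by move=> x _ /=; rewrite lee_fin (le_trans (vN x))// ler_norm.
have d0 : 0 < e / (24 * N%:R) by rewrite divr_gt0// mulr_gt0.
have [g [gc gi gd]] := continuous_approx_L1 vi d0.
pose eta := Num.min 1 (e / 24).
have eta0 : 0 < eta by rewrite lt_min ltr01 divr_gt0.
have eta1 : eta <= 1 by rewrite ge_min lexx.
have eta2 : eta <= e / 24 by rewrite ge_min lexx orbT.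
have [p Hp] := weierstrass11 (continuous_clip (N := N%:R) gc) eta0.
exists p.
have [_ ti] := tail_sqint N sh.
pose b x := (3 * (tail h N x ^+ 2 * weight x) + 6 * N%:R * `|v x - g x|) + 3 * eta ^+ 2.
have bi : mu.-integrable itv11 (EFin \o b).
  apply: integrable_EFinD => //; last exact: integrable_cst11.
  by apply: integrable_EFinD => //; exact: integrable_EFinZ.
have bE : \int[mu]_(x in itv11) b x = 3 * wnorm2 (tail h N) +
    6 * N%:R * \int[mu]_(x in itv11) `|v x - g x| + 6 * eta ^+ 2.
  rewrite RintegralD//; first last.
  - exact: integrable_cst11.
  - by apply: integrable_EFinD => //; exact: integrable_EFinZ.
  rewrite RintegralD//; [|exact: integrable_EFinZ..].
  have -> : \int[mu]_(_ in itv11) (3 * eta ^+ 2) = 6 * eta ^+ 2.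
    by rewrite Rintegral_cst//= mu_itv11/=; ring.
  by rewrite !RintegralZl.
(* With [q = 1 - x^2] the difference is [tail + q (v - clip) + q (clip - p)]. Since [q w = 1] and
   [q <= 1], its weighted square is at most three times the sum of [tail^2 w] and the squares of the
   two brackets. *)
have fb x : itv11 x -> (h x - (1 - x ^+ 2) * p.[x]) ^+ 2 * weight x <= b x.
  move=> xI; have w0 := weight_gt0 xI; move/itv11P: xI => /andP[x1 x2].
  have q0 : 0 < 1 - x ^+ 2 by nra.
  have q1 : 1 - x ^+ 2 <= 1 by nra.
  have qw : (1 - x ^+ 2) * weight x = 1 by rewrite /weight divff// gt_eqF.
  have A2 := @clip_dist N%:R (v x) g x (vN x).
  have B2 : (clip N%:R g x - p.[x]) ^+ 2 <= eta ^+ 2.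
    rewrite -[leLHS]real_normK ?num_real// ler_sqr ?nnegrE ?(ltW eta0)//.
    by apply: Hp; rewrite !ltW.
  have hE : h x = tail h N x + (1 - x ^+ 2) * v x.
    by rewrite /v mulrCA qw mulr1 addrC subrK.
  rewrite {1}hE; move: A2 B2; rewrite /b.
  move: (tail h N x) (v x) (clip _ _ _) p.[x] (g x) (weight x) (1 - x ^+ 2) w0 q0 q1 qw.
  move=> t u c z gx w q w0 q0 q1 qw A2 B2.
  have -> : t + q * u - q * z = t + q * (u - c) + q * (c - z) by ring.
  move: (u - c) (c - z) A2 B2 => A B A2 B2.
  have E : (t + q * A + q * B) ^+ 2 * w = t ^+ 2 * w + q * A ^+ 2 + q * B ^+ 2 +
      2 * t * A + 2 * t * B + 2 * q * A * B.
    have -> : (t + q * A + q * B) ^+ 2 * w = t ^+ 2 * w + q * A ^+ 2 * (q * w) +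
      q * B ^+ 2 * (q * w) + 2 * t * A * (q * w) + 2 * t * B * (q * w) +
      2 * q * A * B * (q * w) by ring.
    by rewrite qw !mulr1.
  rewrite E.
  have C1 : 2 * t * A <= t ^+ 2 * w + q * A ^+ 2.
    have : 0 <= (t * w - A) ^+ 2 * q by rewrite mulr_ge0 ?sqr_ge0// ltW.
    have -> : (t * w - A) ^+ 2 * q = t ^+ 2 * w * (q * w) + q * A ^+ 2 - 2 * t * A * (q * w) by ring.
    rewrite qw; lra.
  have C2 : 2 * t * B <= t ^+ 2 * w + q * B ^+ 2.
    have : 0 <= (t * w - B) ^+ 2 * q by rewrite mulr_ge0 ?sqr_ge0// ltW.
    have -> : (t * w - B) ^+ 2 * q = t ^+ 2 * w * (q * w) + q * B ^+ 2 - 2 * t * B * (q * w) by ring.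
    rewrite qw; lra.
  have C3 : 2 * q * A * B <= q * A ^+ 2 + q * B ^+ 2.
    have : 0 <= q * (A - B) ^+ 2 by rewrite mulr_ge0 ?sqr_ge0// ltW.
    have -> : q * (A - B) ^+ 2 = q * A ^+ 2 + q * B ^+ 2 - 2 * q * A * B by ring.
    lra.
  have D1 : q * A ^+ 2 <= A ^+ 2 by rewrite ler_piMl ?sqr_ge0.
  have D2 : q * B ^+ 2 <= B ^+ 2 by rewrite ler_piMl ?sqr_ge0.
  lra.
apply: (@le_lt_trans _ _ (\int[mu]_(x in itv11) b x)).
  have mp : measurable_fun itv11 (fun x => h x - (1 - x ^+ 2) * p.[x]).
    apply: measurable_funB; first by case: sh.
    apply: open_continuous_measurable_fun; first exact: itv_open.
    move=> x _; apply: (@cvgM R _ _ _ (fun x => 1 - x ^+ 2) (fun x => p.[x])).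
      by apply: cvgB; [exact: cvg_cst|exact: exprn_continuous].
    exact: continuous_horner.
  apply: le_Rintegral => //.
  apply: (le_integrable _ _ _ bi) => //.
    apply/measurable_EFinP/measurable_funM; last exact: measurable_weight.
    exact: measurable_funX.
  move=> x xI /=; rewrite lee_fin ger0_norm; first exact: le_trans (fb x xI) (ler_norm _).
  exact: (@sqr_weight_ge0 (fun x => h x - (1 - x ^+ 2) * p.[x]) x xI).
rewrite bE.
have E2 : 6 * N%:R * \int[mu]_(x in itv11) `|v x - g x| < e / 4.
  have -> : e / 4 = 6 * N%:R * (e / (24 * N%:R)) by field; rewrite gt_eqF.
  by rewrite ltr_pM2l// mulr_gt0.
have E3 : eta ^+ 2 <= eta by rewrite expr2 ler_piMr// ltW.
move: (\int[mu]_(x in itv11) `|v x - g x|) E2 => I E2.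
lra.
Qed.

End polynomial_density.

(** * Eigenpolynomials *)

Section jacobi_polynomials.
Context {R : idomainType}.
Implicit Types (p q : {poly R}).

Definition jpoly q := (1 - 'X^2) * q.

(* [- (1 - x^2) y''] for [y = jpoly q], divided by [1 - x^2]. *)
Definition jop q := - (jpoly q)^`()^`().

Lemma coef_jpoly q i : (jpoly q)`_i.+2 = q`_i.+2 - q`_i.
Proof. by rewrite /jpoly mulrBl mul1r coefB coefXnM /= subn2. Qed.

Lemma coef_jop q i : (jop q)`_i = (i.+2 * i.+1)%:R * (q`_i - q`_i.+2).
Proof.
rewrite /jop coefN !coef_deriv coef_jpoly -mulrnA -mulNrn opprB.
by rewrite mulr_natl.
Qed.

End jacobi_polynomials.

Section eigenpolynomials.
Context {F : numFieldType}.
Implicit Types (p q : {poly F}) (n i j : nat).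

Definition jlam n : F := (n.+2 * n.+1)%:R.

Lemma jlam_inj : injective jlam.
Proof.
have lt m n : (m < n)%N -> jlam m != jlam n.
  by move=> mn; rewrite eqr_nat ltn_eqF// ltn_mul.
move=> m n; case: (ltngtP m n) => [/lt|/lt|//]; last rewrite eq_sym.
  by move/eqP.
by move/eqP.
Qed.

(* The coefficient of X^(n - j) in the monic eigenpolynomial of degree n. *)
Fixpoint eigencoef n j : F := match j with
  | 0 => 1
  | 1 => 0
  | j'.+2 => jlam (n - j) / (jlam (n - j) - jlam n) * eigencoef n j'
  end.

Definition eigenpoly n := \poly_(i < n.+1) eigencoef n (n - i).

Lemma coef_eigenpoly n i : (eigenpoly n)`_i = if (i <= n)%N then eigencoef n (n - i) else 0.
Proof. by rewrite coef_poly ltnS. Qed.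

(** Comparing coefficients of X^i gives [lam_i (q_i - q_(i+2)) = lam_n q_i], which is the recursion
    defining [eigencoef]; distinct eigenvalues make it solvable. *)
Lemma jop_eigenpoly n : jop (eigenpoly n) = jlam n *: eigenpoly n.
Proof.
apply/polyP => i; rewrite coef_jop coefZ !coef_eigenpoly -/(jlam i).
have [i1|i1|->] := ltngtP i n; last first.
- by rewrite (leq_gtF (leqnSn _)) subr0.
- by rewrite (leq_gtF (leqW (ltnW i1))) subrr !mulr0.
have [i2|i2|i2] := ltngtP i.+1 n; last 2 first.
- by move: i2; rewrite ltnNge i1.
- by rewrite -i2 subSnn /= subr0 !mulr0.
rewrite -(subnSK i1) -(subnSK i2) /= !subnSK// (subKn (ltnW i1)).
have d0 : jlam i - jlam n != 0 by rewrite subr_eq0 (inj_eq jlam_inj) ltn_eqF.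
move: (eigencoef _ _) (jlam i) (jlam n) d0 => c a b d0.
by field.
Qed.

Lemma size_eigenpoly n : size (eigenpoly n) = n.+1.
Proof. by apply: size_poly_eq; rewrite subnn oner_neq0. Qed.

Lemma eigenpoly_span n p : (size p <= n)%N ->
  exists a : nat -> F, p = \sum_(i < n) a i *: eigenpoly i.
Proof.
elim: n p => [|n IHn] p pn.
  by exists (fun=> 0); rewrite big_ord0; apply/eqP; rewrite -size_poly_leq0.
have [|a pa] := IHn (p - p`_n *: eigenpoly n).
  apply/leq_sizeP => j nj; rewrite coefB coefZ coef_eigenpoly.
  have [->|jn] := eqVneq j n; first by rewrite leqnn subnn mulr1 subrr.
  have nj' : (n < j)%N by rewrite ltn_neqAle eq_sym jn.
  by rewrite leqNgt nj' mulr0 subr0; move/leq_sizeP: pn; apply.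
exists (fun i => if i == n then p`_n else a i).
rewrite big_ord_recr/= eqxx -[LHS](subrK (p`_n *: eigenpoly n)) pa.
by congr (_ + _); apply: eq_bigr => i _; rewrite ltn_eqF.
Qed.

End eigenpolynomials.

(** * Eigenvectors in the weighted space *)

Section eigenvectors.
Context {R : realType}.
Local Notation C := R[i].
Local Notation mu := (@lebesgue_measure R).
Local Notation weight := (@weight R).
Local Notation itv11 := (@itv11 R).
Local Notation Re := (@complex.Re R).
Local Notation Im := (@complex.Im R).
Implicit Types (x y : R) (p q r : {poly R}).

#[local] Hint Extern 0 (measurable _) => solve [exact: measurable_itv11R | exact: measurable_itv11] : core.

Lemma horner_integrable x y p : mu.-integrable `[x, y] (EFin \o horner p).
Proof.
apply: continuous_compact_integrable; first exact: segment_compact.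
exact/continuous_subspaceT/continuous_horner.
Qed.

Lemma horner_FTC x y p : x <= y ->
  \int[mu]_(t in `[x, y]) p^`().[t] = p.[y] - p.[x].
Proof.
rewrite le_eqVlt => /predU1P[->|xy]; first by rewrite set_itv1 Rintegral_set1 subrr.
rewrite /Rintegral (@continuous_FTC2 _ _ (horner p)) => //.
- exact/continuous_subspaceT/continuous_horner.
- split=> [z _||]; first exact: derivable_horner.
    exact/cvg_at_right_filter/continuous_horner.
  exact/cvg_at_left_filter/continuous_horner.
- by move=> z _; rewrite derivE.
Qed.

Lemma horner_FTC11 p : \int[mu]_(t in itv11) p^`().[t] = p.[1] - p.[-1].
Proof.
rewrite -horner_FTC ?lerN10// /itv11.
have pi := horner_integrable (-1) 1 p^`().
rewrite Rintegral_itv_bndo_bndc; last first.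
  by apply: integrableS pi => //; exact: subset_itv_oo_cc.
rewrite Rintegral_itv_obnd_cbnd//.
by apply: integrableS pi => //; exact: subset_itv_oc_cc.
Qed.

Lemma jpolyE q x : (jpoly q).[x] = (1 - x ^+ 2) * q.[x].
Proof. by rewrite /jpoly hornerM hornerD hornerN hornerXn hornerC. Qed.

Lemma jpoly_sqint q : real_sqint (horner (jpoly q)).
Proof.
have N11 : (-1 : R) <= 1 by lra.
have [|c _ Hc] := @EVT_max R (fun x => `|q.[x]|) (-1) 1 N11.
  apply: continuous_subspaceT => x; apply: continuous_comp.
    exact: continuous_horner.
  exact: norm_continuous.
apply: (@bounded_real_sqint _ _ (`|q.[c]| ^+ 2) _ _).1.
  exact: measurable_poly.
move=> x /andP[x1 x2]; rewrite jpolyE exprMn.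
have := Hc x; rewrite in_itv/= (ltW x1) (ltW x2) => /(_ isT) qc.
have : q.[x] ^+ 2 <= `|q.[c]| ^+ 2.
  by rewrite -[leLHS]real_normK ?num_real// ler_sqr ?nnegrE.
have := sqr_ge0 q.[x]; have : 0 <= 1 - x ^+ 2 <= 1 by apply/andP; split; nra.
move: (q.[x] ^+ 2) (_ ^+ 2) (1 - _) => A B d /andP[d0 d1] A0 AB.
by rewrite [leRHS]mulrC expr2 -mulrA ler_pM// ?mulr_ge0// (le_trans _ AB)// ler_piMl.
Qed.

Lemma jpoly_solution q : real_solution (horner (jpoly q)) (horner (jpoly (jop q))).
Proof.
split=> [x _|x y x1 xy y1]; first exact: derivable_horner.
rewrite -derivE -horner_FTC//; apply: eq_Rintegral => t.
rewrite inE => /(sub_itv11 x1 y1) tI; rewrite /source jpolyE.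
have /itv11P/andP[t1 t2] := tI; rewrite /jop hornerN /weight.
by field; apply: lt0r_neq0; nra.
Qed.

(** A complex polynomial is carried as the pair of its real and imaginary parts [q] and [r]. *)
Definition jfun q r x : C := ((jpoly q).[x] +i* (jpoly r).[x])%C.

Lemma jfun_square_integrable q r : square_integrable (jfun q r).
Proof. by apply/square_integrable_ReIm; split; exact: jpoly_sqint. Qed.

Definition jvec q r : L2 R := sval (cid (L2_of_fun (jfun_square_integrable q r))).

Lemma jvecP q r : eq_ae (jvec q r) (jfun q r).
Proof. by rewrite /jvec; case: cid. Qed.

Lemma jvec_unique (F : L2 R) q r : eq_ae F (jfun q r) -> F = jvec q r.
Proof.
move=> Fq; apply/L2P; exact: eq_ae_trans Fq (eq_ae_sym (jvecP q r)).
Qed.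

Lemma jvecD q r q' r' : jvec q r + jvec q' r' = jvec (q + q') (r + r').
Proof.
apply: jvec_unique; rewrite -[jvec q r]scale1r; apply: eq_ae_trans (L2_funP _ _ _) _.
move: (jvecP q r) (jvecP q' r'); rewrite /eq_ae; apply: filterS2 => x + + xI.
move=> /(_ xI) + /(_ xI); rewrite !fctE => -> ->; rewrite scale1r.
by rewrite /jfun /jpoly !mulrDr !hornerD.
Qed.

Lemma jvec0 : jvec 0 0 = 0.
Proof. by apply: (addrI (jvec 0 0)); rewrite jvecD !addr0. Qed.

Lemma jvecZ (z : C) q : z *: jvec q 0 = jvec (Re z *: q) (Im z *: q).
Proof.
apply: jvec_unique; rewrite -[z *: _]addr0 -jvec0; apply: eq_ae_trans (L2_funP _ _ _) _.
move: (jvecP q 0) (jvecP 0 0); rewrite /eq_ae; apply: filterS2 => x + + xI.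
move=> /(_ xI) + /(_ xI); rewrite !fctE => -> ->; rewrite /jfun !jpolyE !hornerZ horner0 mulr0 addr0.
rewrite ![(1 - _) * (_ * q.[x])]mulrCA; move: ((1 - _) * q.[x]) => w.
by case: z => a b; rewrite [LHS]/((a +i* b)%C * _) /=; congr Complex; ring.
Qed.

Lemma solution_op_jvec q r : solution_op (jvec (jop q) (jop r)) = jvec q r.
Proof.
apply/esym/solution_opE; exists (jfun q r); first exact: jvecP.
have [sr si] := L2_real_sqint (jvec (jop q) (jop r)).
have jv := jvecP (jop q) (jop r).
split.
  apply: (ae_real_solution (jpoly_sqint (jop q)) sr) (jpoly_solution q).
  by move: jv; rewrite /eq_ae; apply: filterS => x + xI => /(_ xI) ->.
apply: (ae_real_solution (jpoly_sqint (jop r)) si) (jpoly_solution r).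
by move: jv; rewrite /eq_ae; apply: filterS => x + xI => /(_ xI) ->.
Qed.

Lemma jop0 : jop 0 = 0 :> {poly R}.
Proof. by rewrite /jop /jpoly mulr0 !deriv0 oppr0. Qed.

(** The points [1 / 2], [1 / 3], ... supply as many distinct roots as the size of [p]. *)
Lemma horner11_eq0 p : (forall x, -1 < x < 1 -> p.[x] = 0) -> p = 0.
Proof.
move=> p0; apply: (@roots_geq_poly_eq0 _ _ [seq i.+2%:R^-1 | i <- iota 0 (size p)]).
- apply/allP => _ /mapP[i _ ->]; apply/eqP/p0.
  rewrite (lt_trans (ltrN10 _)) ?invr_gt0 ?ltr0n//= invf_lt1 ?ltr0n// ltr1n.
  by [].
- rewrite map_inj_uniq ?iota_uniq// => i j /invr_inj/eqP.
  by rewrite eqr_nat !eqSS => /eqP.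
- by rewrite size_map size_iota.
Qed.

Definition evec n := jvec (eigenpoly n) 0.

Lemma solution_op_evec n : solution_op ((jlam n)%:C%C *: evec n) = evec n.
Proof.
rewrite /evec jvecZ /= scale0r -jop_eigenpoly.

by rewrite -[X in jvec (jop _) X]jop0 solution_op_jvec.
Qed.

(** A zero class makes the polynomial vanish only almost everywhere. Its source is a multiple of it
    and then vanishes almost everywhere too, so uniqueness of solutions gives zero at every point of
    [(-1, 1)]. *)
Lemma evec_neq0 n : evec n != 0.
Proof.
apply/eqP; rewrite -jvec0 /evec => e0; set q := eigenpoly n in e0.
have q0 : {ae mu, forall x, itv11 x -> (jpoly (jop q)).[x] = (jpoly 0).[x]}.
  move: (jvecP q 0) (jvecP 0 0); rewrite e0 /eq_ae; apply: filterS2 => x + + xI.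
  move=> /(_ xI) H1 /(_ xI); rewrite H1 => -[q0].
  rewrite jop_eigenpoly -/q /jpoly -scalerAr hornerZ.
  by rewrite -/(jpoly _) q0 /jpoly mulr0 horner0 mulr0.
have s0 := ae_real_solution (jpoly_sqint _) (jpoly_sqint _) q0 (jpoly_solution q).

have s1 := jpoly_solution 0; rewrite jop0 in s1.
have : jpoly q = 0.
  apply: horner11_eq0 => x xI.
  rewrite (real_solution_unique (jpoly_sqint 0) (jpoly_sqint q) (jpoly_sqint 0) s0 s1 xI).
  by rewrite /jpoly mulr0 horner0.
move=> /(congr1 (fun p => size p)); rewrite size_poly0 /jpoly => /eqP.
rewrite size_poly_eq0 mulf_eq0 => /orP[|].
  move/eqP/(congr1 (fun p => p.[0])); rewrite hornerD hornerN hornerXn hornerC horner0 expr0n/=.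
  by move/eqP; rewrite subr0 oner_eq0.
by rewrite -size_poly_eq0 size_eigenpoly.
Qed.

(** The weighted inner product of [jpoly p] and [jpoly q]: one factor [1 - x^2] cancels the weight
    and the integrand is a polynomial. *)
Definition jdot p q := \int[mu]_(x in itv11) (jpoly p * q).[x].

Lemma horner_integrable11 p : mu.-integrable itv11 (EFin \o horner p).
Proof.
by apply: integrableS (horner_integrable (-1) 1 p) => //; exact: subset_itv_oo_cc.
Qed.

(** Lagrange's identity: the difference of the integrands is the derivative of [P Q' - P' Q], which
    vanishes at both endpoints because [P] and [Q] contain the factor [1 - x^2]. *)
Lemma jop_sym p q : jdot (jop p) q = jdot p (jop q).
Proof.
have I r := horner_integrable11 r.
apply/eqP; rewrite -subr_eq0 -RintegralB//; apply/eqP.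
have E : jpoly (jop p) * q - jpoly p * jop q =
    (jpoly p * (jpoly q)^`() - (jpoly p)^`() * jpoly q)^`().
  have -> : jpoly (jop p) * q = jop p * jpoly q by rewrite /jpoly mulrCA mulrA.
  by rewrite /jop; move: (jpoly p) (jpoly q) => P Q; rewrite derivB !derivM; ring.
under eq_Rintegral do rewrite -hornerN -hornerD E.
have J1 r : (jpoly r).[1] = 0 by rewrite jpolyE; ring.
have J2 r : (jpoly r).[-1] = 0 by rewrite jpolyE; ring.
rewrite horner_FTC11; move: (J1 p) (J1 q) (J2 p) (J2 q).
move: (jpoly p) (jpoly q) => P Q p1 q1 p2 q2.
by rewrite !(hornerD, hornerN, hornerM) p1 q1 p2 q2; ring.
Qed.

Lemma jdotZl (a : R) p q : jdot (a *: p) q = a * jdot p q.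
Proof.
rewrite /jdot -RintegralZl//; last exact: horner_integrable11.
by apply: eq_Rintegral => x _; rewrite /jpoly -scalerAr -scalerAl hornerZ.
Qed.

Lemma jdotZr (a : R) p q : jdot p (a *: q) = a * jdot p q.
Proof.
rewrite /jdot -RintegralZl//; last exact: horner_integrable11.
by apply: eq_Rintegral => x _; rewrite -scalerAr hornerZ.
Qed.

Lemma jvec_dot p q : L2_inner R (jvec p 0) (jvec q 0) = (jdot p q)%:C%C.
Proof.
have sp := jfun_square_integrable p 0; have sq := jfun_square_integrable q 0.
have [Jp Jq] : square_integrable (jvec p 0) /\ square_integrable (jvec q 0).
  by split; exact: L2_square_integrable.
have -> : L2_inner R (jvec p 0) (jvec q 0) = wdot (jfun p 0) (jfun q 0).
  rewrite -[LHS]/(wdot (jvec p 0) (jvec q 0)) (eq_ae_wdotl Jp sp Jq (jvecP p 0)).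
  by rewrite wdotC// (eq_ae_wdotl Jq sq sp (jvecP q 0)) -wdotC.
rewrite wdotE; congr Complex.
  apply: eq_Rintegral => x; rewrite inE => xI; rewrite /wre /jfun/= [RHS]hornerM.
  have -> : jpoly 0 = 0 :> {poly R} by rewrite /jpoly mulr0.
  rewrite horner0 mulr0 addr0 [(jpoly q).[x]]jpolyE /weight.
  by move: xI => /itv11P/andP[x1 x2]; field; apply: lt0r_neq0; nra.
under eq_Rintegral => x _.
  have -> : wim (jfun p 0) (jfun q 0) x = 0.
    by rewrite /wim /jfun/= /jpoly !mulr0 horner0 !mul0r mulr0 subrr mul0r.
  over.
by rewrite Rintegral_cst//= mul0r.
Qed.

Lemma evec_orth m n : m != n -> L2_inner R (evec m) (evec n) = 0.
Proof.
move=> mn; rewrite /evec jvec_dot; have := jop_sym (eigenpoly m) (eigenpoly n).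
rewrite !jop_eigenpoly jdotZl jdotZr => /eqP; rewrite -subr_eq0 -mulrBl mulf_eq0.
by rewrite subr_eq0 (inj_eq jlam_inj) (negbTE mn) /= => /eqP ->.
Qed.

Lemma sqnorm_jvec (H : L2 R) p q : sqnorm (L2_inner R) (H - jvec p q) =
  wnorm2 (fun x => Re (H x) - (1 - x ^+ 2) * p.[x]) +
  wnorm2 (fun x => Im (H x) - (1 - x ^+ 2) * q.[x]).
Proof.
have [Hr Hi] := L2_real_sqint H.
have ReB x : Re (H x - jfun p q x) = Re (H x) - (1 - x ^+ 2) * p.[x].
  by rewrite /jfun jpolyE; case: (H x).
have ImB x : Im (H x - jfun p q x) = Im (H x) - (1 - x ^+ 2) * q.[x].
  by rewrite /jfun [(jpoly q).[x]]jpolyE; case: (H x).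
rewrite (@sqnorm_L2E _ _ (fun x => H x - jfun p q x)).
- by congr (wnorm2 _ + wnorm2 _); apply/funext => x; rewrite ?ReB ?ImB.
- apply/square_integrable_ReIm; split.
    apply: eq_real_sqint (real_sqint_lin (-1) (jpoly_sqint p) Hr) => x _.
    by rewrite ReB jpolyE; ring.
  apply: eq_real_sqint (real_sqint_lin (-1) (jpoly_sqint q) Hi) => x _.
  by rewrite ImB jpolyE; ring.
- apply: eq_ae_trans (L2_sub_ae _ _) _; have := jvecP p q; rewrite /eq_ae.
  by apply: filterS => x + xI => /(_ xI) ->.
Qed.

Lemma jvec_sum (a b : nat -> R) n :
  lincomb evec (fun i => (a i +i* b i)%C) n =
  jvec (\sum_(i < n) a i *: eigenpoly i) (\sum_(i < n) b i *: eigenpoly i).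
Proof.
elim: n => [|n IHn]; first by rewrite /lincomb !big_ord0 jvec0.
rewrite /lincomb !big_ord_recr/= -jvecD -IHn.
by rewrite /evec jvecZ.
Qed.

Lemma evec_dense (H : L2 R) (r : R) : 0 < r ->
  exists a n, sqnorm (L2_inner R) (H - lincomb evec a n) < r.
Proof.
move=> r0; have r2 : 0 < r / 2 by rewrite divr_gt0.
have [Hr Hi] := L2_real_sqint H.
have [p Hp] := polynomial_density Hr r2; have [q Hq] := polynomial_density Hi r2.
have [a pa] := @eigenpoly_span _ (maxn (size p) (size q)) p (leq_maxl _ _).
have [b qb] := @eigenpoly_span _ (maxn (size p) (size q)) q (leq_maxr _ _).
exists (fun i => (a i +i* b i)%C), (maxn (size p) (size q)).
rewrite jvec_sum -pa -qb sqnorm_jvec; lra.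
Qed.

Lemma jlam_ge n : n.+1%:R <= jlam n :> R.
Proof. by rewrite ler_nat leq_pmull. Qed.

End eigenvectors.

Theorem mainTheorem2 (R : realType) (k : R) (k_ge0 : 0 <= k) :
  [/\ unbounded_operator (L2_inner R) (jacobi_operator k),
      self_adjoint (L2_inner R) (jacobi_operator k) &
      spectrum (L2_inner R) (jacobi_operator k) =
        [set l : R[i] | exists2 n : nat, (2 <= n)%N &
           l = n%:R * (n%:R - 1) + k%:C%C]].
Proof.
rewrite jacobi_operator_graph.
split.
- exact: (inverse_graph_unbounded solution_op_lin solution_op_bounded
    jlam_ge evec_neq0 solution_op_evec evec_orth evec_dense).
- exact: (inverse_graph_self_adjoint solution_op_lin solution_op_bounded
    jlam_ge solution_op_evec evec_orth evec_dense).
rewrite (inverse_graph_spectrum solution_op_lin solution_op_bounded solution_op_complete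
  jlam_ge evec_neq0 solution_op_evec evec_orth evec_dense).
(* With [m = n + 2] the eigenvalue [(n + 2) (n + 1)] reads [m (m - 1)], so the indices start at
   2. *)
have lamE n : (jlam n + k)%:C%C = n.+2%:R * (n.+2%:R - 1) + k%:C%C :> R[i].
  by rewrite rmorphD /jlam rmorph_nat natrM -[X in _ = _ * (X - 1) + _]natr1 addrK.
apply/seteqP; split=> l /= [n]; first by move=> ->; exists n.+2; rewrite ?lamE.
by case: n => [|[|n]]// _ ->; exists n; rewrite lamE.
Qed.
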